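(* Let $R$ be a commutative ring with $1$, $x=(x_1,\dots,x_n)$, $f=(f_1,\dots,f_s)\in R[x]^s$. Let $J$ be the difference Jacobian for some choice of $\nabla f(x,y)$ and $\Phi_J:C(x_*,\hat f_* )\to C(x,\hat f)$ the $J$-map. Suppose that $H_0(x,\hat f)=R[x]/(f_1,\dots,f_s)$ is a finitely generated $R$-module. Then there exist $e\in Z(x_*,\hat f_* )$ of degree $n-s$ and $t\in C(x,\hat f)$ with $$\Phi_J(e)=1+\partial t ,$$ and the map $C(x,\hat f)\to C(x_*,\hat f_* )$, $c\mapsto e\cdot c$, is homotopy inverse to $\Phi_J$, and induces the inverse of the map $\Phi_J$ on homology. Precisely, there exist $R$-linear maps $\mathcal R,\mathcal L:C(x,\hat f)\to C(x,\hat f)$ of degree $1$ such that: 1. for all $c\in C(x,\hat f)$: $\ c-\Phi_J(e\cdot c)=\partial(\mathcal R(c))+\mathcal R(\partial c)$; 2. for all $c\in C(x_*,\hat f_* )$: $\ c-e\cdot\Phi_J(c)=c\circ(\partial\mathcal L+\mathcal L\partial)$; 3. for all $c\in Z(x,\hat f)$: $\ c-\Phi_J(e\cdot c)=\partial(\mathcal R(c))$; 4. for all homogeneous $c\in Z(x_*,\hat f_* )$: $\ c-e\cdot\Phi_J(c)=\partial\big[(-1)^{|c|}\,c\circ\mathcal L\big]$. Moreover: 5. $H_0(x,\hat f)$ and $H_{-s+n}(x_*,\hat f_* )$ are finitely generated $R$-modules.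
   Context: Koszul complexes. $C(x,\hat f)=R[x]\otimes_R\Lambda(\hat f_1,\dots,\hat f_s)$ (exterior algebra on free generators of degree $1$) with $\partial$ the $R[x]$-linear odd derivation ($\partial(ab)=\partial(a)b+(-1)^{|a|}a\,\partial(b)$) such that $\partial\hat f_i=f_i(x)$. With $y=(y_1,\dots,y_n)$ a copy of $x$, $C(x,y,\hat f_x,\hat f_y)=R[x,y]\otimes_R\Lambda(\hat f_{1,x},\dots,\hat f_{s,x},\hat f_{1,y},\dots,\hat f_{s,y})$, with $\partial\hat f_{i,x}=f_i(x)$, $\partial\hat f_{i,y}=f_i(y)$. Dual complex. $C(x_*,\hat f_* )=\bigoplus_r C_{-r}(x_*,\hat f_* )$, $C_{-r}(x_*,\hat f_* )=\operatorname{Hom}_R(C_r(x,\hat f),R)$ (functionals extended by $0$ to other degrees); $c.b$ denotes the value of $c$ at $b$; $\partial[c].b=-(-1)^{|c|}c.(\partial b)$. For $a\in C(x,\hat f)$, $c\cdot a$ is the functional $b\mapsto c.(ab)$. For both complexes $Z$ denotes cycles ($\partial=0$), $H$ homology, subscripts denote degree. Kernel maps. For $G\in C(x,y,\hat f_x,\hat f_y)$ write $G=\sum_jp_j(x,\hat f_x)\,b_j(y,\hat f_y)$ with $p_j,b_j\in C(x,\hat f)$ homogeneous (after renaming variables). For homogeneous $c\in C(x_*,\hat f_* )$ put $\Phi_G(c)=(-1)^{|c|}\sum_jp_j\cdot(c.b_j)\in C(x,\hat f)$, extended linearly in $c$. Choice of $\nabla f$. $C(x,y,\hat u)=R[x,y]\otimes_R\Lambda(\hat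 u_1,\dots,\hat u_n)$, $|\hat u_k|=1$, with $\partial$ the $R[x,y]$-linear odd derivation such that $\partial\hat u_k=x_k-y_k$. A difference homotopy operator is an $R[y]$-linear map $\nabla:C(x,y,\hat u)\to C(x,y,\hat u)$ of degree $1$ with $(\partial\nabla+\nabla\partial)(c)=c(x,y,\hat u)-c(y,y,0)$ for all $c$ (the last term is the substitution $x_k\mapsto y_k,\ \hat u_k\mapsto 0$). For $F\in R[x]$ write $\nabla(F)=\sum_k\hat u_k\nabla^kF(x,y)$, so $F(x)-F(y)=\sum_k(x_k-y_k)\nabla^kF(x,y)$. A choice of $\nabla f(x,y)$ is the matrix $(\nabla^kf_i(x,y))_{k\le n,i\le s}$ obtained from some difference homotopy operator. Difference Jacobian. $J=\sum_{I\subseteq\{1,\dots,s\},|I|=n}\operatorname{sgn}(I,I^c)\det(\nabla^kf_i(x,y))_{1\le k\le n,\,i\in I}\prod_{j\in I^c}(\hat f_{j,x}-\hat f_{j,y})\in C(x,y,\hat f_x,\hat f_y)$, where $I$ and its complement $I^c$ are listed increasingly, the product is in increasing order, and $\operatorname{sgn}(I,I^c)$ is the sign of the permutation of $(1,\dots,s)$ listing first $I$ then $I^c$. It has degree $s-n$ and $\Phi_J$ commutes with boundaries up to the sign $(-1)^{s-n}$. *)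

(* Defs.v *)
From HB Require Import structures.
From mathcomp Require Import all_boot all_order all_algebra.
From mathcomp Require Import ssrcomplements mpoly.
From mathcomp Require Import ring.

Set Implicit Arguments.
Unset Strict Implicit.
Unset Printing Implicit Defensive.

Import GRing.Theory.

Local Open Scope ring_scope.

(* The exterior algebra over A on m free generators of degree 1 is encoded by *)
(* coordinates in the basis h_I = h_{i1} ... h_{ir}, for                      *)
(* I = {i1 < ... < ir} a subset of 'I_m. The pointwise product of {ffun} is   *)
(* never used: the product is [wedge].                                        *)
Definition ext (A : comNzRingType) (m : nat) := {ffun {set 'I_m} -> A}.

Section ExteriorAlgebra.
Variables (A : comNzRingType) (m : nat).
Implicit Types (I J K : {set 'I_m}) (a b : ext A m).

(* For disjoint I and J: sign of the permutation listing first I, then J, both *)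
(* increasingly, relative to the increasing list of I :|: J.                  *)
Definition sgn I J : A := \prod_(i in I) \prod_(j in J) (-1) ^+ (j < i)%N.

Definition ext_mon (q : A) I : ext A m := [ffun K => if K == I then q else 0].

Definition ext_const (q : A) : ext A m := ext_mon q set0.

Definition ext_one : ext A m := ext_const 1.

Definition ext_gen (i : 'I_m) : ext A m := ext_mon 1 [set i].

Definition ext_scale (q : A) a : ext A m := [ffun K => q * a K].

(* h_I h_J = sgn I J h_{I :|: J} if I and J are disjoint, and 0 otherwise.    *)
Definition wedge a b : ext A m :=
  [ffun K : {set 'I_m} => \sum_(I : {set 'I_m} | I \subset K)
    sgn I (K :\: I) * a I * b (K :\: I)].

Definition has_deg (r : nat) a : Prop := forall I, #|I| != r -> a I = 0.

Definition hpart (r : nat) a : ext A m :=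
  [ffun I : {set 'I_m} => if #|I| == r then a I else 0].

(* Koszul differential: in coordinates,                                       *)
(*   d h_I = \sum_(i in I) (-1)^#{j in I, j < i} g_i h_{I \ i}.               *)
(* It is A-linear, maps h_i to g_i and is an odd derivation                   *)
(* ([koszul_gen] and [koszul_wedge] below), which characterizes it.           *)
Definition koszul (g : 'I_m -> A) a : ext A m :=
  [ffun K : {set 'I_m} => \sum_(i | i \notin K) sgn [set i] K * g i * a (i |: K)].

(* a |-> (-1)^|a| a, extended linearly.                                       *)
Definition ext_twist a : ext A m := [ffun I : {set 'I_m} => (-1) ^+ #|I| * a I].

Definition degree_one (h : ext A m -> ext A m) : Prop :=
  forall r a, has_deg r a -> has_deg r.+1 (h a).

Lemma sgn0l J : sgn set0 J = 1.
Proof. by rewrite /sgn big_set0. Qed.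

Lemma sgn0r I : sgn I set0 = 1.
Proof. by rewrite /sgn big1 // => i _; rewrite big_set0. Qed.

Lemma sgnUl I I' J : [disjoint I & I'] -> sgn (I :|: I') J = sgn I J * sgn I' J.
Proof.
by move=> dI; rewrite /sgn (eq_bigl [predU I & I']) ?bigU // => i; rewrite !inE.
Qed.

Lemma sgnUr I J J' : [disjoint J & J'] -> sgn I (J :|: J') = sgn I J * sgn I J'.
Proof.
move=> dJ; rewrite /sgn -big_split; apply: eq_bigr => i _.
by rewrite -bigU //; apply: eq_bigl => j; rewrite !inE.
Qed.

Lemma sgn_sq I J : sgn I J * sgn I J = 1.
Proof.
rewrite /sgn -big_split big1 //= => i _; rewrite -big_split big1 //= => j _.
by rewrite -expr2 sqrr_sign.
Qed.

Lemma sgn_comm1 i I : i \notin I -> sgn I [set i] * sgn [set i] I = (-1) ^+ #|I|.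
Proof.
move=> iI; rewrite /sgn big_set1 -big_split /= -prodr_const; apply: eq_bigr => j jI.
rewrite big_set1 -signr_addb.
by case: ltngtP => //= /val_inj ij; case/negP: iI; rewrite ?ij // -ij.
Qed.

Lemma koszul_gen g i : koszul g (ext_gen i) = ext_const (g i).
Proof.
apply/ffunP=> K; rewrite !ffunE.
have [->|K0] := eqVneq K set0.
  rewrite (bigD1 i) ?inE //= big1 ?addr0 => [|j /andP[_ ji]].
    by rewrite setU0 ffunE eqxx sgn0r mul1r mulr1.
  by rewrite setU0 ffunE (inj_eq set1_inj) (negbTE ji) mulr0.
apply: big1 => j jK; rewrite ffunE ifN ?mulr0 //; apply: contraNneq K0 => e.
apply/eqP/setP=> k; rewrite inE; apply/negbTE/negP=> kK.
have : k \in j |: K by rewrite inE kK orbT.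
have : j \in j |: K by rewrite setU11.
by rewrite e !inE => /eqP ji /eqP ki; rewrite ji -ki kK in jK.
Qed.

Lemma koszul_wedge g a b : koszul g (wedge a b) =
  wedge (koszul g a) b + wedge (ext_twist a) (koszul g b).
Proof.
have disj1 i I : i \notin I -> [disjoint [set i] & I] by rewrite disjoints1.
have big_ins i K (F : {set 'I_m} -> A) : i \notin K ->
    \sum_(I : {set 'I_m} | (I \subset i |: K) && (i \in I)) F I =
    \sum_(I : {set 'I_m} | I \subset K) F (i |: I).
  move=> iK; rewrite (reindex_onto (fun I => i |: I) (fun I => I :\ i)) /=.
    apply: eq_bigl => I; rewrite setU11 andbT.
    apply/andP/idP=> [[/subsetP sI /eqP eI]|sI].
      apply/subsetP=> j jI; have := sI j; rewrite !inE jI orbT => /(_ isT).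
      by case/predU1P=> // ji; move: jI; rewrite -eI ji !inE eqxx.
    rewrite setUS // setU1K //; apply: contraNN iK; exact: (subsetP sI).
  by move=> I /andP[_ iI]; rewrite setD1K.
apply/ffunP=> K; rewrite !ffunE.
under eq_bigr do rewrite ffunE mulr_sumr.
under [X in _ = X + _]eq_bigr do rewrite ffunE mulr_sumr mulr_suml.
under [X in _ = _ + X]eq_bigr do rewrite !ffunE mulr_sumr.
rewrite [X in _ = X + _](exchange_big_dep xpredT) //= [X in _ = _ + X](exchange_big_dep xpredT) //=.
rewrite -big_split [LHS]big_mkcond /=; apply: eq_bigr => i _.
have [iK|iK] := boolP (i \in K) => /=.
  apply/esym/eqP; rewrite addr_eq0 -sumrN; apply/eqP.
  pose K' := K :\ i; have eK : i |: K' = K by rewrite setD1K.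
  have iK' : i \notin K' by rewrite !inE eqxx.
  have sub_ni I : (I \subset K) && (i \notin I) = (I \subset K').
    by rewrite subsetD1.
  rewrite (eq_bigl _ _ sub_ni).
  have sub_i I : (I \subset K) && (i \notin K :\: I) =
      (I \subset i |: K') && (i \in I).
    by rewrite eK !inE iK andbT negbK.
  rewrite (eq_bigl _ _ sub_i) big_ins //; apply: eq_bigr => I sI.
  have iI : i \notin I by apply: contraNN iK'; exact: (subsetP sI).
  have iKI : i \notin K' :\: I by rewrite inE (negbTE iK') andbF.
  have -> : K :\: I = i |: (K' :\: I).
    by rewrite -eK setDUl; congr (_ :|: _); apply/setDidPl; rewrite disj1.
  have -> : K :\: (i |: I) = K' :\: I by rewrite setDDl.
  rewrite sgnUr ?disj1 // sgnUl ?disj1 // cardsU1 iI exprS -(sgn_comm1 iI).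
  have := sgn_sq [set i] (K' :\: I).
  set u := sgn [set i] (K' :\: I) => uu.
  by rewrite -[LHS]mul1r -[X in X * _ = _]uu; ring.
rewrite (bigID (fun I : {set 'I_m} => i \in I)) /=.
rewrite big_ins //; congr (_ + _).
  apply: eq_big => I; first by rewrite andbC; case: (boolP (I \subset K)) => [/subsetP sI|];
    rewrite ?andbF // andbT; apply/esym; apply: contraNN iK; apply: sI.
  move=> sI.
  have iI : i \notin I by apply: contraNN iK; exact: (subsetP sI).
  have iKI : i \notin K :\: I by rewrite inE (negbTE iK) andbF.
  have -> : (i |: K) :\: (i |: I) = K :\: I.
    apply/setP=> j; rewrite !inE.
    by case: eqVneq => [->|]; rewrite ?(negbTE iK) ?andbF.
  have eIK : I :|: (K :\: I) = K by rewrite -[RHS](setID K I) (setIidPr sI).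
  have dIK : [disjoint I & K :\: I].
    by rewrite disjoints_subset; apply/subsetP=> j; rewrite !inE => ->.
  have eK : sgn [set i] K = sgn [set i] I * sgn [set i] (K :\: I).
    by rewrite -sgnUr // eIK.
  rewrite eK sgnUl ?disj1 //.
  have := sgn_sq [set i] (K :\: I); set u := sgn [set i] (K :\: I) => uu.
  by rewrite -[RHS]mul1r -[X in _ = X * _]uu; ring.
apply: eq_big => I.
  rewrite !inE (negbTE iK) andbF andbT.
  apply/andP/idP=> [[/subsetP sI iI]|/subsetP sI].
    apply/subsetP=> j jI; have := sI j jI; rewrite !inE => /predU1P[ji|//].
    by rewrite -ji jI in iI.
  split; first by apply/subsetP=> j /sI jK; rewrite !inE jK orbT.
  by apply: contraNN iK; apply: sI.
case/andP=> /subsetP sI' iI.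
have sI : I \subset K.
  apply/subsetP=> j jI; have := sI' j jI; rewrite !inE => /predU1P[ji|//].
  by rewrite -ji jI in iI.
have iKI : i \notin K :\: I by rewrite inE (negbTE iK) andbF.
have -> : (i |: K) :\: I = i |: (K :\: I).
  by rewrite setDUl; congr (_ :|: _); apply/setDidPl; rewrite disj1.
have eIK : I :|: (K :\: I) = K by rewrite -[RHS](setID K I) (setIidPr sI).
have dIK : [disjoint I & K :\: I].
  by rewrite disjoints_subset; apply/subsetP=> j; rewrite !inE => ->.
have eK : sgn [set i] K = sgn [set i] I * sgn [set i] (K :\: I).
  by rewrite -sgnUr // eIK.
by rewrite eK sgnUr ?disj1 // -(sgn_comm1 iI); ring.
Qed.

End ExteriorAlgebra.

(* C(x, hat f) is [koszul_alg R n s] with differential [koszul f]. In       *)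
(* R[x, y] = {mpoly R[n + n]}, x_k is 'X_(lshift n k) and y_k is              *)
(* 'X_(rshift n k); in C(x, y, hat f_x, hat f_y), encoded as                  *)
(* [ext {mpoly R[n + n]} (s + s)], the generators hat f_{i,x} and hat f_{i,y} *)
(* are those of index lshift s i and rshift s i.                              *)

Notation koszul_alg R n s := (ext {mpoly R[n]} s).

Section TwoSetsOfVariables.
Variables (R : comNzRingType) (n : nat).

Definition emb_x (p : {mpoly R[n]}) : {mpoly R[n + n]} :=
  p \mPo [tuple 'X_(lshift n k) | k < n].

Definition emb_y (p : {mpoly R[n]}) : {mpoly R[n + n]} :=
  p \mPo [tuple 'X_(rshift n k) | k < n].

Definition x_to_y (p : {mpoly R[n + n]}) : {mpoly R[n + n]} :=
  p \mPo [tuple match split k with inl i | inr i => 'X_(rshift n i) end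
         | k < n + n].

Definition diff_xy (k : 'I_n) : {mpoly R[n + n]} :=
  'X_(lshift n k) - 'X_(rshift n k).

(* Operators on C(x, y, hat u) = ext {mpoly R[n + n]} n.                      *)
Definition difference_homotopy
    (nabla : ext {mpoly R[n + n]} n -> ext {mpoly R[n + n]} n) : Prop :=
  [/\ forall a b, nabla (a + b) = nabla a + nabla b,
      forall (q : {mpoly R[n]}) a,
        nabla (ext_scale (emb_y q) a) = ext_scale (emb_y q) (nabla a),
      degree_one nabla
    & forall c, koszul diff_xy (nabla c) + nabla (koszul diff_xy c) =
                c - ext_const n (x_to_y (c set0))].

Definition nabla_coef nabla (F : {mpoly R[n]}) (k : 'I_n) : {mpoly R[n + n]} :=
  (nabla (ext_const n (emb_x F)) : ext {mpoly R[n + n]} n) [set k].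

Definition difference_jacobian (s : nat) nabla (f : 'I_s -> {mpoly R[n]}) :
    ext {mpoly R[n + n]} (s + s) :=
  \sum_(I : {set 'I_s} | #|I| == n)
    ext_scale
      (sgn {mpoly R[n + n]} I (~: I) *
       \det (\matrix_(k < n, l < n)
               nth 0 [seq nabla_coef nabla (f i) k | i <- enum I] l))
      (\big[@wedge _ _/ext_one _ _]_(j <- enum (~: I))
         (ext_gen _ (lshift s j) - ext_gen _ (rshift s j))).

End TwoSetsOfVariables.

Section DualComplex.
Variables (R : comNzRingType) (n s : nat) (f : 'I_s -> {mpoly R[n]}).
Local Notation C := (koszul_alg R n s).
Implicit Types (c : C -> R) (a b : C).

(* The exterior algebra has finitely many nonzero degrees, so the elements of *)
(* the dual complex are exactly the R-linear functionals {scalar C}. The      *)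
(* operations below are defined on all functions C -> R; they preserve        *)
(* R-linearity. Equality of functionals is pointwise.                         *)

(* c is an element of degree d of the dual complex.                           *)
Definition dual_has_deg (d : int) c : Prop :=
  forall (r : nat) b, has_deg r b -> r%:Z != - d -> c b = 0.

(* The linear extension of c |-> (-1)^|c| c to all functionals is             *)
(* c |-> c \o ext_twist: see [dual_twist_homog].                              *)
Definition dual_diff c : C -> R := fun b => - c (ext_twist (koszul f b)).

(* c . a                                                                      *)
Definition dual_act c a : C -> R := fun b => c (wedge a b).

Definition dual_cycle c : Prop := forall b, dual_diff c b = 0.

(* The kernel map, computed on the expansion of G into products               *)
(*   (g x^m hat f_{I,x}) (y^m' hat f_{K,y}), with g in R;                     *)
(* [kernel_map_split] gives its value on an arbitrary decomposition of G.     *)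
Definition mon_x (m : 'X_{1..n + n}) : 'X_{1..n} :=
  [multinom m (lshift n k) | k < n].
Definition mon_y (m : 'X_{1..n + n}) : 'X_{1..n} :=
  [multinom m (rshift n k) | k < n].
Definition set_x (S : {set 'I_(s + s)}) : {set 'I_s} := [set i | lshift s i \in S].
Definition set_y (S : {set 'I_(s + s)}) : {set 'I_s} := [set i | rshift s i \in S].

Definition kernel_map (G : ext {mpoly R[n + n]} (s + s)) c : C :=
  \sum_(S : {set 'I_(s + s)}) \sum_(m <- msupp (G S))
    c (ext_twist (ext_mon 'X_[mon_y m] (set_y S))) *:
      ext_mon ((G S)@_m *: 'X_[mon_x m]) (set_x S).

Definition ext_emb_x a : ext {mpoly R[n + n]} (s + s) :=
  \sum_(I : {set 'I_s}) ext_mon (emb_x (a I)) (@lshift s s @: I).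
Definition ext_emb_y a : ext {mpoly R[n + n]} (s + s) :=
  \sum_(I : {set 'I_s}) ext_mon (emb_y (a I)) (@rshift s s @: I).

(* Finite generation of H_r(x, hat f) = Z_r / B_r ...                         *)
Definition fin_gen_homology (r : nat) : Prop :=
  exists (k : nat) (z : 'I_k -> C),
    (forall i, has_deg r (z i) /\ koszul f (z i) = 0) /\
    forall a, has_deg r a -> koszul f a = 0 ->
      exists (g : 'I_k -> R) (w : C),
        has_deg r.+1 w /\ a = \sum_i g i *: z i + koszul f w.

(* ... and of the degree d homology of the dual complex.                      *)
Definition fin_gen_dual_homology (d : int) : Prop :=
  exists (k : nat) (z : 'I_k -> {scalar C}),
    (forall i, dual_has_deg d (z i) /\ dual_cycle (z i)) /\
    forall c : {scalar C}, dual_has_deg d c -> dual_cycle c ->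
      exists (g : 'I_k -> R) (w : {scalar C}),
        dual_has_deg (d + 1) w /\
        forall b, c b = \sum_i g i * z i b + dual_diff w b.

(* R[x]/(f_1, ..., f_s) is a finitely generated R-module.                     *)
Definition fin_gen_quotient : Prop :=
  exists (k : nat) (z : 'I_k -> {mpoly R[n]}),
    forall p : {mpoly R[n]},
      exists (g : 'I_k -> R) (h : 'I_s -> {mpoly R[n]}),
        p = \sum_i g i *: z i + \sum_j h j * f j.

Lemma dual_twist_homog (c : {scalar C}) (d : int) b :
  dual_has_deg d c -> c (ext_twist b) = (-1) ^+ `|d|%N * c b.
Proof.
move=> cd.
have {1}-> : ext_twist b = \sum_(r < s.+1) (-1) ^+ r *: hpart r b.
  apply/ffunP=> I; rewrite sum_ffunE ffunE.
  have lt : (#|I| < s.+1)%N by rewrite ltnS -[X in (_ <= X)%N]card_ord max_card.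
  rewrite (bigD1 (Ordinal lt)) //= big1 ?addr0 => [|r rI].
    by rewrite !ffunE eqxx -signr_odd mulr_sign -signr_odd scaler_sign.
  by rewrite !ffunE ifN ?scaler0 // eq_sym.
have deco_b : b = \sum_(r < s.+1) hpart r b.
  apply/ffunP=> I; rewrite sum_ffunE.
  have lt : (#|I| < s.+1)%N by rewrite ltnS -[X in (_ <= X)%N]card_ord max_card.
  rewrite (bigD1 (Ordinal lt)) //= big1 ?addr0 => [|r rI]; rewrite ffunE ?eqxx //.
  by rewrite ifN // eq_sym.
rewrite [in RHS]deco_b !linear_sum mulr_sumr; apply: eq_bigr => r _; rewrite linearZ /=.
have hr : has_deg r (hpart r b) by move=> I rI; rewrite ffunE (negbTE rI).
have [er|ne] := eqVneq (r%:Z) (- d); last by rewrite (cd _ _ hr ne) !mulr0.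
by rewrite -abszN -er absz_nat.
Qed.

(* The linear extension of 'X_[m] |-> F m. *)
Let lin (V : lmodType R) (F : 'X_{1..n + n} -> V) (q : {mpoly R[n + n]}) : V :=
  \sum_(m <- msupp q) q@_m *: F m.

Let linE (V : lmodType R) (F : 'X_{1..n + n} -> V) k q : (msize q <= k)%N ->
  lin F q = \sum_(m : bmultinom (n + n) k) q@_m *: F m.
Proof.
move=> le; pose I : subFinType _ := bmultinom (n + n) k.
rewrite /lin (big_mksub I) ?msupp_uniq //=; first last.
  by move=> x /msize_mdeg_lt /leq_trans; apply.
rewrite big_rmcond //= => i; move/memN_msupp_eq0 ->.
by rewrite scale0r.
Qed.

Let linP (V : lmodType R) (F : 'X_{1..n + n} -> V) : linear (lin F).
Proof.
move=> g p q; pose k := maxn (msize (g *: p + q)) (maxn (msize p) (msize q)).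
rewrite !(@linE _ _ k) ?leq_max ?leqnn ?orbT // scaler_sumr -big_split.
by apply: eq_bigr => m _; rewrite mcoeffD mcoeffZ scalerDl scalerA.
Qed.

Let linX (V : lmodType R) (F : 'X_{1..n + n} -> V) m : lin F 'X_[m] = F m.
Proof. by rewrite /lin msuppX big_seq1 mcoeffX eqxx scale1r. Qed.

Let ker1 (c : C -> R) (S : {set 'I_(s + s)}) (m : 'X_{1..n + n}) : C :=
  c (ext_twist (ext_mon 'X_[mon_y m] (set_y S))) *: ext_mon 'X_[mon_x m] (set_x S).

Let kernel_mapE G c : kernel_map G c = \sum_S lin (ker1 c S) (G S).
Proof.
apply: eq_bigr => S _; apply: eq_bigr => m _; rewrite /ker1 scalerA mulrC -scalerA.
congr (_ *: _); apply/ffunP=> I; rewrite !ffunE.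
by case: eqP; rewrite ?scaler0.
Qed.

Lemma kernel_map_is_linear c : linear (kernel_map ^~ c).
Proof.
move=> g G H; rewrite !kernel_mapE scaler_sumr -big_split.
by apply: eq_bigr => S _; rewrite !ffunE linP.
Qed.

Let join (m1 m2 : 'X_{1..n}) : 'X_{1..n + n} :=
  [multinom match split k with inl i => m1 i | inr i => m2 i end | k < n + n].

Let mon_x_join m1 m2 : mon_x (join m1 m2) = m1.
Proof. by apply/mnmP=> i; rewrite !mnmE (unsplitK (inl i)). Qed.

Let mon_y_join m1 m2 : mon_y (join m1 m2) = m2.
Proof. by apply/mnmP=> i; rewrite !mnmE (unsplitK (inr i)). Qed.

Let emb_X m1 m2 : emb_x 'X_[m1] * emb_y 'X_[m2] = 'X_[join m1 m2] :> {mpoly R[n + n]}.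
Proof.
rewrite /emb_x /emb_y /comp_mpoly !mmapX /mmap1 [RHS]mpolyXE_id big_split_ord /=.
by congr (_ * _); apply: eq_bigr => i _;
  rewrite tnth_mktuple mnmE ?(unsplitK (inl i)) ?(unsplitK (inr i)).
Qed.

Let mp_ext (V : lmodType R) (F G : {mpoly R[n]} -> V) : linear F -> linear G ->
  (forall m, F 'X_[m] = G 'X_[m]) -> F =1 G.
Proof.
move=> linF linG eFG p.
pose F' : {linear _ -> V} := HB.pack F (GRing.isLinear.Build R {mpoly R[n]} V *:%R F linF).
pose G' : {linear _ -> V} := HB.pack G (GRing.isLinear.Build R {mpoly R[n]} V *:%R G linG).
rewrite -[F p]/(F' p) -[G p]/(G' p) [in LHS](mpolyE p) [in RHS](mpolyE p) !linear_sum.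
by apply: eq_bigr => m _; rewrite !linearZ /= eFG.
Qed.

Let ext_mon_linear K : linear (fun q : {mpoly R[n]} => ext_mon q K : C).
Proof.
move=> g u v; apply/ffunP=> I; rewrite !ffunE; case: eqP => _ //.
by rewrite scaler0 addr0.
Qed.

Let ext_twist_linear : linear (@ext_twist {mpoly R[n]} s : C -> C).
Proof. by move=> g u v; apply/ffunP=> I; rewrite !ffunE mulrDr scalerAr. Qed.

Let ker1_emb (c : {scalar C}) S p q :
  lin (ker1 c S) (emb_x p * emb_y q) =
  c (ext_twist (ext_mon q (set_y S))) *: ext_mon p (set_x S).
Proof.
pose L p q := lin (ker1 c S) (emb_x p * emb_y q).
pose M p q := c (ext_twist (ext_mon q (set_y S))) *: (ext_mon p (set_x S) : C).
apply: (mp_ext (F := L^~ q) (G := M^~ q)) => [g u v|g u v|m].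
- by rewrite /L /emb_x linearP mulrDl -scalerAl linP.
- by rewrite /M ext_mon_linear scalerDr !scalerA mulrC.
apply: (mp_ext (F := L _) (G := M _)) => [g u v|g u v|m'].
- by rewrite /L /emb_y linearP mulrDr -scalerAr linP.
- by rewrite /M ext_mon_linear ext_twist_linear linearP scalerDl scalerA.
by rewrite /L /M emb_X linX /ker1 mon_x_join mon_y_join.
Qed.

Lemma ext_emb_xE a S :
  ext_emb_x a S = if S == @lshift s s @: set_x S then emb_x (a (set_x S)) else 0.
Proof.
have set_xK (I : {set 'I_s}) : set_x (@lshift s s @: I) = I.
  by apply/setP=> i; rewrite inE mem_imset //; apply: lshift_inj.
rewrite sum_ffunE; case: eqP => [eS|neS].
  rewrite (bigD1 (set_x S)) //= ffunE -eS eqxx big1 ?addr0 // => I neI.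
  by rewrite ffunE; case: eqP => // e; case/eqP: neI; rewrite e set_xK.
by rewrite big1 // => I _; rewrite ffunE; case: eqP => // e; case: neS; rewrite e set_xK.
Qed.

Lemma ext_emb_yE a S :
  ext_emb_y a S = if S == @rshift s s @: set_y S then emb_y (a (set_y S)) else 0.
Proof.
have set_yK (I : {set 'I_s}) : set_y (@rshift s s @: I) = I.
  by apply/setP=> i; rewrite inE mem_imset //; apply: rshift_inj.
rewrite sum_ffunE; case: eqP => [eS|neS].
  rewrite (bigD1 (set_y S)) //= ffunE -eS eqxx big1 ?addr0 // => I neI.
  by rewrite ffunE; case: eqP => // e; case/eqP: neI; rewrite e set_yK.
by rewrite big1 // => I _; rewrite ffunE; case: eqP => // e; case: neS; rewrite e set_yK.
Qed.

Lemma wedge_emb a b S :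
  wedge (ext_emb_x a) (ext_emb_y b) S = emb_x (a (set_x S)) * emb_y (b (set_y S)).
Proof.
rewrite ffunE; pose X := @lshift s s @: set_x S; pose Y := @rshift s s @: set_y S.
have memX i : (lshift s i \in X) = (lshift s i \in S).
  by rewrite mem_imset ?inE //; apply: lshift_inj.
have memXr i : (rshift s i \in X) = false.
  by apply/negP=> /imsetP[j _ /eqP]; rewrite eq_rlshift.
have memY i : (rshift s i \in Y) = (rshift s i \in S).
  by rewrite mem_imset ?inE //; apply: rshift_inj.
have memYl i : (lshift s i \in Y) = false.
  by apply/negP=> /imsetP[j _ /eqP]; rewrite eq_lrshift.
have XS : X \subset S by apply/subsetP=> _ /imsetP[i iX ->]; rewrite inE in iX.
have SX : S :\: X = Y.
  apply/setP=> k; rewrite inE; case: (split_ordP k) => i ->.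
    by rewrite memX memYl andNb.
  by rewrite memXr memY.
have setxX : set_x X = set_x S by apply/setP=> i; rewrite !inE memX.
have setyY : set_y Y = set_y S by apply/setP=> i; rewrite !inE memY.
rewrite (bigD1 X) //= SX ext_emb_xE ext_emb_yE setxX setyY !eqxx.
rewrite /sgn big1 ?mul1r => [|_ /imsetP[i _ ->]]; last first.
  by rewrite big1 // => _ /imsetP[j _ ->]; rewrite ltnNge ltnW ?expr0 //= ltn_addr.
rewrite big1 ?addr0 // => I /andP[IS neI]; rewrite ext_emb_xE ext_emb_yE.
case: eqP => [eI|_]; last by rewrite mulr0 mul0r.
case: eqP => [eY|_]; last by rewrite mulr0.
case/eqP: neI; apply/setP=> k; case: (split_ordP k) => i ->.
  have := congr1 (fun A : {set _} => lshift s i \in A) eY.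
  rewrite memX !inE; case: (boolP (_ \in I)) => [/(subsetP IS)->//|_] /=.
  by move->; apply/esym/negbTE/negP=> /imsetP[j _ /eqP]; rewrite eq_lrshift.
by rewrite memXr eI; apply/negbTE/negP=> /imsetP[j _ /eqP]; rewrite eq_rlshift.
Qed.

Lemma ext_sum_mon a : a = \sum_I ext_mon (a I) I.
Proof.
apply/ffunP=> K; rewrite sum_ffunE (bigD1 K) //= ffunE eqxx big1 ?addr0 // => I neI.
by rewrite ffunE eq_sym (negbTE neI).
Qed.

Lemma kernel_map_wedge (c : {scalar C}) p b :
  kernel_map (wedge (ext_emb_x p) (ext_emb_y b)) c = c (ext_twist b) *: p.
Proof.
rewrite kernel_mapE.
under eq_bigr do rewrite wedge_emb ker1_emb.
rewrite (reindex (fun IK : {set 'I_s} * {set 'I_s} =>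
   (@lshift s s @: IK.1) :|: (@rshift s s @: IK.2))) /=; last first.
  exists (fun S => (set_x S, set_y S)) => [[I K] _|S _] /=.
    congr pair; apply/setP=> i; rewrite !inE.
      rewrite mem_imset; last exact: lshift_inj.
      by case: imsetP => [[j _ /eqP]|_]; rewrite ?eq_lrshift ?orbF.
    rewrite orbC mem_imset; last exact: rshift_inj.
    by case: imsetP => [[j _ /eqP]|_]; rewrite ?eq_rlshift ?orbF.
  apply/setP=> k; rewrite !inE; case: (split_ordP k) => i ->.
    rewrite mem_imset ?inE; last exact: lshift_inj.
    by case: imsetP => [[j _ /eqP]|_]; rewrite ?eq_lrshift ?orbF.
  rewrite orbC mem_imset ?inE; last exact: rshift_inj.
  by case: imsetP => [[j _ /eqP]|_]; rewrite ?eq_rlshift ?orbF.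
have sx (I K : {set 'I_s}) : set_x ((@lshift s s @: I) :|: (@rshift s s @: K)) = I.
  apply/setP=> i; rewrite !inE mem_imset; last exact: lshift_inj.
  by case: imsetP => [[j _ /eqP]|_]; rewrite ?eq_lrshift ?orbF.
have sy (I K : {set 'I_s}) : set_y ((@lshift s s @: I) :|: (@rshift s s @: K)) = K.
  apply/setP=> i; rewrite !inE orbC mem_imset; last exact: rshift_inj.
  by case: imsetP => [[j _ /eqP]|_]; rewrite ?eq_rlshift ?orbF.
under eq_bigr do rewrite sx sy.
rewrite -(pair_bigA _ (fun I K => c (ext_twist (ext_mon (b K) K)) *: ext_mon (p I) I)) /=.
rewrite [in RHS](ext_sum_mon p) scaler_sumr; apply: eq_bigr => I _.
rewrite -scaler_suml; congr (_ *: _).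
pose T : {linear C -> C} :=
  HB.pack (@ext_twist {mpoly R[n]} s) (GRing.isLinear.Build R C C *:%R _ ext_twist_linear).
by rewrite [in RHS](ext_sum_mon b) -[ext_twist _]/(T _) !linear_sum.
Qed.

Lemma kernel_map_split (c : {scalar C}) (d : int) (k : nat) (p b : 'I_k -> C) :
  dual_has_deg d c ->
  kernel_map (\sum_j wedge (ext_emb_x (p j)) (ext_emb_y (b j))) c =
  (-1) ^+ `|d|%N *: \sum_j c (b j) *: p j.
Proof.
move=> cd.
pose T : {linear ext {mpoly R[n + n]} (s + s) -> C} :=
  HB.pack (kernel_map ^~ c)
    (GRing.isLinear.Build R (ext {mpoly R[n + n]} (s + s)) C *:%R _ (kernel_map_is_linear c)).
rewrite -[LHS]/(T _) linear_sum scaler_sumr; apply: eq_bigr => j _.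
by rewrite /= kernel_map_wedge (dual_twist_homog _ cd) scalerA.
Qed.
End DualComplex.

(* Main.v *)
(* For each i, gamma_i = hat f_{i,x} - hat f_{i,y} - \sum_k (nabla^k f_i) hat u_k  *)
(* is a cycle of C(x, y, hat f_x, hat f_y, hat u), and J is, up to sign, the      *)
(* coefficient of hat u_1 ... hat u_n in P = gamma_1 ... gamma_s. As gamma_i P = 0, *)
(* multiplication by P turns hat f_{i,x} into hat f_{i,y} + \sum_k (nabla^k f_i)  *)
(* hat u_k, and the homotopy nabla, extended linearly over C(y, hat f_y), shows   *)
(* that c(x) J and c(y) J are homotopic. Evaluating e on the y-variables gives    *)
(* c Phi_J(e) ~ Phi_J(e . c), and evaluating it on the x-variables gives the      *)
(* homotopy e . Phi_J(c) ~ c, provided Phi_J(e) = 1 modulo (f) and likewise with  *)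
(* x and y exchanged.                                                             *)
(*   To construct e: by Cayley-Hamilton, (f) contains a monic polynomial          *)
(* g_l(x_l) = \sum_i a_{li} f_i for each l. Let rho be the residue of g_1, ..., g_n, *)
(* i.e. the functional killing (g) and dual to the top monomial, and let          *)
(* alpha_l = \sum_i a_{li} hat f_i. Then e(b) is, up to sign, rho of the          *)
(* coefficient of hat f_1 ... hat f_s in alpha_1 ... alpha_n b. Computing in the  *)
(* same Koszul algebra, Phi_J(e) is the residue of the determinant of difference  *)
(* quotients of the g_l modulo (f), which does not depend on their choice modulo  *)
(* (g) and equals 1 for the quotients (g_l(x_l) - g_l(y_l)) / (x_l - y_l).        *)

Require Import Defs.
From HB Require Import structures.
From mathcomp Require Import all_boot all_order all_algebra.
From mathcomp Require Import perm fingroup ssrcomplements mpoly.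
From mathcomp Require Import ring.

Set Implicit Arguments.
Unset Strict Implicit.
Unset Printing Implicit Defensive.

Import GRing.Theory.

Local Open Scope ring_scope.

(** * The exterior algebra as a ring *)

(** Write P for [gam_prod]. In front of P the generator f_{i,x} may be replaced by f_{i,y} + [theta]
    i, because gamma_i P = 0 ([prod_odd_subst], [iota_sigma]). Move c(x) in this way into C(y, hat
    u, hat f_y), apply nabla there ([nabla_ext_homotopy]), multiply by the cycle P and take the top
    coefficient in hat u, which is a chain map ([ext_top_koszul]). The result is an operator h with
    (c(x) - c(y)) J = d h(c) + h(d c): this is [jac_homotopyP], the core of the proof.

    Both homotopies are this identity integrated against a cycle e of degree n - s. Over the
    y-variables, c(x) J becomes c Phi(e) and c(y) J becomes Phi(e . c) ([KM_ext_x], [KM_dact],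
    [right_homotopy]). Over the x-variables one obtains the value of e . Phi(c) at b ([dact_KM],
    [left_homotopy]). The second computation exchanges x and y, which turns J, up to sign, into the
    Jacobian of another matrix of difference quotients ([swap_jac]). Hence Phi(e) = 1 + d t is
    proved for every such matrix ([KM_dual_one]), with t depending on the matrix.

    The functional e is [residue], built from monic one-variable polynomials g_l in the ideal
    ([monic_in_ideal]) and the functional [mres], which kills them. It is a cycle because d of
    alpha_l is g_l ([residue_cycle]). To compute Phi(e), put f_{i,x} = 0 in P: then f_{i,y} acts on
    P as -[theta] i, and alpha becomes the product of the [Theta] l ([alpha_jac]). Modulo f(x) and
    g(y) the top coefficient of this product depends only on the boundaries involved
    ([prod_Theta_cong]), so the explicit quotients [bezout] may be used, and their residue is 1
    ([mres_bezout]). Finally [jacE] identifies the coefficient of P with the sum of minors that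
    defines J.

    Finite generation in the dual complex follows: a cycle c of degree n - s is homologous to e .
    Phi(c), and Phi(c) has degree 0, so the e . z_i generate when the z_i generate R[x]/(f). If s <
    n, then J and e are zero and the homotopies say that C(x, hat f) is contractible. *)

Section ExtRing.
Variables (A : comNzRingType) (m : nat).
Implicit Types (I J K : {set 'I_m}) (a b c : ext A m).

(** Both bracketings are sums over the partitions of K into I, J, N, and since [sgn] is
    multiplicative over disjoint unions in each argument, both carry the sign sgn I J sgn I N sgn J
    N. *)
Lemma wedgeA : associative (@wedge A m).
Proof.
move=> a b c; apply/ffunP=> K; rewrite !ffunE.
under eq_bigr do rewrite ffunE mulr_sumr.
under [RHS]eq_bigr do rewrite ffunE mulr_sumr mulr_suml.
rewrite [RHS](exchange_big_dep (fun I => I \subset K)) /=; last first.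
  by move=> I J IK JI; apply: subset_trans JI IK.
apply: eq_bigr => I IK.
rewrite [RHS](reindex_onto (fun J => I :|: J) (fun J => J :\: I)) /=; last first.
  move=> J /andP[JK IJ]; apply/setP=> i; rewrite !inE.
  by have /implyP := subsetP IJ i; case: (i \in I); case: (i \in J).
have dJ J : J \subset K :\: I -> [disjoint I & J].
  move=> JK; rewrite disjoint_sym disjoints_subset.
  by apply: subset_trans JK _; rewrite setDE subsetIr.
apply: eq_big => [J|J JK].
  rewrite subsetUl andbT subUset IK /= subsetD; congr andb.
  rewrite setDUl setDv set0U; apply/idP/eqP => [dJI|<-].
    by apply/setDidPl.
  by rewrite disjoints_subset; apply/subsetP=> i; rewrite !inE => /andP[].
have dIJ := dJ _ JK.
have -> : (I :|: J) :\: I = J.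
  by rewrite setDUl setDv set0U; apply/setDidPl; rewrite disjoint_sym.
rewrite -setDDl; set N := (K :\: I) :\: J.
have eKI : K :\: I = J :|: N.
  by rewrite /N -{1}(setID (K :\: I) J) (setIidPr JK).
rewrite eKI sgnUl // sgnUr; first by ring.
by rewrite /N disjoints_subset; apply/subsetP=> i; rewrite !inE => ->.
Qed.

Lemma ext_monE q I K : ext_mon q I K = if K == I then q else 0 :> A.
Proof. by rewrite ffunE. Qed.

Lemma wedge_mon p q I J : wedge (ext_mon p I) (ext_mon q J) =
  if [disjoint I & J] then ext_mon (sgn A I J * p * q) (I :|: J) else 0.
Proof.
apply/ffunP=> K; rewrite ffunE.
under eq_bigr do rewrite !ext_monE.
have [IK|nIK] := boolP (I \subset K); last first.
  rewrite big1 => [|L LK]; last first.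
    by case: eqP => [eL|_]; rewrite ?mulr0 ?mul0r //; rewrite -eL LK in nIK.
  case: ifP => _; rewrite !ffunE //; case: eqP => // eK.
  by rewrite eK subsetUl in nIK.
rewrite (bigD1 I) //= eqxx big1 ?addr0 => [|L /andP[_ /negbTE->]]; last first.
  by rewrite mulr0 mul0r.
case: (eqVneq (K :\: I) J) => [eJ|neJ].
  rewrite -eJ ifT; last first.
    by rewrite disjoints_subset; apply/subsetP=> i; rewrite !inE => ->.
  rewrite ext_monE ifT //; apply/eqP; rewrite -{1}(setID K I); congr (_ :|: _).
  exact/setIidPr.
rewrite mulr0; case: ifP => dIJ; rewrite ffunE //.
case: eqP => // eK; case/eqP: neJ; rewrite eK setDUl setDv set0U.
by apply/setDidPl; rewrite disjoint_sym.
Qed.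

Lemma wedge1l : left_id (ext_one A m) (@wedge A m).
Proof.
move=> a; apply/ffunP=> K; rewrite ffunE (bigD1 set0) ?sub0set //= big1.
  by rewrite ffunE eqxx sgn0l setD0 addr0 !mul1r.
by move=> I /andP[_ /negbTE nI]; rewrite ffunE nI mulr0 mul0r.
Qed.

Lemma wedge1r : right_id (ext_one A m) (@wedge A m).
Proof.
move=> a; apply/ffunP=> K; rewrite ffunE (bigD1 K) //= big1.
  by rewrite setDv ffunE eqxx sgn0r addr0 mul1r mulr1.
move=> I /andP[IK nI]; rewrite ffunE ifN ?mulr0 //.
by apply: contra nI; rewrite setD_eq0 eqEsubset IK.
Qed.

Lemma wedgeDl : left_distributive (@wedge A m) +%R.
Proof.
move=> a b c; apply/ffunP=> K; rewrite !ffunE -big_split; apply: eq_bigr => I _.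
by rewrite ffunE mulrDr mulrDl.
Qed.

Lemma wedgeDr : right_distributive (@wedge A m) +%R.
Proof.
move=> a b c; apply/ffunP=> K; rewrite !ffunE -big_split; apply: eq_bigr => I _.
by rewrite ffunE mulrDr.
Qed.

End ExtRing.

(* From here on, [*] on [ext A m] is [wedge], not the pointwise product that   *)
(* [{ffun _}] would inherit from [A].                                          *)
HB.instance Definition _ (A : comNzRingType) (m : nat) :=
  GRing.Zmodule.copy (ext A m) {ffun {set 'I_m} -> A}.
HB.instance Definition _ (A : comNzRingType) (m : nat) :=
  GRing.Zmodule_isPzRing.Build (ext A m) (@wedgeA A m) (@wedge1l A m) (@wedge1r A m)
    (@wedgeDl A m) (@wedgeDr A m).


Section ExtTheory.
Variables (A : comNzRingType) (m : nat).
Implicit Types (I J K : {set 'I_m}) (a b c : ext A m).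
Local Notation cst := (@ext_const A m).
Local Notation gen := (@ext_gen A m).

Lemma extM a b : a * b = wedge a b. Proof. by []. Qed.

Lemma ext_monM p q I J : ext_mon p I * ext_mon q J =
  if [disjoint I & J] then ext_mon (sgn A I J * p * q) (I :|: J) else 0.
Proof. exact: wedge_mon. Qed.

Fact ext_const_is_zmod_morphism : zmod_morphism cst.
Proof.
move=> p q; apply/ffunP=> K; rewrite !ffunE.
by case: eqP; rewrite ?subr0.
Qed.

Fact ext_const_is_monoid_morphism : monoid_morphism cst.
Proof.
split=> // p q; rewrite /ext_const ext_monM.
by rewrite disjoints_subset sub0set sgn0l mul1r setU0.
Qed.

HB.instance Definition _ :=
  GRing.isZmodMorphism.Build A (ext A m) cst ext_const_is_zmod_morphism.
HB.instance Definition _ :=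
  GRing.isMonoidMorphism.Build A (ext A m) cst ext_const_is_monoid_morphism.

Lemma cst_mon p q I : cst p * ext_mon q I = ext_mon (p * q) I.
Proof.
by rewrite /ext_const ext_monM disjoints_subset sub0set sgn0l mul1r set0U.
Qed.

Lemma cstE p a K : (cst p * a) K = p * a K.
Proof.
rewrite extM ffunE (bigD1 set0) ?sub0set //= big1.
  by rewrite ffunE eqxx sgn0l setD0 addr0 mul1r.
by move=> I /andP[_ /negbTE nI]; rewrite ffunE nI mulr0 mul0r.
Qed.

Lemma ext_scaleE p a : ext_scale p a = cst p * a.
Proof. by apply/ffunP=> K; rewrite cstE ffunE. Qed.

Lemma cst_comm p a : cst p * a = a * cst p.
Proof.
apply/ffunP=> K; rewrite cstE extM ffunE (bigD1 K) //= big1.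
  by rewrite setDv sgn0r ffunE eqxx addr0 mul1r mulrC.
move=> I /andP[IK nI]; rewrite ffunE ifN ?mulr0 //.
by apply: contra nI; rewrite setD_eq0 eqEsubset IK.
Qed.

Lemma cst_commA p a b : a * (cst p * b) = cst p * (a * b).
Proof. by rewrite mulrA -cst_comm mulrA. Qed.

Lemma ext_sum a : a = \sum_I cst (a I) * ext_mon 1 I.
Proof.
apply/ffunP=> K; rewrite sum_ffunE (bigD1 K) //= cst_mon mulr1 ffunE eqxx.
rewrite big1 ?addr0 // => I neI.
by rewrite cst_mon ffunE eq_sym (negbTE neI) .
Qed.

Lemma gen_mon i q J : gen i * ext_mon q J =
  if i \in J then 0 else ext_mon (sgn A [set i] J * q) (i |: J).
Proof. by rewrite ext_monM disjoints1 mulr1; case: (i \in J). Qed.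

Lemma ext_monU1 i J : i \notin J ->
  ext_mon 1 (i |: J) = cst (sgn A [set i] J) * (gen i * ext_mon 1 J).
Proof.
by move=> /negbTE iJ; rewrite gen_mon iJ mulr1 cst_mon sgn_sq.
Qed.

Lemma set_ind (P : {set 'I_m} -> Prop) : P set0 ->
  (forall i I, i \notin I -> P I -> P (i |: I)) -> forall I, P I.
Proof.
move=> P0 PU I; have [k] := ubnP #|I|; elim: k I => // k IHk I ltIk.
have [->//|[i iI]] := set_0Vmem I.
rewrite -(setD1K iI); apply: PU; first by rewrite !inE eqxx.
by apply: IHk; rewrite (cardsD1 i) iI in ltIk.
Qed.

(** Everything is reached from 1 by sums, scalars and left multiplication by generators; identities
    between algebra morphisms and derivations are proved along this. *)
Lemma ext_ind (P : ext A m -> Prop) :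
    P 1 -> (forall a b, P a -> P b -> P (a + b)) ->
    (forall q a, P a -> P (cst q * a)) -> (forall i a, P a -> P (gen i * a)) ->
  forall a, P a.
Proof.
move=> P1 PD PM Pg a; rewrite (ext_sum a).
have P0 : P 0 by rewrite -(mul0r 1) -(rmorph0 cst); exact: PM.
apply: big_ind => // I _; apply: (PM); elim/set_ind: I => // i I iI PI.
by rewrite ext_monU1 //; apply/PM/Pg.
Qed.

End ExtTheory.

Section ExtGrading.
Variables (A : comNzRingType) (m : nat).
Implicit Types (I J K : {set 'I_m}) (a b c u v : ext A m) (g : 'I_m -> A).
Local Notation cst := (@ext_const A m).
Local Notation gen := (@ext_gen A m).
Local Notation tw := (@ext_twist A m).

Fact ext_twist_is_zmod_morphism : zmod_morphism tw.
Proof. by move=> a b; apply/ffunP=> K; rewrite !ffunE mulrBr. Qed.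

HB.instance Definition _ :=
  GRing.isZmodMorphism.Build (ext A m) (ext A m) tw ext_twist_is_zmod_morphism.

Fact ext_twist_is_monoid_morphism : monoid_morphism tw.
Proof.
split=> [|a b]; apply/ffunP=> K; rewrite !ffunE.
  by case: eqP => [->|]; rewrite ?mulr0 // cards0 mulr1.
rewrite mulr_sumr; apply: eq_bigr => I IK; rewrite !ffunE.
by rewrite -{1}(setID K I) (setIidPr IK) cardsU (_ : I :&: _ = set0) ?cards0 ?subn0 ?exprD;
  [ring | apply/setP=> i; rewrite !inE; case: (i \in I)].
Qed.

HB.instance Definition _ :=
  GRing.isMonoidMorphism.Build (ext A m) (ext A m) tw ext_twist_is_monoid_morphism.

Lemma twistK : involutive tw.
Proof. by move=> a; apply/ffunP=> K; rewrite !ffunE mulrA -expr2 sqrr_sign mul1r. Qed.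

Fact koszul_is_zmod_morphism g : zmod_morphism (koszul g).
Proof.
move=> a b; apply/ffunP=> K; rewrite !ffunE -sumrB; apply: eq_bigr => i _.
by rewrite !ffunE mulrBr.
Qed.

HB.instance Definition _ g :=
  GRing.isZmodMorphism.Build (ext A m) (ext A m) (koszul g) (koszul_is_zmod_morphism g).

Lemma koszulM g a b : koszul g (a * b) = koszul g a * b + tw a * koszul g b.
Proof. exact: koszul_wedge. Qed.

Lemma koszul_cst g q : koszul g (cst q) = 0.
Proof.
apply/ffunP=> K; rewrite !ffunE big1 // => i iK; rewrite ffunE ifN ?mulr0 //.
by apply/set0Pn; exists i; rewrite setU11.
Qed.

Lemma koszul1 g : koszul g 1 = 0.
Proof. exact: (koszul_cst g 1). Qed.

Lemma twist_cst q : tw (cst q) = cst q.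
Proof.
apply/ffunP=> K; rewrite !ffunE; case: eqP => [->|]; last by rewrite mulr0.
by rewrite cards0 mul1r.
Qed.

Lemma koszul_cstM g q a : koszul g (cst q * a) = cst q * koszul g a.
Proof. by rewrite koszulM koszul_cst mul0r add0r twist_cst. Qed.

Lemma has_degP r a : has_deg r a ->
  a = \sum_(I : {set 'I_m} | #|I| == r) cst (a I) * ext_mon 1 I.
Proof.
move=> ar; rewrite {1}(ext_sum a) (bigID (fun I => #|I| == r)) /= addrC big1 ?add0r //.
by move=> I /ar->; rewrite rmorph0 mul0r.
Qed.

Lemma has_deg0 r : has_deg r (0 : ext A m).
Proof. by move=> I _; rewrite ffunE. Qed.

Lemma has_degD r a b : has_deg r a -> has_deg r b -> has_deg r (a + b).
Proof. by move=> ar br I Ir; rewrite ffunE ar // br // addr0. Qed.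

Lemma has_degN r a : has_deg r a -> has_deg r (- a).
Proof. by move=> ar I Ir; rewrite ffunE ar // oppr0. Qed.

Lemma has_degB r a b : has_deg r a -> has_deg r b -> has_deg r (a - b).
Proof. by move=> ar br; apply/has_degD/has_degN. Qed.

Lemma has_deg_sum r (T : Type) (s : seq T) (P : pred T) (F : T -> ext A m) :
  (forall i, P i -> has_deg r (F i)) -> has_deg r (\sum_(i <- s | P i) F i).
Proof.
by move=> Fr; apply: big_ind => //; [apply: has_deg0 | move=> *; apply: has_degD].
Qed.

Lemma has_deg_cst q : has_deg 0 (cst q).
Proof. by move=> I I0; rewrite ffunE ifN // -cards_eq0. Qed.

Lemma has_deg_mon q I : has_deg #|I| (ext_mon q I : ext A m).
Proof. by move=> J IJ; rewrite ffunE ifN //; apply: contraNneq IJ => ->. Qed.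

Lemma has_deg_gen i : has_deg 1 (gen i).
Proof. by rewrite -(cards1 i); apply: has_deg_mon. Qed.

Lemma has_degM r k a b : has_deg r a -> has_deg k b -> has_deg (r + k) (a * b).
Proof.
move=> ar bk K Krk; rewrite extM ffunE big1 // => I IK.
have [Ir|/ar->] := eqVneq #|I| r; last by rewrite mulr0 mul0r.
rewrite bk ?mulr0 //; apply: contraNneq Krk => <-.
by rewrite -Ir -(cardsID I K) (setIidPr IK).
Qed.

Lemma has_degZ r q a : has_deg r a -> has_deg r (cst q * a).
Proof. by move=> ar I /ar; rewrite cstE => ->; rewrite mulr0. Qed.

Lemma has_deg_twist r a : has_deg r a -> has_deg r (tw a).
Proof. by move=> ar I /ar aI; rewrite ffunE aI mulr0. Qed.

Lemma has_deg_koszul g r a : has_deg r.+1 a -> has_deg r (koszul g a).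
Proof.
move=> ar I Ir; rewrite ffunE big1 // => i iI.
by rewrite ar ?mulr0 // cardsU1 iI add1n eqSS.
Qed.

Lemma koszul_deg0 g a : has_deg 0 a -> koszul g a = 0.
Proof.
move=> a0; apply/ffunP=> I; rewrite !ffunE big1 // => i iI.
by rewrite a0 ?mulr0 // cardsU1 iI.
Qed.

Lemma has_deg0E a : has_deg 0 a -> a = cst (a set0).
Proof.
move=> a0; apply/ffunP=> I; rewrite ffunE; case: eqP => [->//|/eqP I0].
by rewrite a0 // cards_eq0.
Qed.

Lemma has_deg_gt r a : (m < r)%N -> has_deg r a -> a = 0.
Proof.
move=> ltmr ar; apply/ffunP=> I; rewrite ar ?ffunE // neq_ltn.
by rewrite (leq_ltn_trans _ ltmr) // -[X in (_ <= X)%N]card_ord max_card.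
Qed.

Lemma twist_deg r a : has_deg r a -> tw a = (-1) ^+ r * a.
Proof.
move=> ar; apply/ffunP=> I; rewrite -(rmorph_sign cst) cstE ffunE.
by have [->//|/ar->] := eqVneq #|I| r; rewrite !mulr0.
Qed.

Lemma ext_deg_ind (P : ext A m -> Prop) :
    (forall a b, P a -> P b -> P (a + b)) -> (forall r a, has_deg r a -> P a) ->
  forall a, P a.
Proof.
move=> PD Pr a; rewrite (ext_sum a).
apply: big_ind => //; first by apply: (Pr 0); apply: has_deg0.
by move=> I _; apply/Pr/has_degZ/has_deg_mon.
Qed.

Lemma koszul_twist g a : koszul g (tw a) = - tw (koszul g a).
Proof.
elim/ext_deg_ind: a => [a b IHa IHb|r a ar]; first by rewrite !raddfD /= IHa IHb.
case: r ar => [|r] ar.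
  by rewrite !koszul_deg0 ?raddf0 ?oppr0 //; apply: has_deg_twist.
rewrite (twist_deg ar) (twist_deg (has_deg_koszul g ar)).
by rewrite -!(rmorph_sign cst) koszul_cstM exprS mulN1r rmorphN mulNr.
Qed.

Lemma gen_comm i a : gen i * a = tw a * gen i.
Proof.
rewrite (ext_sum a) rmorph_sum mulr_sumr mulr_suml; apply: eq_bigr => I _ /=.
rewrite rmorphM /= twist_cst mulrA -cst_comm -!mulrA; congr (_ * _).
rewrite (twist_deg (@has_deg_mon 1 I)) -mulrA !ext_monM !mulr1.
rewrite disjoints1 disjoint_sym disjoints1; case: ifPn => [iI|_]; last by rewrite mulr0.
rewrite -(rmorph_sign cst) cst_mon setUC -(sgn_comm1 _ iI).
by congr ext_mon; rewrite -[LHS]mul1r -(sgn_sq _ I [set i]); ring.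
Qed.

Lemma odd_comm v a : has_deg 1 v -> v * a = tw a * v.
Proof.
move=> /has_degP->; rewrite mulr_suml mulr_sumr; apply: eq_bigr => I /cards1P[i ->].
by rewrite -mulrA gen_comm mulrA cst_comm mulrA.
Qed.

Lemma gen_sq i : gen i * gen i = 0.
Proof. by rewrite gen_mon set11. Qed.

(** Anticommutation gives only 2 v v = 0, which is too weak over a general ring. Squares vanish on
    generators, and the cross terms of a sum cancel. *)
Lemma odd_sq v : has_deg 1 v -> v * v = 0.
Proof.
move=> v1; suff [] : has_deg 1 v /\ v * v = 0 by [].
rewrite (has_degP v1); 
apply: (big_ind (fun u => has_deg 1 u /\ u * u = 0))
  => [|a b [a1 aa] [b1 bb]|I /cards1P[i ->]].
- by split; [apply: has_deg0 | rewrite mul0r].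
- split; first exact: has_degD.
  rewrite mulrDl !mulrDr aa bb add0r addr0 (odd_comm _ a1) (twist_deg b1).
  by rewrite mulN1r mulNr addNr.
split; first by apply: has_degZ; apply: has_deg_gen.
by rewrite mulrA -(mulrA (cst _)) -cst_comm mulrA -mulrA gen_sq mulr0.
Qed.

Lemma odd_anticomm u v : has_deg 1 u -> has_deg 1 v -> u * v = - (v * u).
Proof. by move=> u1 v1; rewrite (odd_comm _ u1) (twist_deg v1) mulN1r mulNr. Qed.

Lemma deg_comm r a b : has_deg r a -> a * b = iter r tw b * a.
Proof.
move=> /has_degP->; rewrite mulr_suml mulr_sumr; apply: eq_bigr => I /eqP <-.
rewrite -mulrA [RHS]mulrA -cst_comm -[RHS]mulrA; congr (_ * _); move: b.
elim/set_ind: I => [|i I iI IH] b.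
  by rewrite cards0 [ext_mon _ _](rmorph1 cst) mul1r mulr1.
rewrite cardsU1 iI add1n ext_monU1 // -mulrA -(mulrA (gen i)) IH.
rewrite (mulrA (gen i)) gen_comm -!mulrA -iterS.
by rewrite [RHS]mulrA -[in RHS]cst_comm -[RHS]mulrA.
Qed.

Lemma graded_comm r k a b : has_deg r a -> has_deg k b -> a * b = (-1) ^+ (r * k) * (b * a).
Proof.
move=> ar bk; rewrite (deg_comm b ar) mulrA; congr (_ * _).
elim: r {ar} => [|r IH]; first by rewrite mul1r.
rewrite iterS IH -(rmorph_sign cst) rmorphM /= twist_cst (twist_deg bk) mulrA.
by rewrite rmorph_sign -exprD mulSn addnC.
Qed.

End ExtGrading.

(** * Algebra morphisms out of an exterior algebra *)

Section OddProducts.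
Variables (A : comNzRingType) (m k : nat) (v : 'I_k -> ext A m).
Hypothesis v_odd : forall i, has_deg 1 (v i).
Implicit Types (I J K : {set 'I_k}).
Local Notation cst := (@ext_const A m).

(** Products over sets are taken in increasing order, so v i has to pass exactly the v j with j < i;
    each passage costs a sign, and these signs make up [sgn]. *)
Lemma prod_odd_insert i J : i \notin J ->
  v i * \prod_(j in J) v j = cst (sgn A [set i] J) * \prod_(j in i |: J) v j.
Proof.
move=> iJ; rewrite /sgn big_set1.
have : pairwise ltn [seq val j | j <- index_enum 'I_k].
  rewrite -sorted_pairwise; last exact: ltn_trans.
  by rewrite -[index_enum _]enumT val_enum_ord iota_ltn_sorted.
elim: (index_enum _) (mem_index_enum i) => // j l IHl.
rewrite inE /= => il /andP[lt_jl pl]; rewrite !big_cons.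
have [eij|nij] := eqVneq i j.
  rewrite -eij (negbTE iJ) setU11.
  have gt_l j' : j' \in l -> (i < j')%N.
    by move=> j'l; rewrite eij; apply: (allP lt_jl); rewrite map_f.
  rewrite [X in cst X]big_seq_cond [X in cst X]big1 ?rmorph1 ?mul1r; last first.
    by move=> j' /andP[/gt_l /ltnW]; rewrite leqNgt => /negbTE->.
  congr (_ * _); rewrite big_seq_cond [RHS]big_seq_cond; apply: eq_bigl => j'.
  rewrite in_setU1; case: eqP => [->|]//=; case: (boolP (i \in l)) => //= /gt_l.
  by rewrite ltnn.
rewrite (negbTE nij) /= in il; rewrite in_setU1 eq_sym (negbTE nij) /=.
case: ifP => jJ; last exact: IHl.
have lt_ji : (j < i)%N by apply: (allP lt_jl); rewrite map_f.
rewrite mulrA (odd_anticomm (v_odd i) (v_odd j)) mulNr -mulrA IHl //.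
by rewrite lt_ji expr1 mulN1r rmorphN mulNr mulrA -cst_comm -mulrA.
Qed.

Lemma prod_oddU1 i J : i \notin J ->
  \prod_(j in i |: J) v j = cst (sgn A [set i] J) * (v i * \prod_(j in J) v j).
Proof. by move=> iJ; rewrite prod_odd_insert // mulrA -rmorphM sgn_sq rmorph1 mul1r. Qed.

Lemma prod_odd_mem i J : i \in J -> v i * \prod_(j in J) v j = 0.
Proof.
move=> iJ; rewrite -(setD1K iJ) prod_oddU1 ?setD11 // mulrA -cst_comm -mulrA.
by rewrite (mulrA (v i)) odd_sq // mul0r mulr0.
Qed.

Lemma has_deg_prod_odd J : has_deg #|J| (\prod_(j in J) v j).
Proof.
elim/set_ind: J => [|i J iJ IH].
  by rewrite cards0 big_set0 -(rmorph1 cst); apply: has_deg_cst.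
by rewrite prod_oddU1 // cardsU1 iJ; apply/has_degZ/has_degM.
Qed.

Lemma koszul_prod_odd g J : (forall j, koszul g (v j) = 0) ->
  koszul g (\prod_(j in J) v j) = 0.
Proof.
move=> v0; elim/set_ind: J => [|i J iJ IH]; first by rewrite big_set0 koszul1.
by rewrite prod_oddU1 // koszul_cstM koszulM v0 IH mul0r !mulr0 addr0 mulr0.
Qed.

End OddProducts.

(** Slide v i to the right until it meets P, replace it by w i, and slide back: both elements are
    odd, so the two twists agree. *)
Lemma prod_odd_subst (A : comNzRingType) m k (v w : 'I_k -> ext A m) (P : ext A m)
    (J : {set 'I_k}) :
    (forall i, has_deg 1 (v i)) -> (forall i, has_deg 1 (w i)) ->
    (forall i, v i * P = w i * P) ->
  (\prod_(j in J) v j) * P = (\prod_(j in J) w j) * P.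
Proof.
move=> v1 w1 vw; elim/set_ind: J => [|i J iJ IH]; first by rewrite !big_set0.
rewrite !prod_oddU1 // -!mulrA IH; congr (_ * _).
by rewrite !mulrA (odd_comm _ (v1 i)) (odd_comm _ (w1 i)) -!mulrA vw.
Qed.

Lemma prod_gen (A : comNzRingType) m (J : {set 'I_m}) :
  \prod_(j in J) ext_gen A j = ext_mon 1 J.
Proof.
elim/set_ind: J => [|i J iJ IH]; first by rewrite big_set0 [RHS](rmorph1 (@ext_const A m)).
by rewrite prod_oddU1 ?IH ?ext_monU1 // => j; apply: has_deg_gen.
Qed.

Section ExtMap.
Variables (A B : comNzRingType) (m k : nat) (phi : {rmorphism A -> B}).
Variable v : 'I_k -> ext B m.
Implicit Types (a b : ext A k).
Local Notation cst := (@ext_const _ _).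

(** The universal property of the exterior algebra: this is multiplicative as soon as the v i are
    odd, since they then anticommute and have square zero. *)
Definition extmap a : ext B m := \sum_I cst (phi (a I)) * \prod_(i in I) v i.

Lemma extmapE a : extmap a = \sum_I cst (phi (a I)) * \prod_(i in I) v i.
Proof. by []. Qed.

Fact extmap_is_zmod_morphism : zmod_morphism extmap.
Proof.
move=> a b; rewrite /extmap -sumrB; apply: eq_bigr => I _.
by rewrite !ffunE !rmorphB mulrBl.
Qed.

HB.instance Definition _ :=
  GRing.isZmodMorphism.Build (ext A k) (ext B m) extmap extmap_is_zmod_morphism.

Lemma extmap_mon q I : extmap (ext_mon q I) = cst (phi q) * \prod_(i in I) v i.
Proof.
rewrite /extmap (bigD1 I) //= ffunE eqxx [X in _ + X]big1 ?addr0 // => J /negbTE nJ.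
by rewrite ffunE nJ !rmorph0 mul0r.
Qed.

Lemma extmap_cst q : extmap (ext_const k q) = cst (phi q).
Proof. by rewrite extmap_mon big_set0 mulr1. Qed.

Lemma extmap1 : extmap 1 = 1.
Proof. by rewrite (extmap_cst 1 : extmap 1 = _) !rmorph1. Qed.

Lemma extmap_cstM q a : extmap (cst q * a) = cst (phi q) * extmap a.
Proof.
rewrite mulr_sumr; apply: eq_bigr => I _.
by rewrite cstE !rmorphM mulrA.
Qed.

Hypothesis v_odd : forall i, has_deg 1 (v i).

Lemma extmap_gen i : extmap (ext_gen A i) = v i.
Proof. by rewrite extmap_mon !rmorph1 mul1r big_set1. Qed.

Lemma extmap_genM i a : extmap (ext_gen A i * a) = v i * extmap a.
Proof.
rewrite [in LHS](ext_sum a) [in RHS](ext_sum a) mulr_sumr !raddf_sum mulr_sumr.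
apply: eq_bigr => I _ /=.
rewrite mulrA -cst_comm -mulrA !extmap_cstM mulrA -cst_comm -mulrA; congr (_ * _).
rewrite gen_mon mulr1 extmap_mon !rmorph1 mul1r; case: ifPn => iI.
  by rewrite raddf0 prod_odd_mem.
rewrite extmap_mon prod_odd_insert //; congr (cst _ * _).
by rewrite /sgn rmorph_prod; apply: eq_bigr => j _; rewrite rmorph_prod;
   apply: eq_bigr => j' _; rewrite rmorph_sign.
Qed.

Lemma extmapM a b : extmap (a * b) = extmap a * extmap b.
Proof.
elim/ext_ind: a => [|a c IHa IHc|q a IH|i a IH].
- by rewrite extmap1 !mul1r.
- by rewrite mulrDl !raddfD /= IHa IHc mulrDl.
- by rewrite -mulrA !extmap_cstM IH mulrA.
by rewrite -mulrA !extmap_genM IH mulrA.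
Qed.

(** Both sides are odd derivations along [extmap], so agreement on generators suffices. All chain
    maps between Koszul complexes below are obtained from this. *)
Lemma extmap_koszul g g' a : (forall i, koszul g' (v i) = cst (phi (g i))) ->
  koszul g' (extmap a) = extmap (koszul g a).
Proof.
move=> dv; elim/ext_ind: a => [|a c IHa IHc|q a IH|i a IH].
- by rewrite extmap1 !koszul1 raddf0.
- by rewrite !raddfD /= IHa IHc.
- by rewrite extmap_cstM !koszul_cstM extmap_cstM IH.
rewrite extmap_genM !koszulM koszul_gen raddfD /= !extmapM extmap_cst dv IH.
rewrite (twist_deg (v_odd i)) (twist_deg (has_deg_gen _ i)) !mulN1r.
by rewrite raddfN /= extmap_gen.
Qed.

Lemma has_deg_extmap r a : has_deg r a -> has_deg r (extmap a).
Proof.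
move=> ar; rewrite /extmap (bigID (fun I : {set 'I_k} => #|I| == r)) /= [X in _ + X]big1.
  rewrite addr0; apply: has_deg_sum => I /eqP <-.
  by apply/has_degZ/has_deg_prod_odd.
by move=> I /ar->; rewrite !rmorph0 mul0r.
Qed.

Lemma extmap_twist a : extmap (ext_twist a) = ext_twist (extmap a).
Proof.
elim/ext_deg_ind: a => [a b IHa IHb|r a ar]; first by rewrite !raddfD /= IHa IHb.
rewrite (twist_deg ar) (twist_deg (has_deg_extmap ar)).
by rewrite -!(rmorph_sign cst) extmap_cstM !rmorph_sign.
Qed.

End ExtMap.

Lemma eq_extmap (A B : comNzRingType) m k (phi psi : {rmorphism A -> B})
    (v w : 'I_k -> ext B m) a :
  phi =1 psi -> v =1 w -> extmap phi v a = extmap psi w a.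
Proof.
move=> pp vw; apply: eq_bigr => I _; rewrite pp; congr (_ * _).
by apply: eq_bigr.
Qed.

Lemma extmap_comp (A B C : comNzRingType) m k l (phi : {rmorphism A -> B})
    (psi : {rmorphism B -> C}) (v : 'I_k -> ext B l) (w : 'I_l -> ext C m) a :
    (forall i, has_deg 1 (w i)) ->
  extmap psi w (extmap phi v a) =
  extmap (psi \o phi : {rmorphism A -> C}) (fun i => extmap psi w (v i)) a.
Proof.
move=> w1; rewrite raddf_sum; apply: eq_bigr => I _ /=.
rewrite extmap_cstM; congr (_ * _).
by rewrite (big_morph (extmap psi w) (extmapM psi w1) (extmap1 psi w)) .
Qed.

(** * Exterior algebras of direct sums *)

Section DirectSum.
Variables (m n : nat).
Implicit Types (S : {set 'I_(m + n)}) (I : {set 'I_m}) (J : {set 'I_n}).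

Definition lpart S : {set 'I_m} := [set i | lshift n i \in S].
Definition rpart S : {set 'I_n} := [set i | rshift m i \in S].
Definition lrset I J : {set 'I_(m + n)} := (@lshift m n @: I) :|: (@rshift m n @: J).

Lemma mem_limset (i : 'I_m) I : (lshift n i \in @lshift m n @: I) = (i \in I).
Proof. by rewrite mem_imset //; apply: lshift_inj. Qed.

Lemma mem_rimset (i : 'I_n) J : (rshift m i \in @rshift m n @: J) = (i \in J).
Proof. by rewrite mem_imset //; apply: rshift_inj. Qed.

Lemma mem_lrimset (i : 'I_m) J : (lshift n i \in @rshift m n @: J) = false.
Proof. by apply/imsetP=> -[j _ /eqP]; rewrite eq_lrshift. Qed.

Lemma mem_rlimset (i : 'I_n) I : (rshift m i \in @lshift m n @: I) = false.
Proof. by apply/imsetP=> -[j _ /eqP]; rewrite eq_rlshift. Qed.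

Lemma lpartK I J : lpart (lrset I J) = I.
Proof. by apply/setP=> i; rewrite !inE mem_limset mem_lrimset orbF. Qed.

Lemma rpartK I J : rpart (lrset I J) = J.
Proof. by apply/setP=> i; rewrite !inE mem_rimset mem_rlimset. Qed.

Lemma lrsetK S : lrset (lpart S) (rpart S) = S.
Proof.
apply/setP=> i; rewrite inE; case: (split_ordP i) => j ->.
  by rewrite mem_limset mem_lrimset inE orbF.
by rewrite mem_rlimset mem_rimset inE.
Qed.

Lemma lrset_disj I J : [disjoint @lshift m n @: I & @rshift m n @: J].
Proof.
by rewrite disjoints_subset; apply/subsetP=> _ /imsetP[i iI ->]; rewrite inE mem_lrimset.
Qed.

Lemma card_lrset I J : #|lrset I J| = (#|I| + #|J|)%N.
Proof.
rewrite cardsU (disjoint_setI0 (lrset_disj I J)) cards0 subn0.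
by rewrite !card_imset //; [apply: rshift_inj | apply: lshift_inj].
Qed.

Lemma eq_lrset S I J : (S == lrset I J) = (lpart S == I) && (rpart S == J).
Proof.
apply/eqP/andP=> [->|[/eqP<- /eqP<-]]; first by rewrite lpartK rpartK !eqxx.
by rewrite lrsetK.
Qed.

End DirectSum.

Section ExtSum.
Variables (A : comNzRingType) (m n : nat).
Implicit Types (S : {set 'I_(m + n)}) (I : {set 'I_m}) (J : {set 'I_n}).
Implicit Types (a : ext A m) (b : ext A n) (w : ext A (m + n)).
Local Notation cst := (@ext_const _ _).

Definition einl : ext A m -> ext A (m + n) := extmap idfun (fun i => ext_gen A (lshift n i)).
Definition einr : ext A n -> ext A (m + n) := extmap idfun (fun i => ext_gen A (rshift m i)).

Let lodd (i : 'I_m) : has_deg 1 (ext_gen A (lshift n i)). Proof. exact: has_deg_gen. Qed.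
Let rodd (i : 'I_n) : has_deg 1 (ext_gen A (rshift m i)). Proof. exact: has_deg_gen. Qed.

HB.instance Definition _ := GRing.Additive.on einl.
HB.instance Definition _ := GRing.Additive.on einr.

Fact einl_is_monoid_morphism : monoid_morphism einl.
Proof. by split; [apply: extmap1 | apply: extmapM]. Qed.

Fact einr_is_monoid_morphism : monoid_morphism einr.
Proof. by split; [apply: extmap1 | apply: extmapM]. Qed.

HB.instance Definition _ :=
  GRing.isMonoidMorphism.Build (ext A m) (ext A (m + n)) einl einl_is_monoid_morphism.
HB.instance Definition _ :=
  GRing.isMonoidMorphism.Build (ext A n) (ext A (m + n)) einr einr_is_monoid_morphism.

Lemma einl_cst q : einl (cst q) = cst q. Proof. exact: extmap_cst. Qed.
Lemma einr_cst q : einr (cst q) = cst q. Proof. exact: extmap_cst. Qed.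
Lemma einl_gen i : einl (ext_gen A i) = ext_gen A (lshift n i).
Proof. exact: extmap_gen. Qed.
Lemma einr_gen i : einr (ext_gen A i) = ext_gen A (rshift m i).
Proof. exact: extmap_gen. Qed.
Lemma einl_twist a : einl (ext_twist a) = ext_twist (einl a).
Proof. exact: extmap_twist. Qed.
Lemma has_deg_einl r a : has_deg r a -> has_deg r (einl a).
Proof. exact: has_deg_extmap. Qed.
Lemma has_deg_einr r b : has_deg r b -> has_deg r (einr b).
Proof. exact: has_deg_extmap. Qed.

Lemma einl_mon q I : einl (ext_mon q I) = ext_mon q (@lshift m n @: I).
Proof.
rewrite /einl extmap_mon /= -[q in RHS]mulr1 -cst_mon; congr (_ * _).
elim/set_ind: I => [|i I iI IH].
  by rewrite big_set0 imset0 [RHS](rmorph1 (@ext_const _ _)).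
rewrite prod_oddU1 // IH imsetU1 ext_monU1 ?mem_limset //; congr (cst _ * _).
rewrite /sgn !big_set1 big_imset //=; apply: in2W; exact: lshift_inj.
Qed.

Lemma einr_mon q J : einr (ext_mon q J) = ext_mon q (@rshift m n @: J).
Proof.
rewrite /einr extmap_mon /= -[q in RHS]mulr1 -cst_mon; congr (_ * _).
elim/set_ind: J => [|i J iJ IH].
  by rewrite big_set0 imset0 [RHS](rmorph1 (@ext_const _ _)).
rewrite prod_oddU1 // IH imsetU1 ext_monU1 ?mem_rimset //; congr (cst _ * _).
rewrite /sgn !big_set1 big_imset /=; last by apply: in2W; exact: rshift_inj.
by apply: eq_bigr => j _; rewrite ltn_add2l.
Qed.

(** Every left index precedes every right one, so no sign appears. *)
Lemma einlr_mon p q I J :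
  einl (ext_mon p I) * einr (ext_mon q J) = ext_mon (p * q) (lrset I J).
Proof.
rewrite einl_mon einr_mon ext_monM lrset_disj /sgn big1 ?mul1r // => _ /imsetP[i _ ->].
rewrite big1 // => _ /imsetP[j _ ->].
by rewrite ltnNge ltnW ?expr0 //= ltn_addr.
Qed.

Lemma einlrE a b S : (einl a * einr b) S = a (lpart S) * b (rpart S).
Proof.
rewrite [in LHS](ext_sum a) raddf_sum mulr_suml sum_ffunE (bigD1 (lpart S)) //=.
rewrite [in LHS](ext_sum b) raddf_sum.
have E I : (einl (cst (a I) * ext_mon 1 I) *
      \sum_J einr (cst (b J) * ext_mon 1 J)) S =
      if lpart S == I then a I * b (rpart S) else 0.
  rewrite mulr_sumr sum_ffunE (bigD1 (rpart S)) //= !cst_mon !mulr1 einlr_mon.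
  rewrite ffunE eq_lrset eqxx andbT big1 ?addr0 // => J /negbTE neJ.
  by rewrite !cst_mon !mulr1 einlr_mon ffunE eq_lrset eq_sym in neJ *; rewrite neJ andbF.
rewrite E eqxx big1 ?addr0 // => I neI; rewrite E eq_sym (negbTE neI) //.
Qed.

Definition rcoef w J : ext A m := [ffun I => w (lrset I J)].

Lemma einlr_sum w : w = \sum_J einl (rcoef w J) * einr (ext_mon 1 J).
Proof.
apply/ffunP=> S; rewrite sum_ffunE (bigD1 (rpart S)) //= einlrE !ffunE eqxx lrsetK mulr1.
by rewrite big1 ?addr0 // => J neJ; rewrite einlrE !ffunE eq_sym (negbTE neJ) mulr0.
Qed.

Lemma einlr_ind (P : ext A (m + n) -> Prop) :
    (forall w1 w2, P w1 -> P w2 -> P (w1 + w2)) ->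
    (forall a J, P (einl a * einr (ext_mon 1 J))) ->
  forall w, P w.
Proof.
move=> PD PM w; rewrite (einlr_sum w); apply: big_ind => //.
by rewrite -(mul0r (einr (ext_mon 1 set0))) -(raddf0 einl); apply: PM.
Qed.

Lemma rcoefM a b J : rcoef (einl a * einr b) J = cst (b J) * a.
Proof. by apply/ffunP=> I; rewrite ffunE cstE einlrE lpartK rpartK mulrC. Qed.

Fact rcoef_is_zmod_morphism J : zmod_morphism (rcoef^~ J).
Proof. by move=> w1 w2; apply/ffunP=> I; rewrite !ffunE. Qed.

(* With hat u as the second summand, the coefficient of hat u_1 ... hat u_n; it *)
(* is a chain map because the differential lowers the degree in hat u.         *)
Definition ext_top w : ext A m := rcoef w setT.

HB.instance Definition _ :=
  GRing.isZmodMorphism.Build (ext A (m + n)) (ext A m) ext_top (rcoef_is_zmod_morphism setT).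

Lemma ext_topM a b : ext_top (einl a * einr b) = cst (b setT) * a.
Proof. exact: rcoefM. Qed.

Lemma ext_topMl a w : ext_top (einl a * w) = a * ext_top w.
Proof.
elim/einlr_ind: w => [w1 w2 IH1 IH2|c J]; first by rewrite mulrDr !raddfD /= IH1 IH2 mulrDr.
by rewrite mulrA -rmorphM !ext_topM !mulrA (cst_comm _ a).
Qed.

Lemma has_deg_ext_top r w : has_deg (r + n) w -> has_deg r (ext_top w).
Proof.
move=> wr I Ir; rewrite ffunE wr // card_lrset cardsT card_ord eqn_add2r //.
Qed.

Definition gsum (T : Type) (g : 'I_m -> T) (h : 'I_n -> T) : 'I_(m + n) -> T :=
  fun k => match split k with inl i => g i | inr j => h j end.

Lemma gsuml T (g : 'I_m -> T) h i : gsum g h (lshift n i) = g i.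
Proof. by rewrite /gsum (unsplitK (inl i)). Qed.

Lemma gsumr T (g : 'I_m -> T) h j : gsum g h (rshift m j) = h j.
Proof. by rewrite /gsum (unsplitK (inr j)). Qed.

Lemma koszul_einl g h a : koszul (gsum g h) (einl a) = einl (koszul g a).
Proof. by apply: extmap_koszul => // i; rewrite koszul_gen gsuml. Qed.

Lemma koszul_einr g h b : koszul (gsum g h) (einr b) = einr (koszul h b).
Proof. by apply: extmap_koszul => // i; rewrite koszul_gen gsumr. Qed.

Lemma ext_top_koszul g h w : ext_top (koszul (gsum g h) w) = koszul g (ext_top w).
Proof.
elim/einlr_ind: w => [w1 w2 IH1 IH2|a J]; first by rewrite !raddfD /= IH1 IH2.
rewrite koszulM koszul_einl koszul_einr -einl_twist raddfD /= !ext_topM.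
rewrite koszul_cstM [X in cst X * ext_twist _](_ : _ = 0) ?rmorph0 ?mul0r ?addr0 //.
by rewrite ffunE big1 // => i; rewrite inE.
Qed.

End ExtSum.

(** Scaling each of the n generators of the second summand by c scales their full product by c ^+ n.
    This serves with c = -1 for the exchange of x and y, and with c = 1 for setting the f_{i,x} to
    zero. *)
Lemma ext_top_extmap (A B : comNzRingType) m m' n (phi : {rmorphism A -> B})
    (v : 'I_m -> ext B m') (u : 'I_(m + n) -> ext B (m' + n)) (c : B) w :
    (forall i, has_deg 1 (v i)) ->
    (forall i, u (lshift n i) = einl n (v i)) ->
    (forall j, u (rshift m j) = ext_const _ c * ext_gen B (rshift m' j)) ->
  ext_top (extmap phi u w) = ext_const _ (c ^+ n) * extmap phi v (ext_top w).
Proof.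
move=> v1 ul ur.
have u1 k : has_deg 1 (u k).
  case: (split_ordP k) => i ->; rewrite ?ul ?ur; first exact: has_deg_einl.
  by apply/has_degZ/has_deg_gen.
elim/einlr_ind: w => [w1 w2 IH1 IH2|a J]; first by rewrite !raddfD /= IH1 IH2 mulrDr.
rewrite extmapM // /einl /einr !extmap_comp //.
have -> : extmap (phi \o idfun : {rmorphism A -> B})
    (fun i => extmap phi u (ext_gen A (lshift n i))) a = einl n (extmap phi v a).
  rewrite /einl extmap_comp; last by move=> i; apply: has_deg_gen.
  by apply: eq_extmap => // i; rewrite extmap_gen // ul.
rewrite extmap_mon rmorph1 mul1r.
have -> : \prod_(j in J) extmap phi u (ext_gen A (rshift m j)) =
    einr m' (ext_const _ (c ^+ #|J|) * ext_mon 1 J).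
  elim/set_ind: J => [|j J jJ IH].
    by rewrite big_set0 cards0 rmorph1 mul1r [ext_mon _ _](rmorph1 (@ext_const _ _)) rmorph1.
  rewrite prod_oddU1 // => [|k]; last by rewrite extmap_gen.
  rewrite IH extmap_gen // ur ext_monU1 // !rmorphM /= !einr_cst einr_gen cardsU1 jJ.
  rewrite -!mulrA exprS rmorphM /= (cst_commA _ (ext_gen _ _)) !mulrA -!rmorphM.
  congr (_ * _ * _).
  by rewrite -mulrA mulrC.
rewrite -[ext_top (einl _ a * _)]/(ext_top (einl _ a * einr m (ext_mon 1 J))).
rewrite !ext_topM cstE extmap_cstM !ffunE eq_sym.
case: eqP => [->|_]; last by rewrite mulr0 !rmorph0 !mul0r mulr0.
by rewrite cardsT card_ord mulr1 rmorph1 mul1r.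
Qed.

(** * Two copies of the variables *)

Lemma extmap_genE (A B : comNzRingType) m (phi : {rmorphism A -> B}) (a : ext A m) K :
  extmap phi (@ext_gen B m) a K = phi (a K).
Proof.
rewrite extmapE; under eq_bigr do rewrite prod_gen.
rewrite sum_ffunE (bigD1 K) //= cstE ffunE eqxx mulr1 big1 ?addr0 // => I neI.
by rewrite cstE ffunE eq_sym (negbTE neI) mulr0.
Qed.

Section TwoCopies.
Variables (A B : comNzRingType) (ex ey : {rmorphism A -> B}) (s : nat).
Implicit Types (a b : ext A s).

Definition ext_x : ext A s -> ext B (s + s) := extmap ex (fun i => ext_gen B (lshift s i)).
Definition ext_y : ext A s -> ext B (s + s) := extmap ey (fun i => ext_gen B (rshift s i)).

Let genl_odd (i : 'I_s) : has_deg 1 (ext_gen B (lshift s i)).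
Proof. exact: has_deg_gen. Qed.
Let genr_odd (i : 'I_s) : has_deg 1 (ext_gen B (rshift s i)).
Proof. exact: has_deg_gen. Qed.

HB.instance Definition _ := GRing.Additive.on ext_x.
HB.instance Definition _ := GRing.Additive.on ext_y.

Fact ext_x_is_monoid_morphism : monoid_morphism ext_x.
Proof. by split; [apply: extmap1 | apply: extmapM]. Qed.
Fact ext_y_is_monoid_morphism : monoid_morphism ext_y.
Proof. by split; [apply: extmap1 | apply: extmapM]. Qed.

HB.instance Definition _ :=
  GRing.isMonoidMorphism.Build (ext A s) (ext B (s + s)) ext_x ext_x_is_monoid_morphism.
HB.instance Definition _ :=
  GRing.isMonoidMorphism.Build (ext A s) (ext B (s + s)) ext_y ext_y_is_monoid_morphism.

Lemma ext_x_twist a : ext_x (ext_twist a) = ext_twist (ext_x a).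
Proof. exact: extmap_twist. Qed.
Lemma has_deg_ext_x r a : has_deg r a -> has_deg r (ext_x a).
Proof. exact: has_deg_extmap. Qed.
Lemma has_deg_ext_y r a : has_deg r a -> has_deg r (ext_y a).
Proof. exact: has_deg_extmap. Qed.

Variable f : 'I_s -> A.

Definition koszul_xy : ext B (s + s) -> ext B (s + s) :=
  koszul (gsum (fun i => ex (f i)) (fun i => ey (f i))).

HB.instance Definition _ := GRing.Additive.on koszul_xy.

Lemma koszul_xyM u v : koszul_xy (u * v) = koszul_xy u * v + ext_twist u * koszul_xy v.
Proof. exact: koszulM. Qed.

Lemma koszul_ext_x a : koszul_xy (ext_x a) = ext_x (koszul f a).
Proof. by apply: extmap_koszul => // i; rewrite koszul_gen gsuml. Qed.

Lemma koszul_ext_y a : koszul_xy (ext_y a) = ext_y (koszul f a).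
Proof. by apply: extmap_koszul => // i; rewrite koszul_gen gsumr. Qed.

Variable sw : {rmorphism B -> B}.
Hypotheses (sw_x : forall p, sw (ex p) = ey p) (sw_y : forall p, sw (ey p) = ex p).

Definition swap_gen : 'I_(s + s) -> ext B (s + s) :=
  gsum (fun i => ext_gen B (rshift s i)) (fun i => ext_gen B (lshift s i)).

Definition ext_swap : ext B (s + s) -> ext B (s + s) := extmap sw swap_gen.

HB.instance Definition _ := GRing.Additive.on ext_swap.

Lemma swap_odd i : has_deg 1 (swap_gen i).
Proof.
by rewrite /swap_gen; case: (split_ordP i) => j ->; rewrite ?gsuml ?gsumr.
Qed.

Lemma ext_swapM u v : ext_swap (u * v) = ext_swap u * ext_swap v.
Proof. exact: (extmapM _ swap_odd). Qed.

Lemma ext_swap_genl i : ext_swap (ext_gen B (lshift s i)) = ext_gen B (rshift s i).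
Proof. by rewrite /ext_swap extmap_gen /swap_gen gsuml. Qed.

Lemma ext_swap_genr i : ext_swap (ext_gen B (rshift s i)) = ext_gen B (lshift s i).
Proof. by rewrite /ext_swap extmap_gen /swap_gen gsumr. Qed.

Lemma has_deg_swap r u : has_deg r u -> has_deg r (ext_swap u).
Proof. exact: (has_deg_extmap _ swap_odd). Qed.

Lemma ext_swap_x a : ext_swap (ext_x a) = ext_y a.
Proof.
rewrite /ext_swap /ext_x extmap_comp; last exact: swap_odd.
by apply: eq_extmap => [p|i]; [exact: sw_x | exact: ext_swap_genl].
Qed.

Lemma ext_swap_y a : ext_swap (ext_y a) = ext_x a.
Proof.
rewrite /ext_swap /ext_y extmap_comp; last exact: swap_odd.
by apply: eq_extmap => [p|i]; [exact: sw_y | exact: ext_swap_genr].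
Qed.

Lemma koszul_swap u : koszul_xy (ext_swap u) = ext_swap (koszul_xy u).
Proof.
apply: (extmap_koszul swap_odd) => i; rewrite /swap_gen; case: (split_ordP i) => j ->.
  by rewrite !gsuml koszul_gen gsumr sw_x.
by rewrite !gsumr koszul_gen gsuml sw_y.
Qed.

End TwoCopies.

(** * The difference Jacobian and its homotopy *)

Lemma extmap_mulr_subst (A B : comNzRingType) m k (phi : {rmorphism A -> B})
    (v w : 'I_k -> ext B m) P a :
    (forall i, has_deg 1 (v i)) -> (forall i, has_deg 1 (w i)) ->
    (forall i, v i * P = w i * P) ->
  extmap phi v a * P = extmap phi w a * P.
Proof.
move=> v1 w1 vw; rewrite !extmapE !mulr_suml; apply: eq_bigr => I _.
by rewrite -!mulrA (prod_odd_subst _ v1 w1 vw).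
Qed.

Section NablaExtension.
Variables (A B : comNzRingType) (ey : {rmorphism A -> B}) (dg : {rmorphism B -> B}).
Variables (n s : nat) (u : 'I_n -> B) (f : 'I_s -> A).
Local Notation cst := (@ext_const _ _).
Variable nabla : ext B n -> ext B n.
Hypothesis dg_y : forall q, dg (ey q) = ey q.
Hypothesis nablaD : forall a b, nabla (a + b) = nabla a + nabla b.
Hypothesis nablaZ : forall q a, nabla (cst (ey q) * a) = cst (ey q) * nabla a.
Hypothesis nabla_deg : degree_one nabla.
Hypothesis nabla_htpy :
  forall c, koszul u (nabla c) + nabla (koszul u c) = c - cst (dg (c set0)).
Implicit Types (a : ext B n) (w : ext B (n + s)).

Lemma nabla0 : nabla 0 = 0.
Proof. by apply: (addrI (nabla 0)); rewrite -nablaD !addr0. Qed.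

Lemma nablaN a : nabla (- a) = - nabla a.
Proof. by apply: (addrI (nabla a)); rewrite -nablaD !subrr nabla0. Qed.

Lemma nabla_twist a : nabla (ext_twist a) = - ext_twist (nabla a).
Proof.
elim/ext_deg_ind: a => [a b IHa IHb|r a ar].
  by rewrite raddfD !nablaD IHa IHb raddfD opprD.
rewrite (twist_deg ar) (twist_deg (nabla_deg ar)) exprS mulN1r mulNr opprK.
by rewrite -signr_odd; case: odd; rewrite ?expr1 ?mulN1r ?mul1r // nablaN.
Qed.

(** The monomials in hat f_y stand on the right, so nabla passes no odd factor and the extension
    carries no sign. *)
Definition nabla_ext w : ext B (n + s) :=
  \sum_J einl s (nabla (rcoef w J)) * einr n (ext_mon 1 J).

Lemma nabla_extD w1 w2 : nabla_ext (w1 + w2) = nabla_ext w1 + nabla_ext w2.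
Proof.
rewrite /nabla_ext -big_split; apply: eq_bigr => J _ /=.
have -> : rcoef (w1 + w2) J = rcoef w1 J + rcoef w2 J.
  by apply/ffunP=> I; rewrite !ffunE.
by rewrite nablaD raddfD mulrDl.
Qed.

Lemma nabla_extZ p w : nabla_ext (cst (ey p) * w) = cst (ey p) * nabla_ext w.
Proof.
rewrite /nabla_ext mulr_sumr; apply: eq_bigr => J _.
have -> : rcoef (cst (ey p) * w) J = cst (ey p) * rcoef w J.
  by apply/ffunP=> I; rewrite ffunE !cstE ffunE.
by rewrite nablaZ rmorphM /= einl_cst mulrA.
Qed.

(** The right factor must have coefficients in the image of [ey], the only scalars over which nabla
    is linear. *)
Lemma nabla_extM a (b : ext A s) :
  nabla_ext (einl s a * einr n (extmap ey (@ext_gen B s) b)) =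
  einl s (nabla a) * einr n (extmap ey (@ext_gen B s) b).
Proof.
set b' := extmap _ _ b.
have -> : einl s (nabla a) * einr n b' =
    \sum_J einl s (nabla a) * einr n (cst (b' J) * ext_mon 1 J).
  by rewrite -mulr_sumr -raddf_sum -ext_sum.
apply: eq_bigr => J _.
rewrite rcoefM extmap_genE nablaZ !rmorphM /= einl_cst einr_cst.
by rewrite cst_commA mulrA.
Qed.

Lemma has_deg_nabla_ext r w : has_deg r w -> has_deg r.+1 (nabla_ext w).
Proof.
move=> wr; rewrite /nabla_ext (bigID (fun J : {set 'I_s} => #|J| <= r)%N) /=.
rewrite [X in _ + X]big1 ?addr0 => [|J ltJ].
  apply: has_deg_sum => J leJ; rewrite -(subnK leJ) -addSn; apply: has_degM.
    apply/has_deg_einl/nabla_deg => I Ir; rewrite ffunE wr // card_lrset.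
    by apply: contraNneq Ir => <-; rewrite addnK.
  exact/has_deg_einr/has_deg_mon.
rewrite (_ : rcoef w J = 0) ?nabla0 ?raddf0 ?mul0r //.
apply/ffunP=> I; rewrite !ffunE wr // card_lrset.
by rewrite gtn_eqF // ltn_addl // ltnNge.
Qed.

Definition koszul_uy : ext B (n + s) -> ext B (n + s) :=
  koszul (gsum u (fun i => ey (f i))).

HB.instance Definition _ := GRing.Additive.on koszul_uy.

Definition diag_gen : 'I_(n + s) -> ext B (n + s) :=
  gsum (fun=> 0) (fun i => ext_gen B (rshift n i)).

(* hat u_k |-> 0, x_k |-> y_k. *)
Definition diag_uy : ext B (n + s) -> ext B (n + s) := extmap dg diag_gen.

HB.instance Definition _ := GRing.Additive.on diag_uy.

Lemma diag_uy_odd i :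
  has_deg 1 (diag_gen i).
Proof.
rewrite /diag_gen; case: (split_ordP i) => j ->; rewrite ?gsuml ?gsumr.
  exact: has_deg0.
exact: has_deg_gen.
Qed.

Lemma diag_uy_einl a : diag_uy (einl s a) = cst (dg (a set0)).
Proof.
rewrite /diag_uy /einl extmap_comp; last exact: diag_uy_odd.
rewrite extmapE (bigD1 set0) //= big_set0 mulr1 big1 ?addr0 // => I /set0Pn[i iI].
have diag0 j : extmap dg diag_gen (ext_gen B (lshift s j)) = 0.
  by rewrite extmap_gen /diag_gen ?gsuml //; apply: diag_uy_odd.
rewrite -(setD1K iI) prod_oddU1 ?setD11 // => [|j]; rewrite diag0.
  by rewrite mul0r !mulr0.
exact: has_deg0.
Qed.

Lemma diag_uy_einr (b : ext A s) :
  diag_uy (einr n (extmap ey (@ext_gen B s) b)) =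
  einr n (extmap ey (@ext_gen B s) b).
Proof.
have g1 i : has_deg 1 (ext_gen B (rshift n i)) by exact: has_deg_gen.
have d1 := diag_uy_odd.
rewrite /diag_uy /einr [in RHS]extmap_comp // [extmap idfun _ _]extmap_comp // extmap_comp //.
apply: eq_extmap => [p|i] /=.
  exact: dg_y.
by rewrite !extmap_gen /diag_gen ?gsumr.
Qed.

(** For w = a b, with b a monomial in hat f_y, the two terms containing d b cancel because nabla
    anticommutes with the twist. What is left is the homotopy formula for a, multiplied by b, and
    the diagonal substitution fixes b. *)
Lemma nabla_ext_homotopy w :
  koszul_uy (nabla_ext w) + nabla_ext (koszul_uy w) = w - diag_uy w.
Proof.
elim/einlr_ind: w => [w1 w2 IH1 IH2|a J].
  rewrite (raddfD koszul_uy) nabla_extD nabla_extD (raddfD koszul_uy) (raddfD diag_uy).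
  by rewrite addrACA IH1 IH2 opprD addrACA.
have -> : ext_mon 1 J = extmap ey (@ext_gen B s) (ext_mon 1 J).
  by rewrite extmap_mon rmorph1 prod_gen mul1r.
set b := ext_mon 1 J; rewrite nabla_extM.
rewrite /koszul_uy !koszulM !koszul_einl !koszul_einr -!einl_twist.
have -> : koszul (fun i => ey (f i)) (extmap ey (@ext_gen B s) b) =
          extmap ey (@ext_gen B s) (koszul f b).
  apply: extmap_koszul => i; [exact: has_deg_gen | exact: koszul_gen].
rewrite nabla_extD !nabla_extM nabla_twist raddfN mulNr addrACA subrr addr0.
have E := nabla_htpy a.
rewrite -mulrDl -raddfD E raddfB mulrBl /= einl_cst; congr (_ - _).
rewrite -[in RHS](diag_uy_einr b).
by rewrite /diag_uy extmapM -/diag_uy ?diag_uy_einl ?diag_uy_einr //; apply: diag_uy_odd.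
Qed.

End NablaExtension.

Section Jacobian.
Variables (B : comNzRingType) (n s : nat).
Local Notation cst := (@ext_const _ _).
Implicit Types (D : 'I_n -> 'I_s -> B).

Definition theta D (i : 'I_s) : ext B n := \sum_k cst (D k i) * ext_gen B k.

Definition fdiff (i : 'I_s) : ext B (s + s) :=
  ext_gen B (lshift s i) - ext_gen B (rshift s i).

(* The cycles hat f_{i,x} - hat f_{i,y} - \sum_k (nabla^k f_i) hat u_k of     *)
(* C(x, y, hat f_x, hat f_y, hat u).                                          *)
Definition gam D (i : 'I_s) : ext B ((s + s) + n) :=
  einl n (fdiff i) - einr (s + s) (theta D i).

Definition gam_prod D := \prod_(i in [set: 'I_s]) gam D i.

Definition jac D : ext B (s + s) := ext_top (gam_prod D).

Lemma has_deg_theta D i : has_deg 1 (theta D i).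
Proof. by apply: has_deg_sum => k _; apply/has_degZ/has_deg_gen. Qed.

Lemma has_deg_fdiff i : has_deg 1 (fdiff i).
Proof. by apply: has_degB; apply: has_deg_gen. Qed.

Lemma has_deg_gam D i : has_deg 1 (gam D i).
Proof.
by apply: has_degB; [apply/has_deg_einl/has_deg_fdiff | apply/has_deg_einr/has_deg_theta].
Qed.

Lemma has_deg_gam_prod D : has_deg s (gam_prod D).
Proof.
have := has_deg_prod_odd (has_deg_gam D) (J := [set: 'I_s]).
by rewrite cardsT card_ord.
Qed.

(** P has degree s and cannot contain all n of the hat u. This case is treated apart throughout,
    since s - n is then truncated to 0. *)
Lemma jac_gt D : (s < n)%N -> jac D = 0.
Proof.
move=> ltsn; apply/ffunP=> I; rewrite !ffunE has_deg_gam_prod //.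
by rewrite card_lrset cardsT card_ord gtn_eqF // ltn_addl.
Qed.

Lemma has_deg_jac D : has_deg (s - n) (jac D).
Proof.
have [le_ns|lt_sn] := leqP n s; last by rewrite jac_gt //; apply: has_deg0.
by apply: has_deg_ext_top; rewrite subnK //; apply: has_deg_gam_prod.
Qed.

Lemma jac_sign D : ext_twist (jac D) = (-1) ^+ (n + s) * jac D.
Proof.
have [le_ns|lt_sn] := leqP n s; last by rewrite jac_gt // raddf0 mulr0.
rewrite (twist_deg (has_deg_jac D)); congr (_ * _).
by rewrite -signr_odd oddB // addbC -oddD signr_odd.
Qed.

Lemma gam_mul D i : gam D i * gam_prod D = 0.
Proof. by apply: prod_odd_mem; rewrite ?inE // => j; apply: has_deg_gam. Qed.

Variables (A : comNzRingType) (ex ey : {rmorphism A -> B}).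
Variables (u : 'I_n -> B) (f : 'I_s -> A).

Definition diff_quot D :=
  forall i, ex (f i) - ey (f i) = \sum_k u k * D k i.

Definition koszul_xyu : ext B ((s + s) + n) -> ext B ((s + s) + n) :=
  koszul (gsum (gsum (fun i => ex (f i)) (fun i => ey (f i))) u).

HB.instance Definition _ := GRing.Additive.on koszul_xyu.

Lemma koszul_theta D i : diff_quot D ->
  koszul u (theta D i) = cst (ex (f i) - ey (f i)).
Proof.
move=> DP; rewrite raddf_sum DP raddf_sum; apply: eq_bigr => k _ /=.
by rewrite koszul_cstM koszul_gen -rmorphM mulrC.
Qed.

Lemma koszul_gam D i : diff_quot D -> koszul_xyu (gam D i) = 0.
Proof.
move=> DP; rewrite /koszul_xyu raddfB /= koszul_einl koszul_einr koszul_theta //.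
by rewrite raddfB /= !koszul_gen gsuml gsumr -rmorphB einl_cst einr_cst subrr.
Qed.

Lemma koszul_gam_prod D : diff_quot D -> koszul_xyu (gam_prod D) = 0.
Proof.
by move=> DP; apply: koszul_prod_odd => i; [apply: has_deg_gam | apply: koszul_gam].
Qed.

Lemma koszul_jac D : diff_quot D -> koszul_xy ex ey f (jac D) = 0.
Proof.
move=> DP; rewrite /jac /koszul_xy -(ext_top_koszul _ u).
by rewrite [koszul _ _]koszul_gam_prod // raddf0.
Qed.

Section Homotopy.
Variables (nabla : ext B n -> ext B n) (D : 'I_n -> 'I_s -> B).
Variable dg : {rmorphism B -> B}.
Hypotheses (dg_x : forall q, dg (ex q) = ey q) (dg_y : forall q, dg (ey q) = ey q).
Hypothesis nablaD : forall a b, nabla (a + b) = nabla a + nabla b.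
Hypothesis nablaZ : forall q a, nabla (cst (ey q) * a) = cst (ey q) * nabla a.
Hypothesis nabla_deg : degree_one nabla.
Hypothesis nabla_htpy :
  forall c, koszul u (nabla c) + nabla (koszul u c) = c - cst (dg (c set0)).
Hypothesis DP : diff_quot D.
Implicit Types (c : ext A s).

(* [sigma] and [iota_uy] are chain maps, and the composite C(x, hat f) ->      *)
(* C(y, hat u, hat f_y) -> C(x, y, hat f_x, hat f_y, hat u) agrees with the    *)
(* inclusion after multiplication by [gam_prod], which kills each [gam D i].   *)
Definition sigma : ext A s -> ext B (n + s) :=
  extmap ex (fun i => einr n (ext_gen B i) + einl s (theta D i)).

Definition iota_gen : 'I_(n + s) -> ext B ((s + s) + n) :=
  gsum (fun k => ext_gen B (rshift (s + s) k))
       (fun i => ext_gen B (lshift n (rshift s i))).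

Definition iota_uy : ext B (n + s) -> ext B ((s + s) + n) := extmap idfun iota_gen.

HB.instance Definition _ := GRing.Additive.on sigma.
HB.instance Definition _ := GRing.Additive.on iota_uy.

Definition jac_homotopy c := ext_top (iota_uy (nabla_ext nabla (sigma c)) * gam_prod D).

Lemma sigma_odd i : has_deg 1 (einr n (ext_gen B i) + einl s (theta D i)).
Proof.
by apply: has_degD; [apply/has_deg_einr/has_deg_gen | apply/has_deg_einl/has_deg_theta].
Qed.

Lemma iota_odd i : has_deg 1 (iota_gen i).
Proof.
by rewrite /iota_gen; case: (split_ordP i) => j ->; rewrite ?gsuml ?gsumr; apply: has_deg_gen.
Qed.

Lemma iota_einl a : iota_uy (einl s a) = einr (s + s) a.
Proof.
rewrite /iota_uy /einl extmap_comp; last exact: iota_odd.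
by apply: eq_extmap => // k; rewrite extmap_gen /iota_gen ?gsuml //; apply: iota_odd.
Qed.

Lemma iota_einr_gen i :
  iota_uy (einr n (ext_gen B i)) = einl n (ext_gen B (rshift s i)).
Proof.
rewrite einr_gen einl_gen /iota_uy extmap_gen ?/iota_gen ?gsumr //.
Qed.

Lemma koszul_sigma c : koszul_uy ey u f (sigma c) = sigma (koszul f c).
Proof.
apply: extmap_koszul => i; first exact: sigma_odd.
rewrite raddfD /= koszul_einl koszul_einr koszul_theta // koszul_gen.
by rewrite einl_cst einr_cst -rmorphD addrC subrK.
Qed.

Lemma koszul_iota w : koszul_xyu (iota_uy w) = iota_uy (koszul_uy ey u f w).
Proof.
apply: extmap_koszul => i; first exact: iota_odd.
rewrite /iota_gen; case: (split_ordP i) => j ->.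
  by rewrite !gsuml koszul_gen gsumr.
by rewrite !gsumr koszul_gen gsuml gsumr.
Qed.

Lemma iota_sigma c : iota_uy (sigma c) * gam_prod D = einl n (ext_x ex c) * gam_prod D.
Proof.
rewrite /ext_x /iota_uy /sigma /einl.
rewrite [in LHS]extmap_comp; last exact: iota_odd.
rewrite extmap_comp; last by move=> i; apply: has_deg_gen.
rewrite (@eq_extmap _ _ _ _ (idfun \o ex) ex _ _ c (fun=> erefl) (fun=> erefl)).
rewrite (@eq_extmap _ _ _ _ (idfun \o ex) ex _ _ c (fun=> erefl) (fun=> erefl)).
apply: extmap_mulr_subst => i.
- by apply: has_deg_extmap; [apply: iota_odd | apply: sigma_odd].
- by apply: has_deg_extmap => [j|]; apply: has_deg_gen.
change (iota_uy (einr n (ext_gen B i) + einl s (theta D i)) * gam_prod D =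
  einl n (ext_gen B (lshift s i)) * gam_prod D).
rewrite raddfD /= iota_einr_gen iota_einl.
apply/eqP; rewrite -subr_eq0 -mulrBl -oppr_eq0 -mulNr opprB opprD addrA -raddfB.
by apply/eqP; apply: gam_mul.
Qed.

Lemma diag_sigma c :
  diag_uy dg (sigma c) = einr n (extmap ey (@ext_gen B s) c).
Proof.
rewrite /diag_uy /sigma /einr !extmap_comp => [|i|]; try exact: diag_uy_odd;
  last exact: has_deg_gen.
apply: eq_extmap => [p|i] /=; first exact: dg_x.
change (diag_uy dg (einr n (ext_gen B i) + einl s (theta D i)) =
  extmap idfun (fun i => ext_gen B (rshift n i)) (ext_gen B i)).
rewrite raddfD /= diag_uy_einl.
rewrite (_ : theta D i set0 = 0) ?rmorph0 ?addr0; last first.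
  by apply: (has_deg_theta D i); rewrite cards0.
by rewrite /diag_uy /einr !extmap_gen /diag_gen ?gsumr.
Qed.

Lemma iota_emb_y c :
  iota_uy (einr n (extmap ey (@ext_gen B s) c)) = einl n (ext_y ey c).
Proof.
rewrite /ext_y /iota_uy /einr /einl.
have i1 := iota_odd.
have g1 (j : 'I_s) : has_deg 1 (ext_gen B (rshift n j)) by exact: has_deg_gen.
have g2 (j : 'I_(s + s)) : has_deg 1 (ext_gen B (lshift n j)) by exact: has_deg_gen.
rewrite [in RHS]extmap_comp // [extmap _ (fun i => ext_gen B (rshift n i)) _]extmap_comp //.
rewrite extmap_comp //.
apply: eq_extmap => // i.
by rewrite !extmap_gen /iota_gen ?gsumr.
Qed.

(** As P is a cycle, right multiplication by it commutes with d. Apply the homotopy formula of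
    [nabla_ext] to w = [sigma] c: in front of P, the image of w becomes c(x), while its restriction
    to the diagonal becomes c(y). *)
Lemma jac_homotopyP c :
  (ext_x ex c - ext_y ey c) * jac D =
  koszul_xy ex ey f (jac_homotopy c) + jac_homotopy (koszul f c).
Proof.
rewrite /jac_homotopy /koszul_xy -(ext_top_koszul _ u) koszulM -/koszul_xyu.
rewrite koszul_gam_prod // mulr0 addr0 koszul_iota -koszul_sigma.
rewrite -raddfD -mulrDl -raddfD (nabla_ext_homotopy _ dg_y nablaD) //.
rewrite raddfB !mulrBl /= iota_sigma diag_sigma iota_emb_y.
by rewrite raddfB /= !ext_topMl.
Qed.

Lemma jac_homotopyD a b :
  jac_homotopy (a + b) = jac_homotopy a + jac_homotopy b.
Proof.
rewrite /jac_homotopy [sigma _]raddfD /= nabla_extD // [iota_uy _]raddfD /= mulrDl.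
exact: (raddfD (@ext_top B (s + s) n)).
Qed.

(** A scalar enters as p(x), whereas nabla is linear over R[y]; the two have to agree. The case of
    use is p in R. *)
Lemma jac_homotopyM p c : ex p = ey p ->
  jac_homotopy (cst p * c) = cst (ex p) * jac_homotopy c.
Proof.
move=> exy; rewrite /jac_homotopy /sigma extmap_cstM exy nabla_extZ // /iota_uy.
by rewrite extmap_cstM -mulrA -[X in ext_top (X * _)]einl_cst ext_topMl.
Qed.

Lemma has_deg_jac_homotopy r c : (n <= s)%N -> has_deg r c ->
  has_deg (r.+1 + (s - n)) (jac_homotopy c).
Proof.
move=> le_ns cr; apply: has_deg_ext_top.
have -> : (r.+1 + (s - n) + n = r.+1 + s)%N by rewrite -addnA subnK.
apply: has_degM (has_deg_gam_prod D).
apply: has_deg_extmap; first exact: iota_odd.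
apply: has_deg_nabla_ext => //; apply: has_deg_extmap => //; exact: sigma_odd.
Qed.

End Homotopy.
End Jacobian.

(** * Substitutions in polynomial rings *)

Lemma comp_mpolyA (R : comNzRingType) (k l n : nat) (p : {mpoly R[k]})
    (u : k.-tuple {mpoly R[l]}) (v : l.-tuple {mpoly R[n]}) :
  (p \mPo u) \mPo v = p \mPo [tuple tnth u i \mPo v | i < k].
Proof.
rewrite (mpolyE p) (raddf_sum (comp_mpoly u)) (raddf_sum (comp_mpoly v)) [RHS]raddf_sum.
apply: eq_bigr => m _ /=.
rewrite !comp_mpolyZ !comp_mpolyX rmorph_prod; congr (_ *: _).
by apply: eq_bigr => i _; rewrite rmorphXn tnth_mktuple.
Qed.

Lemma comp_mpolyXt (R : comNzRingType) (k l : nat) (u : k.-tuple {mpoly R[l]}) i :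
  'X_i \mPo u = tnth u i.
Proof. by rewrite comp_mpolyXU -tnth_nth. Qed.

Section Substitutions.
Variables (R : comNzRingType) (n : nat).
Implicit Types (p : {mpoly R[n]}) (q : {mpoly R[n + n]}).

HB.instance Definition _ := GRing.RMorphism.copy (@emb_x R n)
  (comp_mpoly [tuple 'X_(lshift n k) | k < n]).
HB.instance Definition _ := GRing.RMorphism.copy (@emb_y R n)
  (comp_mpoly [tuple 'X_(rshift n k) | k < n]).
HB.instance Definition _ := GRing.RMorphism.copy (@x_to_y R n)
  (comp_mpoly [tuple match split k with inl i | inr i => 'X_(rshift n i) end
         | k < n + n]).

Definition swap_xy q : {mpoly R[n + n]} :=
  q \mPo [tuple match split k with
                | inl i => 'X_(rshift n i)
                | inr i => 'X_(lshift n i) end | k < n + n].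

HB.instance Definition _ := GRing.RMorphism.copy swap_xy
  (comp_mpoly [tuple match split k with
                | inl i => 'X_(rshift n i)
                | inr i => 'X_(lshift n i) end | k < n + n]).

Lemma emb_xX k : emb_x 'X_k = 'X_(lshift n k) :> {mpoly R[n + n]}.
Proof. by rewrite /emb_x comp_mpolyXt tnth_mktuple. Qed.

Lemma emb_yX k : emb_y 'X_k = 'X_(rshift n k) :> {mpoly R[n + n]}.
Proof. by rewrite /emb_y comp_mpolyXt tnth_mktuple. Qed.

Lemma emb_xZ (r : R) p : emb_x (r *: p) = r *: emb_x p.
Proof. exact: comp_mpolyZ. Qed.

Lemma emb_yZ (r : R) p : emb_y (r *: p) = r *: emb_y p.
Proof. exact: comp_mpolyZ. Qed.

Lemma x_to_y_emb_x p : x_to_y (emb_x p) = emb_y p.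
Proof.
rewrite /x_to_y /emb_x comp_mpolyA; congr comp_mpoly; apply: eq_from_tnth => i.
by rewrite !tnth_mktuple comp_mpolyXt tnth_mktuple (unsplitK (inl i)).
Qed.

Lemma swap_emb_x p : swap_xy (emb_x p) = emb_y p.
Proof.
rewrite /swap_xy /emb_x comp_mpolyA; congr comp_mpoly; apply: eq_from_tnth => i.
by rewrite !tnth_mktuple comp_mpolyXt tnth_mktuple (unsplitK (inl i)).
Qed.

Lemma swap_emb_y p : swap_xy (emb_y p) = emb_x p.
Proof.
rewrite /swap_xy /emb_y comp_mpolyA; congr comp_mpoly; apply: eq_from_tnth => i.
by rewrite !tnth_mktuple comp_mpolyXt tnth_mktuple (unsplitK (inr i)).
Qed.

Lemma swap_diff k : swap_xy (diff_xy R k) = - diff_xy R k.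
Proof. by rewrite /diff_xy rmorphB -emb_xX -emb_yX /= swap_emb_x swap_emb_y opprB. Qed.

End Substitutions.

(** * Exchanging the two copies *)

Section SwapJacobian.
Variables (B : comNzRingType) (n s : nat) (sw : {rmorphism B -> B}).
Implicit Types (D : 'I_n -> 'I_s -> B).
Local Notation cst := (@ext_const _ _).

(** The hat u_k are negated because x_k - y_k changes sign under the exchange; each gamma_i then
    goes to minus the gamma_i of the exchanged matrix. *)
Let su : 'I_((s + s) + n) -> ext B ((s + s) + n) :=
  gsum (fun j => einl n (swap_gen B j)) (fun k => cst (- 1) * ext_gen B (rshift (s + s) k)).

Let su_odd i : has_deg 1 (su i).
Proof.
rewrite /su; case: (split_ordP i) => j ->; rewrite ?gsuml ?gsumr.
  by apply/has_deg_einl/swap_odd.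
by apply/has_degZ/has_deg_gen.
Qed.

Let su_gam D i : extmap sw su (gam D i) = - gam (fun k i => sw (D k i)) i.
Proof.
rewrite /gam raddfB /= /einl /einr !extmap_comp //.
have -> : extmap (sw \o idfun : {rmorphism B -> B})
    (fun i => extmap sw su (ext_gen B (lshift n i))) (fdiff B i) = - einl n (fdiff B i).
  rewrite /fdiff raddfB [einl n _]raddfB /= !extmap_gen /su !gsuml /swap_gen gsuml gsumr.
  by rewrite opprB.
have -> : extmap (sw \o idfun : {rmorphism B -> B})
    (fun i => extmap sw su (ext_gen B (rshift (s + s) i))) (theta D i) =
    - einr (s + s) (theta (fun k i => sw (D k i)) i).
  rewrite /theta [LHS]raddf_sum (raddf_sum (@einr B (s + s) n)) -sumrN.
  apply: eq_bigr => k _ /=.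
  rewrite extmap_cstM !extmap_gen /su !gsumr rmorphM /= einr_cst einr_gen.
  by rewrite mulrA -rmorphM mulrN1 rmorphN mulNr.
by rewrite opprD.
Qed.

(** The s factors of P contribute (-1)^s and the n negated generators hat u contribute (-1)^n. *)
Lemma swap_jac D :
  ext_swap sw (jac D) = (-1) ^+ (n + s) * jac (fun k i => sw (D k i)).
Proof.
have E : extmap sw su (gam_prod D) = (-1) ^+ s * gam_prod (fun k i => sw (D k i)).
  rewrite /gam_prod (big_morph (extmap sw su) (extmapM sw su_odd) (extmap1 sw su)).
  by under eq_bigr do rewrite su_gam; rewrite prodrN cardsT card_ord.
have sul i : su (lshift n i) = einl n (swap_gen B i) by rewrite /su gsuml.
have sur i : su (rshift (s + s) i) = cst (- 1) * ext_gen B (rshift (s + s) i).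
  by rewrite /su gsumr.
have := ext_top_extmap sw (gam_prod D) (@swap_odd B s) sul sur; rewrite E.
rewrite -(rmorph_sign (@einl B (s + s) n)) ext_topMl -/(jac _) => H.
rewrite exprD -mulrA H rmorphXn rmorphN rmorph1 /= mulrA -exprD.
by rewrite -signr_odd oddD addbb mul1r.
Qed.

End SwapJacobian.

(** * Products of odd elements modulo an ideal *)

Section Ideal.
Variables (B : comNzRingType) (n : nat) (u : 'I_n -> B) (K : B -> Prop).
Local Notation cst := (@ext_const _ _).
Hypotheses (K0 : K 0) (KD : forall p q, K p -> K q -> K (p + q)).
Hypothesis (KM : forall p q, K q -> K (p * q)).
Implicit Types (a b : ext B n) (T : 'I_n -> ext B n).

Definition in_ideal a := forall I, K (a I).

Lemma ideal_sum (I : Type) (l : seq I) (P : pred I) (F : I -> B) :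
  (forall i, P i -> K (F i)) -> K (\sum_(i <- l | P i) F i).
Proof. by move=> KF; apply: big_ind. Qed.

Lemma in_idealD a b : in_ideal a -> in_ideal b -> in_ideal (a + b).
Proof. by move=> Ka Kb I; rewrite ffunE; apply: KD. Qed.

Lemma in_ideal0 : in_ideal 0.
Proof. by move=> I; rewrite ffunE. Qed.

Lemma in_idealMl a b : in_ideal b -> in_ideal (a * b).
Proof. by move=> Kb I; rewrite extM ffunE; apply: ideal_sum => L _; apply: KM. Qed.

Lemma in_idealMr a b : in_ideal a -> in_ideal (a * b).
Proof.
by move=> Ka I; rewrite extM ffunE; apply: ideal_sum => L _; rewrite mulrC; apply/KM/KM.
Qed.

Lemma in_idealN a : in_ideal a -> in_ideal (- a).
Proof. by move=> Ka; rewrite -mulN1r; apply: in_idealMl. Qed.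

Lemma in_ideal_cst q : K q -> in_ideal (cst q).
Proof. by move=> Kq I; rewrite ffunE; case: eqP. Qed.

Lemma in_ideal_koszul_prod (k : nat) (T : 'I_k -> ext B n) l :
  (forall i, in_ideal (koszul u (T i))) ->
  in_ideal (koszul u (\prod_(i <- l) T i)).
Proof.
move=> KT; elim: l => [|i l IH]; first by rewrite big_nil koszul1; apply: in_ideal0.
by rewrite big_cons koszulM; apply: in_idealD; [apply: in_idealMr | apply: in_idealMl].
Qed.

(* Modulo the ideal, replacing T i by T' i changes the product by the boundary  *)
(* of an element of degree n + 1, which is 0.                                   *)
Lemma prod_cong_ideal T T' (eta kap : 'I_n -> ext B n) :
    (forall i, has_deg 1 (T i)) -> (forall i, has_deg 1 (T' i)) ->
    (forall i, has_deg 2 (eta i)) -> (forall i, in_ideal (kap i)) ->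
    (forall i, in_ideal (koszul u (T i))) -> (forall i, in_ideal (koszul u (T' i))) ->
    (forall i, T i - T' i = koszul u (eta i) + kap i) ->
  in_ideal (\prod_i T i - \prod_i T' i).
Proof.
move=> T1 T1' eta2 Kkap KT KT' TT'.
(* [M k a] says that a is, modulo the ideal, the boundary of an element of degree k. *)
pose M k a := exists xi, has_deg k xi /\ in_ideal (a - koszul u xi).
have MD k a b : M k a -> M k b -> M k (a + b).
  move=> [x [xk Kx]] [y [yk Ky]]; exists (x + y); split; first exact: has_degD.
  by rewrite raddfD /= opprD addrACA; apply: in_idealD.
have MK k a : in_ideal a -> M k a.
  by move=> Ka; exists 0; split; [apply: has_deg0 | rewrite raddf0 subr0].
have Md k x : has_deg k x -> M k (koszul u x).
  by move=> xk; exists x; split=> //; rewrite subrr; apply: in_ideal0.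
have H l : M (size l).+1 (\prod_(i <- l) T i - \prod_(i <- l) T' i).
  elim: l => [|i l [xi [xi_deg IH]]].
    by rewrite !big_nil subrr; apply/MK/in_ideal0.
  have degT : has_deg (size l) (\prod_(i <- l) T i).
    elim: (l) => [|j l' IHl]; rewrite ?big_nil ?big_cons.
      by rewrite -(rmorph1 (@ext_const _ _)); apply: has_deg_cst.
    exact: has_degM (T1 j) IHl.
  rewrite !big_cons; set W := \prod_(_ <- _) _; set W' := \prod_(_ <- _) _.
  (* Telescoping: T W - T' W' = (T - T') W + T' (W - W'), where W - W' is a boundary up to the ideal
     by induction. All boundaries of factors lie in the ideal, so d can be moved out of each
     product. *)
  have -> : T i * W - T' i * W' =
      (koszul u (eta i) * W + kap i * W) +
      (T' i * koszul u xi + T' i * (W - W' - koszul u xi)).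
    by rewrite -mulrDl -TT' -mulrDr [koszul u xi + _]addrC subrK mulrBl mulrBr addrA subrK.
  apply: (MD); apply: (MD).
  - have -> : koszul u (eta i) * W =
        koszul u (eta i * W) - ext_twist (eta i) * koszul u W by rewrite koszulM addrK.
    apply: MD; first by apply: Md; exact: has_degM (eta2 i) degT.
    exact/MK/in_idealN/in_idealMl/in_ideal_koszul_prod.
  - exact/MK/in_idealMr.
  - have -> : T' i * koszul u xi = koszul u (T' i) * xi - koszul u (T' i * xi).
      by rewrite koszulM (twist_deg (T1' i)) mulN1r mulNr opprD opprK addrA subrr add0r.
    apply: MD; first exact/MK/in_idealMr.
    by rewrite -raddfN; apply/Md/has_degN; rewrite -add1n; apply: has_degM.
  exact/MK/in_idealMl.
have sz : size (index_enum 'I_n) = n by rewrite -[index_enum _]enumT size_enum_ord.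
have [xi []] := H (index_enum 'I_n); rewrite sz => xi_deg.
by rewrite (has_deg_gt (ltnSn n) xi_deg) raddf0 subr0 => Kxi; exact Kxi.
Qed.

End Ideal.

(** * The residue of the difference Jacobian *)

Section ResidueCoefficient.
Variables (A B : comNzRingType) (n s : nat) (ey : {rmorphism A -> B}).
Variables (D : 'I_n -> 'I_s -> B) (al : 'I_n -> 'I_s -> A).
Local Notation cst := (@ext_const _ _).

(* A lift of g_l = \sum_i al l i * f i to degree 1. *)
Definition alpha1 (l : 'I_n) : ext A s := \sum_i cst (al l i) * ext_gen A i.
Definition alpha : ext A s := \prod_(l in [set: 'I_n]) alpha1 l.

Lemma alpha1_odd l : has_deg 1 (alpha1 l).
Proof. by apply: has_deg_sum => k _; apply/has_degZ/has_deg_gen. Qed.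

Lemma has_deg_alpha : has_deg n alpha.
Proof. by have := has_deg_prod_odd alpha1_odd (J := [set: 'I_n]); rewrite cardsT card_ord. Qed.

(* hat f_{i,x} |-> 0. *)
Definition piy_gen : 'I_(s + s) -> ext B s := gsum (fun=> 0) (@ext_gen B s).
Definition piy : ext B (s + s) -> ext B s := extmap idfun piy_gen.

HB.instance Definition _ := GRing.Additive.on piy.

Lemma piy_odd i : has_deg 1 (piy_gen i).
Proof.
rewrite /piy_gen; case: (split_ordP i) => j ->; rewrite ?gsuml ?gsumr.
  exact: has_deg0.
exact: has_deg_gen.
Qed.

(** The cycle gamma_i after f_{i,x} is set to zero. *)
Definition gam0 (i : 'I_s) : ext B (s + n) := - einl n (ext_gen B i) - einr s (theta D i).
Definition gam0_prod := \prod_(i in [set: 'I_s]) gam0 i.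

Lemma gam0_odd i : has_deg 1 (gam0 i).
Proof.
apply: has_degB; first by apply/has_degN/has_deg_einl/has_deg_gen.
by apply/has_deg_einr/has_deg_theta.
Qed.

Lemma piy_jac : piy (jac D) = ext_top gam0_prod.
Proof.
pose v : 'I_((s + s) + n) -> ext B (s + n) :=
  gsum (fun j => einl n (piy_gen j)) (fun k => cst 1 * ext_gen B (rshift s k)).
have vl i : v (lshift n i) = einl n (piy_gen i) by rewrite /v gsuml.
have vr i : v (rshift (s + s) i) = cst 1 * ext_gen B (rshift s i) by rewrite /v gsumr.
have v_odd i : has_deg 1 (v i).
  case: (split_ordP i) => j ->; rewrite ?vl ?vr; first exact/has_deg_einl/piy_odd.
  by apply/has_degZ/has_deg_gen.
have := ext_top_extmap idfun (gam_prod D) piy_odd vl vr.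
rewrite expr1n rmorph1 mul1r /piy /jac => <-; congr ext_top.
rewrite /gam_prod (big_morph (extmap idfun v) (extmapM idfun v_odd) (extmap1 idfun v)).
apply: eq_bigr => i _; rewrite /gam raddfB /= /einl /einr !extmap_comp //.
rewrite /gam0; congr (_ - _).
  rewrite raddfB /= !extmap_gen !vl /piy_gen gsuml gsumr raddf0 sub0r.
  by rewrite einl_gen.
rewrite /einr; apply: eq_extmap => // k; rewrite extmap_gen vr rmorph1 mul1r //.
Qed.

(** What becomes of alpha_l(y) when the generators are replaced by the [theta] i. Its boundary is
    g_l(x) - g_l(y) up to multiples of the f_i(x). *)
Definition Theta (l : 'I_n) : ext B n := \sum_i cst (ey (al l i)) * theta D i.

Lemma Theta_odd l : has_deg 1 (Theta l).
Proof. by apply: has_deg_sum => k _; apply/has_degZ/has_deg_theta. Qed.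

Lemma ext_topdeg (m : nat) (w : ext B m) : has_deg m w -> w = cst (w setT) * ext_mon 1 setT.
Proof.
move=> wm; apply/ffunP=> I; rewrite cstE ffunE; case: eqP => [->|neI]; first by rewrite mulr1.
rewrite mulr0 wm //; have := @proper_card _ (mem I) (mem [set: 'I_m]).
by rewrite -/(_ \proper _) cardsT card_ord properT neq_ltn => -> //; apply/eqP.
Qed.

Let alpha_y := extmap ey (@ext_gen B s) alpha.
Let mu := (\prod_(l in [set: 'I_n]) Theta l) setT.

(** In front of the product of the [gam0], each f_{i,y} acts as -[theta] i, so alpha(y) acts as the
    product of the -[Theta] l, that is (-1)^n mu times the top monomial in hat u. This monomial
    kills every [theta] i for degree reasons, so only the product of the -f_{i,y} survives; (-1)^s
    comes from these signs and (-1)^(n s) from reordering. *)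
Lemma alpha_jac : (alpha_y * piy (jac D)) setT = (-1) ^+ (n + s + n * s) * mu.
Proof.
have gen1 i : has_deg 1 (ext_gen B (i : 'I_s)) by exact: has_deg_gen.
have gam0E i : einl n (ext_gen B i) * gam0_prod = - einr s (theta D i) * gam0_prod.
  apply/eqP; rewrite -subr_eq0 -mulrBl opprK -oppr_eq0 -mulNr opprD.
  by apply/eqP; apply: (prod_odd_mem gam0_odd); rewrite inE.
have alE : einl n alpha_y * gam0_prod =
    (\prod_(l in [set: 'I_n]) - einr s (Theta l)) * gam0_prod.
  rewrite /alpha_y /alpha (big_morph _ (extmapM ey gen1) (extmap1 ey _)) rmorph_prod.
  apply: prod_odd_subst => l; first by apply/has_deg_einl/has_deg_extmap/alpha1_odd.
    by apply/has_degN/has_deg_einr/Theta_odd.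
  rewrite /= /alpha1 /Theta [extmap _ _ _]raddf_sum [einl n _]raddf_sum.
  rewrite [einr s _]raddf_sum -sumrN !mulr_suml; apply: eq_bigr => i _ /=.
  rewrite extmap_cstM extmap_gen !rmorphM /= einl_cst einr_cst.
  by rewrite -mulrN -!mulrA gam0E.
have muE : \prod_(l in [set: 'I_n]) Theta l = cst mu * ext_mon 1 setT.
  apply: ext_topdeg.
  by have := has_deg_prod_odd Theta_odd (J := [set: 'I_n]); rewrite cardsT card_ord.
have degT : has_deg n (ext_mon 1 [set: 'I_n] : ext B n).
  by have := @has_deg_mon B n 1 setT; rewrite cardsT card_ord.
have TP : einr s (ext_mon 1 setT) * gam0_prod =
    (-1) ^+ (n * s + s) * (einl n (ext_mon 1 setT) * einr s (ext_mon 1 setT)) :> ext B _.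
  have degP : has_deg s gam0_prod.
    by have := has_deg_prod_odd gam0_odd (J := [set: 'I_s]); rewrite cardsT card_ord.
  rewrite (graded_comm (has_deg_einr (m := s) degT) degP) exprD -mulrA; congr (_ * _).
  have lodd i : has_deg 1 (- einl n (ext_gen B (i : 'I_s))).
    by apply/has_degN/has_deg_einl/has_deg_gen.
  rewrite (@prod_odd_subst _ _ _ _ _ _ setT gam0_odd lodd) => [|i].
    rewrite prodrN cardsT card_ord -mulrA; congr (_ * (_ * _)).
    by rewrite -rmorph_prod prod_gen.
  rewrite /gam0 mulrBl -rmorphM /= (has_deg_gt _ (has_degM (has_deg_theta D i) degT)) //.
  by rewrite raddf0 subr0.
rewrite piy_jac -ext_topMl alE prodrN -rmorph_prod muE rmorphM /= einr_cst.
rewrite cardsT card_ord -!mulrA TP.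
rewrite -!(rmorph_sign cst) ffunE !cstE.
have -> : (einl n (ext_mon 1 setT) * einr s (ext_mon 1 setT)) (lrset setT setT) = 1 :> B.
  by rewrite einlrE lpartK rpartK !ext_monE !eqxx mulr1.
by rewrite mulr1 mulrCA -exprD mulrC [(n * s + s)%N]addnC addnA.
Qed.

End ResidueCoefficient.

Section ResidueCongruence.
Variables (A B : comNzRingType) (n s : nat) (ex ey : {rmorphism A -> B}).
Variables (u : 'I_n -> B) (f : 'I_s -> A).
Variables (D : 'I_n -> 'I_s -> B) (al : 'I_n -> 'I_s -> A).
Variables (nabla : ext B n -> ext B n) (dg : {rmorphism B -> B}) (K : B -> Prop).
Local Notation cst := (@ext_const _ _).
Hypothesis dg_x : forall q, dg (ex q) = ey q.
Hypothesis nabla0 : nabla 0 = 0.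
Hypothesis nabla_deg : degree_one nabla.
Hypothesis nabla_htpy :
  forall c, koszul u (nabla c) + nabla (koszul u c) = c - cst (dg (c set0)).
Hypothesis DP : diff_quot ex ey u f D.
Hypotheses (K0 : K 0) (KD : forall p q, K p -> K q -> K (p + q)).
Hypothesis (KM : forall p q, K q -> K (p * q)).

Let g l := \sum_i al l i * f i.
Hypotheses (K_f : forall i, K (ex (f i))) (K_g : forall l, K (ey (g l))).
Variable T : 'I_n -> ext B n.
Hypothesis T_odd : forall l, has_deg 1 (T l).
Hypothesis koszul_T : forall l, koszul u (T l) = cst (ex (g l) - ey (g l)).

(* Adding \sum_i f_i(x) nabla (al l i) to Theta l gives a difference quotient   *)
(* of g_l, whose product depends on the choice only up to the g_l(x) - g_l(y).  *)
Lemma prod_Theta_cong :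
  K ((\prod_(l in [set: 'I_n]) Theta ey D al l) setT - (\prod_(l in [set: 'I_n]) T l) setT).
Proof.
have KN q : K q -> K (- q) by move=> Kq; rewrite -mulN1r; apply: KM.
have K_exg l : K (ex (g l)).
  by rewrite rmorph_sum; apply: ideal_sum => // i _; rewrite rmorphM; apply: KM.
pose S l := \sum_i cst (ex (f i)) * nabla (cst (ex (al l i))).
have S_odd l : has_deg 1 (S l).
  by apply: has_deg_sum => i _; apply/has_degZ/nabla_deg/has_deg_cst.
have KS l : in_ideal K (S l).
  move=> I; rewrite sum_ffunE; apply: ideal_sum => // i _.
  by rewrite cstE mulrC; apply: KM.
have koszul_Theta l : koszul u (Theta ey D al l) =
    cst (\sum_i ey (al l i) * (ex (f i) - ey (f i))).
  rewrite raddf_sum raddf_sum; apply: eq_bigr => i _ /=.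
  by rewrite koszul_cstM (koszul_theta _ DP) -rmorphM.
have koszul_S l : koszul u (S l) = cst (\sum_i ex (f i) * (ex (al l i) - ey (al l i))).
  rewrite raddf_sum raddf_sum; apply: eq_bigr => i _ /=.
  rewrite koszul_cstM rmorphM; congr (_ * _).
  have := nabla_htpy (cst (ex (al l i))).
  by rewrite koszul_cst nabla0 addr0 ffunE eqxx dg_x -rmorphB.
have koszul0 l : koszul u (Theta ey D al l + S l - T l) = 0.
  rewrite raddfB raddfD /= koszul_Theta koszul_S koszul_T -rmorphD -rmorphB.
  rewrite -big_split /g !rmorph_sum /= -!sumrB -[RHS](rmorph0 cst); congr cst.
  by apply: big1 => i _; rewrite !rmorphM; ring.
(* [Theta] l + S l and T l have the same boundary. Their difference is a cycle of degree 1 without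
   constant term, hence the boundary of its image under nabla. *)
have eta_eq l : Theta ey D al l - T l =
    koszul u (nabla (Theta ey D al l + S l - T l)) + - S l.
  have := nabla_htpy (Theta ey D al l + S l - T l); rewrite koszul0 nabla0 addr0 => ->.
  have odd1 : has_deg 1 (Theta ey D al l + S l - T l).
    by apply: has_degB => //; apply: has_degD => //; exact: Theta_odd.
  by rewrite (odd1 set0) ?cards0 // !rmorph0 subr0 addrAC addrK.
have KP : in_ideal K (\prod_l Theta ey D al l - \prod_l T l).
  apply: (@prod_cong_ideal B n u K K0 KD KM _ _
    (fun l => nabla (Theta ey D al l + S l - T l)) (fun l => - S l)) => // l.
  - exact: Theta_odd.
  - apply: nabla_deg; apply: has_degB => //; apply: has_degD => //; exact: Theta_odd.
  - exact: in_idealN.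
  - rewrite koszul_Theta; apply: in_ideal_cst => //.
    under eq_bigr do rewrite mulrBr.
    rewrite sumrB; apply: KD; first by apply: ideal_sum => // i _; apply: KM.
    by apply: KN; have := K_g l; rewrite /g rmorph_sum /=; under eq_bigr do rewrite rmorphM.
  by rewrite koszul_T; apply: in_ideal_cst => //; apply: KD => //; apply: KN.
have E (F : 'I_n -> ext B n) : \prod_(l in [set: 'I_n]) F l = \prod_l F l.
  by apply: eq_bigl => l; rewrite inE.
by have := KP setT; rewrite !E !ffunE.
Qed.

End ResidueCongruence.

(** * Determinants *)

Lemma big_subsetU1 (V : nmodType) k (i : 'I_k) (S : {set 'I_k}) (F : {set 'I_k} -> V) :
  i \notin S ->
  \sum_(I : {set 'I_k} | I \subset i |: S) F I =
  \sum_(I : {set 'I_k} | I \subset S) F (i |: I) + \sum_(I : {set 'I_k} | I \subset S) F I.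
Proof.
move=> iS; rewrite (bigID (fun I : {set 'I_k} => i \in I)) /=; congr (_ + _).
  rewrite (reindex_onto (fun I => i |: I) (fun I => I :\ i)) /=; last first.
    by move=> I /andP[_ iI]; rewrite setD1K.
  apply: eq_bigl => I; rewrite setU11 andbT.
  apply/andP/idP=> [[/subsetP sI /eqP eI]|sI].
    apply/subsetP=> j jI; have := sI j; rewrite !inE jI orbT => /(_ isT).
    by case/predU1P=> // ji; move: jI; rewrite -eI ji !inE eqxx.
  by rewrite setUS // setU1K //; apply: contraNN iS; apply: (subsetP sI).
apply: eq_bigl => I; apply/andP/idP=> [[/subsetP sI iI]|sI].
  apply/subsetP=> j jI; have := sI j jI; rewrite !inE => /predU1P[ji|//].
  by rewrite -ji jI in iI.
split; first exact: subset_trans sI (subsetUr _ _).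
by apply: contraNN iS; apply: (subsetP sI).
Qed.

Lemma sgn_comm (B : comNzRingType) k (I J : {set 'I_k}) : [disjoint I & J] ->
  sgn B I J * sgn B J I = (-1) ^+ (#|I| * #|J|).
Proof.
move=> dIJ; rewrite /sgn [X in _ * X]exchange_big -big_split /=.
rewrite mulnC exprM -prodr_const; apply: eq_bigr => i iI.
rewrite -big_split -prodr_const; apply: eq_bigr => j jJ /=.
rewrite -signr_addb; case: ltngtP => //= /val_inj ij.
by move/pred0P/(_ i): dIJ; rewrite /= iI -ij jJ.
Qed.

(** The expansion of a product of binomials, where [sgn] records the cost of collecting the v's to
    the left of the w's. *)
Lemma prod_oddD (B : comNzRingType) m k (v w : 'I_k -> ext B m) (S : {set 'I_k}) :
    (forall i, has_deg 1 (v i)) -> (forall i, has_deg 1 (w i)) ->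
  \prod_(i in S) (v i + w i) =
  \sum_(I : {set 'I_k} | I \subset S) ext_const m (sgn B I (S :\: I)) *
    (\prod_(i in I) v i * \prod_(i in S :\: I) w i).
Proof.
move=> v1 w1; have vw1 i : has_deg 1 (v i + w i) by apply: has_degD.
elim/set_ind: S => [|i S iS IH].
  rewrite big_set0 (big_pred1 set0) => [|I]; last by rewrite subset0.
  by rewrite setDv !big_set0 sgn0l rmorph1 !mulr1.
rewrite prod_oddU1 // IH big_subsetU1 // mulrDl mulrDr !mulr_sumr.
congr (_ + _); apply: eq_bigr => I IS; have iI : i \notin I.
- by apply: contraNN iS; apply: (subsetP IS).
- have -> : (i |: S) :\: (i |: I) = S :\: I.
    by apply/setP=> j; rewrite !inE; case: eqVneq => [->|]//=; rewrite (negbTE iS) andbF.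
  have eS : S = I :|: (S :\: I) by rewrite -{1}(setID S I) (setIidPr IS).
  have dI : [disjoint I & S :\: I].
    by rewrite disjoints_subset; apply/subsetP=> j; rewrite !inE => ->.
  rewrite {1}eS sgnUr // sgnUl ?disjoints1 // (prod_oddU1 v1) //.
  rewrite cst_commA !mulrA -!rmorphM; congr (ext_const _ _ * _ * _ * _); ring.
- by apply: contraNN iS; apply: (subsetP IS).
have iK : i \notin S :\: I by rewrite inE negb_and iS orbT.
have -> : (i |: S) :\: I = i |: (S :\: I).
  by rewrite setDUl; congr (_ :|: _); apply/setDidPl; rewrite disjoints1.
have eS : S = I :|: (S :\: I) by rewrite -{1}(setID S I) (setIidPr IS).
have dI : [disjoint I & S :\: I].
  by rewrite disjoints_subset; apply/subsetP=> j; rewrite !inE => ->.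
have dK : [disjoint [set i] & S :\: I] by rewrite disjoints1.
rewrite {1}eS !sgnUr // (prod_oddU1 w1) //.
have -> : sgn B I [set i] = (-1) ^+ #|I| * sgn B [set i] I.
  by rewrite -(sgn_comm1 _ iI) -mulrA sgn_sq mulr1.
rewrite (cst_commA _ (w i)) (cst_commA _ (\prod_(j in I) v j)).
rewrite (mulrA (w i)) (odd_comm _ (w1 i)).
rewrite (twist_deg (has_deg_prod_odd v1 (J := I))) -(rmorph_sign (@ext_const B m)).
rewrite !mulrA -!rmorphM; congr (ext_const _ _ * _ * _ * _); ring.
Qed.

Lemma prod_odd_eq0 (B : comNzRingType) m k (v : 'I_k -> ext B m) (i j : 'I_k) :
  (forall i, has_deg 1 (v i)) -> i != j -> v i = v j -> \prod_(l in [set: 'I_k]) v l = 0.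
Proof.
move=> v1 neij vij; rewrite -(setD1K (in_setT i)) (prod_oddU1 v1) ?setD11 // vij.
by rewrite (prod_odd_mem v1) ?mulr0 // !inE eq_sym neij.
Qed.

Lemma prod_odd_tperm (B : comNzRingType) m k (v : 'I_k -> ext B m) (i j : 'I_k) :
    (forall i, has_deg 1 (v i)) -> i != j ->
  \prod_(l in [set: 'I_k]) v (tperm i j l) = - \prod_(l in [set: 'I_k]) v l.
Proof.
move=> v1 neij; set S := [set: 'I_k] :\ i :\ j.
have E (w : 'I_k -> ext B m) : (forall i, has_deg 1 (w i)) ->
    \prod_(l in [set: 'I_k]) w l =
    ext_const m (sgn B [set i] ([set: 'I_k] :\ i) * sgn B [set j] S) *
      (w i * w j * \prod_(l in S) w l).
  move=> w1; rewrite -[in LHS](setD1K (in_setT i)) (prod_oddU1 w1) ?setD11 //.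
  rewrite -[in X in _ * X = _](@setD1K _ j ([set: 'I_k] :\ i)) ?(prod_oddU1 w1) ?setD11 //.
    by rewrite -/S cst_commA rmorphM !mulrA.
  by rewrite !inE eq_sym neij.
rewrite !E //.
rewrite tpermL tpermR (odd_anticomm (v1 j) (v1 i)) mulNr mulrN.
congr (- (_ * (_ * _))); apply: eq_bigr => l; rewrite !inE => /andP[lj /andP[li _]].
by rewrite tpermD // eq_sym.
Qed.

Lemma prod_odd_perm (B : comNzRingType) m k (v : 'I_k -> ext B m) (p : 'S_k) :
    (forall i, has_deg 1 (v i)) ->
  \prod_(l in [set: 'I_k]) v (p l) = (-1) ^+ p * \prod_(l in [set: 'I_k]) v l.
Proof.
move=> v1; have [ts -> ok] := prod_tpermP p; elim: ts ok => [_|[i j] ts IH] /=.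
  rewrite big_nil odd_perm1 expr0 mul1r; apply: eq_bigr => l _; by rewrite perm1.
case/andP=> neij /IH {}IH; rewrite big_cons odd_mul_tperm signr_addb -mulrA -IH.
rewrite /= neij expr1 mulN1r -(prod_odd_tperm _ neij) => [|l]; last exact: v1.
by apply: eq_bigr => l _; rewrite permM.
Qed.

(** Expand over all maps from columns to rows: maps with a repeated value give zero, and
    permutations give the Leibniz formula. *)
Lemma prod_det (B : comNzRingType) n (N : 'M[B]_n) :
  \prod_(l in [set: 'I_n]) (\sum_k ext_const n (N k l) * ext_gen B k) =
  ext_const n (\det N) * ext_mon 1 setT.
Proof.
rewrite (eq_bigl xpredT) => [|l]; last by rewrite inE.
rewrite bigA_distr_bigA /=.
have g1 k : has_deg 1 (ext_gen B (k : 'I_n)) by exact: has_deg_gen.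
have split_prod (p : 'I_n -> 'I_n) :
    \prod_l (ext_const n (N (p l) l) * ext_gen B (p l)) =
    ext_const n (\prod_l N (p l) l) * \prod_(l in [set: 'I_n]) ext_gen B (p l).
  rewrite [X in _ * X](eq_bigl xpredT) => [|l]; last by rewrite inE.
  elim: (index_enum _) => [|l r IH]; first by rewrite !big_nil rmorph1 mulr1.
  by rewrite !big_cons IH -mulrA cst_commA rmorphM -!mulrA.
under eq_bigr do rewrite split_prod.
rewrite (bigID (fun p : {ffun 'I_n -> 'I_n} => injectiveb p)) /= [X in _ + X]big1; last first.
  move=> p /injectivePn[i [j neij pij]].
  by rewrite (@prod_odd_eq0 _ _ _ (fun l => ext_gen B (p l)) i j) ?mulr0 ?pij.
rewrite addr0 (reindex (@pval _)) /=; last first.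
  pose in_Sn := insubd (1%g : 'S_n).
  by exists in_Sn => /= p Up; first apply: val_inj; apply: insubdK.
rewrite -det_tr rmorph_sum mulr_suml; apply: eq_big => [p|p _]; first by rewrite (valP p).
rewrite pvalE (prod_odd_perm p g1).
rewrite rmorphM rmorph_sign prod_gen -(rmorph_sign (@ext_const B n)) !mulrA -!rmorphM.
congr (ext_const _ _ * _); rewrite mulrC; congr (_ * _).
by apply: eq_bigr => l _; rewrite mxE.
Qed.

Lemma prod_enum_set (V : pzRingType) (k : nat) (I : {set 'I_k}) (F : 'I_k -> V) :
  \prod_(i <- enum I) F i = \prod_(i in I) F i.
Proof. by rewrite -[RHS]big_filter [index_enum _]unlock. Qed.

Section JacobianDet.
Variables (B : comNzRingType) (n s : nat) (D : 'I_n -> 'I_s -> B).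
Local Notation cst := (@ext_const _ _).
Implicit Types (I : {set 'I_s}).

Definition minor I : 'M[B]_n :=
  \matrix_(k < n, l < n) nth 0 [seq D k i | i <- enum I] l.

Lemma prod_theta_det I : #|I| = n ->
  \prod_(i in I) theta D i = cst (\det (minor I)) * ext_mon 1 setT.
Proof.
move=> In; rewrite -prod_enum_set -(big_map (theta D) xpredT id) /= (big_nth 0) size_map.
rewrite -cardE In big_mkord -prod_det [RHS](eq_bigl xpredT) => [|l]; last by rewrite inE.
apply: eq_bigr => l _; have: (l < size (enum I))%N by rewrite -cardE In.
case E : (enum I) => [|i0 r] // ltl; rewrite (nth_map i0) //.
by apply: eq_bigr => k _; rewrite mxE E (nth_map i0).
Qed.

Lemma jacE : jac D = (-1) ^+ (n + n * (s - n)) *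
  \sum_(I : {set 'I_s} | #|I| == n)
    cst (sgn B I (~: I) * \det (minor I)) * \prod_(j in ~: I) fdiff B j.
Proof.
have F1 i : has_deg 1 (einl n (fdiff B (i : 'I_s))) by exact/has_deg_einl/has_deg_fdiff.
have T1 i : has_deg 1 (- einr (s + s) (theta D i)).
  by apply/has_degN/has_deg_einr/has_deg_theta.
rewrite /jac /gam_prod (prod_oddD _ F1 T1) raddf_sum.
rewrite (reindex_inj (@setC_inj _)) (eq_bigl xpredT) => [|I]; last by rewrite subsetT.
have E I : ext_top (cst (sgn B (~: I) ([set: 'I_s] :\: ~: I)) *
      (\prod_(i in ~: I) einl n (fdiff B i) *
       \prod_(i in [set: 'I_s] :\: ~: I) - einr (s + s) (theta D i))) =
    cst (sgn B (~: I) I * (-1) ^+ #|I| * (\prod_(i in I) theta D i) setT) *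
      \prod_(i in ~: I) fdiff B i.
  rewrite setTD setCK prodrN -!rmorph_prod /=.
  set X := \prod_(i in ~: I) _; set Y := \prod_(i in I) _.
  have -> : cst (sgn B (~: I) I) * (einl n X * ((-1) ^+ #|I| * einr (s + s) Y)) =
      einl n (cst (sgn B (~: I) I * (-1) ^+ #|I|) * X) * einr (s + s) Y.
    rewrite [einl n (_ * X)]rmorphM /= einl_cst rmorphM -!mulrA; congr (_ * _).
    by rewrite -(rmorph_sign cst) cst_commA.
  by rewrite ext_topM mulrA -rmorphM mulrC.
under eq_bigr do rewrite /= E.
rewrite (bigID (fun I : {set 'I_s} => #|I| == n)) /= [X in _ + X]big1 ?addr0; last first.
  move=> I In; have := has_deg_prod_odd (has_deg_theta D) (J := I) => ->.
    by rewrite mulr0 rmorph0 mul0r.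
  by rewrite cardsT card_ord eq_sym.
rewrite mulr_sumr; apply: eq_bigr => I /eqP In.
rewrite prod_theta_det // cstE ffunE eqxx mulr1 mulrA -(rmorph_sign cst) -rmorphM In.
congr (cst _ * _).
have dI : [disjoint I & ~: I] by rewrite disjoints_subset setCK.
have := sgn_comm B dI; rewrite In cardsCs setCK card_ord In => sg.
have -> : sgn B (~: I) I = (-1) ^+ (n * (s - n)) * sgn B I (~: I).
  by rewrite -sg mulrAC sgn_sq mul1r.
by rewrite exprD; ring.
Qed.

End JacobianDet.

(** * The dual complex and kernel maps *)

Section DualComplexOps.
Variables (R : comNzRingType) (A : comAlgType R) (s : nat).
Local Notation C := (ext A s).
Local Notation cst := (@ext_const _ _).
Local Notation tw := (@ext_twist _ _).
Implicit Types (a b : C) (c e : {scalar C}).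

Lemma ext_scaleE_cst (r : R) a : r *: a = cst r%:A * a.
Proof. by apply/ffunP=> I; rewrite cstE ffunE mulr_algl. Qed.

Lemma ext_sign k a : (-1) ^+ k * a = (-1) ^+ k *: a.
Proof.
rewrite -signr_odd -[in RHS]signr_odd.
by case: odd; rewrite ?expr1 ?mulN1r ?scaleN1r ?expr0 ?mul1r ?scale1r.
Qed.

Lemma ext_scaleAl (r : R) a b : (r *: a : C) * b = r *: (a * b).
Proof. by rewrite !ext_scaleE_cst mulrA. Qed.

Lemma ext_scaleAr (r : R) a b : a * (r *: b : C) = r *: (a * b).
Proof. by rewrite !ext_scaleE_cst cst_commA. Qed.

Lemma twist_scale (r : R) a : tw (r *: a) = r *: tw a.
Proof. by rewrite !ext_scaleE_cst rmorphM /= twist_cst. Qed.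

Lemma has_deg_scale k (r : R) a : has_deg k a -> has_deg k (r *: a).
Proof. by rewrite ext_scaleE_cst; apply: has_degZ. Qed.

Variable f : 'I_s -> A.
Local Notation d := (koszul f).

Lemma koszul_scale (r : R) a : d (r *: a) = r *: d a.
Proof. by rewrite !ext_scaleE_cst koszul_cstM. Qed.

Definition ddiff c : C -> R := fun b => - c (tw (d b)).

Fact ddiff_is_linear c : linear_for *%R (ddiff c).
Proof.
move=> r a b; rewrite /ddiff raddfD /= koszul_scale raddfD /= twist_scale.
by rewrite linearP /= opprD mulrN.
Qed.

HB.instance Definition _ c :=
  GRing.isLinear.Build R C R *%R (ddiff c) (ddiff_is_linear c).

Definition dact (c : C -> R) a : C -> R := fun b => c (a * b).

Fact dact_is_linear c a : linear_for *%R (dact c a).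
Proof. by move=> r x y; rewrite /dact mulrDr ext_scaleAr linearP. Qed.

HB.instance Definition _ c a :=
  GRing.isLinear.Build R C R *%R (dact c a) (dact_is_linear c a).

Definition rscale (r : R) c : C -> R := fun b => r * c b.

Fact rscale_is_linear r c : linear_for *%R (rscale r c).
Proof. by move=> a x y; rewrite /rscale linearP /= mulrDr mulrCA. Qed.

HB.instance Definition _ r c :=
  GRing.isLinear.Build R C R *%R (rscale r c) (rscale_is_linear r c).

(* e has degree - q in the dual complex. *)
Definition codeg (q : nat) (e : C -> R) := forall r b, has_deg r b -> r != q -> e b = 0.

Lemma codeg_twist q e b : codeg q e -> e (tw b) = (-1) ^+ q * e b.
Proof.
move=> eq; elim/ext_deg_ind: b => [a b IHa IHb|r b br].
  by rewrite raddfD !linearD /= IHa IHb mulrDr.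
have [<-|neq] := eqVneq r q.
  rewrite (twist_deg br) -signr_odd -[in RHS]signr_odd.
  by case: odd; rewrite ?expr1 ?mulN1r ?linearN ?expr0 ?mul1r.
by rewrite (eq r) ?(eq r b) ?mulr0 //; apply: has_deg_twist.
Qed.

Lemma cycle_koszul e : (forall b, ddiff e b = 0) -> forall b, e (d b) = 0.
Proof.
move=> ecyc b; have := ecyc (tw b); rewrite /ddiff koszul_twist raddfN /= twistK.
by rewrite linearN opprK.
Qed.

(** The cycle e vanishes on d(a b), so the Leibniz rule moves d from b to a, and homogeneity of e
    turns the twist into a sign. *)
Lemma ddiff_dact q e a b : codeg q e -> (forall b, ddiff e b = 0) ->
  ddiff (dact e a) b = (-1) ^+ q * dact e (d a) b.
Proof.
move=> eq /cycle_koszul ecyc; rewrite /ddiff /= /dact.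
have -> : a * tw (d b) = tw (tw a * d b) by rewrite rmorphM /= twistK.
rewrite (codeg_twist _ eq) -mulrN; congr (_ * _).
have := ecyc (a * b); rewrite koszulM linearD /= => /eqP; rewrite addrC addr_eq0 => /eqP->.
by rewrite opprK.
Qed.

End DualComplexOps.

Section Kernel.
Variables (R : comNzRingType) (A : comAlgType R) (B : comNzRingType) (s : nat).
Variables (ex ey : {rmorphism A -> B}) (sw : {rmorphism B -> B}) (f : 'I_s -> A).
Local Notation C := (ext A s).
Local Notation cst := (@ext_const _ _).
Local Notation tw := (@ext_twist _ _).
Local Notation d := (koszul f).
Local Notation X := (@ext_x A B ex s).
Local Notation Y := (@ext_y A B ey s).
Local Notation dd := (koszul_xy ex ey f).
Local Notation swap := (ext_swap sw).
Hypotheses (sw_x : forall p, sw (ex p) = ey p) (sw_y : forall p, sw (ey p) = ex p).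
Hypothesis B_ind : forall P : B -> Prop, (forall p q, P p -> P q -> P (p + q)) ->
  (forall p q, P (ex p * ey q)) -> forall q, P q.

(* [KM] is [kernel_map], of which only additivity in G and the value on        *)
(* products p(x, hat f_x) b(y, hat f_y) matter.                                *)
Variable KM : ext B (s + s) -> (C -> R) -> C.
Hypothesis KM_D : forall G H c, KM (G + H) c = KM G c + KM H c.
Hypothesis KM_xy : forall (c : {scalar C}) p b, KM (X p * Y b) c = c (tw b) *: p.
Implicit Types (a b p : C) (c e : {scalar C}) (G H : ext B (s + s)).

Lemma xy_deg_ind (P : ext B (s + s) -> Prop) q :
    (forall G H, P G -> P H -> P (G + H)) ->
    (forall i j p b, has_deg i p -> has_deg j b -> (i + j)%N = q -> P (X p * Y b)) ->
    (P 0) -> forall G, has_deg q G -> P G.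
Proof.
move=> PD PM P0 G /has_degP->; apply: big_ind => // S /eqP Sq.
elim/B_ind: (G S) => [g h Pg Ph|g h]; first by rewrite rmorphD mulrDl; apply: PD.
have -> : cst (ex g * ey h) * ext_mon 1 S =
    X (cst g * ext_mon 1 (lpart S)) * Y (cst h * ext_mon 1 (rpart S)).
  rewrite !rmorphM /= /ext_x /ext_y !extmap_cst !extmap_mon !rmorph1 !mul1r.
  have /= xE := einl_mon s (1 : B) (lpart S); have /= yE := einr_mon s (1 : B) (rpart S).
  rewrite /einl extmap_mon rmorph1 mul1r in xE; rewrite /einr extmap_mon rmorph1 mul1r in yE.
  rewrite xE yE -[RHS]mulrA cst_commA [RHS]mulrA; congr (_ * _).
  have := einlr_mon (1 : B) 1 (lpart S) (rpart S).
  by rewrite mulr1 lrsetK einl_mon einr_mon.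
apply: (PM #|lpart S| #|rpart S|); try exact/has_degZ/has_deg_mon.
by rewrite -Sq -[in RHS](lrsetK S) card_lrset.
Qed.

Lemma xy_ind (P : ext B (s + s) -> Prop) :
    (forall G H, P G -> P H -> P (G + H)) -> (forall p b, P (X p * Y b)) ->
  forall G, P G.
Proof.
move=> PD PM; have P0 : P 0 by have := PM 0 0; rewrite raddf0 mul0r.
by elim/ext_deg_ind => // q G; apply: (xy_deg_ind PD _ P0) => i j p b _ _ _; apply: PM.
Qed.

Lemma KM0 c : KM 0 c = 0.
Proof. by apply: (addrI (KM 0 c)); rewrite -KM_D !addr0. Qed.

Lemma KMN G c : KM (- G) c = - KM G c.
Proof. by apply: (addrI (KM G c)); rewrite -KM_D !subrr KM0. Qed.

Lemma KM_sign k G c : KM ((-1) ^+ k * G) c = (-1) ^+ k * KM G c.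
Proof.
rewrite -signr_odd -[in RHS]signr_odd.
by case: odd; rewrite ?expr1 ?mulN1r ?KMN ?expr0 ?mul1r.
Qed.

Lemma KM_ext_x a G c : KM (X a * G) c = a * KM G c.
Proof.
elim/xy_ind: G => [G H IHG IHH|p b]; first by rewrite mulrDr !KM_D IHG IHH mulrDr.
by rewrite mulrA -rmorphM !KM_xy ext_scaleAr.
Qed.

(** For G = p(x) b(y), the term of d G in which d falls on b cancels against the term with the dual
    differential of c. *)
Lemma koszul_KM q G c : has_deg q G ->
  d (KM G c) = KM (dd G) c + (-1) ^+ q * KM G (ddiff f c).
Proof.
apply: (@xy_deg_ind (fun G => d (KM G c) = KM (dd G) c + (-1) ^+ q * KM G (ddiff f c)) q)
  => [G1 G2 IH1 IH2|i j p b pi bj ijq|].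
- by rewrite KM_D !raddfD /= IH1 IH2 !KM_D mulrDr addrACA.
- rewrite koszul_xyM koszul_ext_x koszul_ext_y -ext_x_twist KM_D !KM_xy koszul_scale.
  rewrite -addrA -[LHS]addr0; congr (_ + _); apply/esym.
  rewrite /= /ddiff koszul_twist raddfN /= twistK linearN opprK.
  case: j bj ijq => [|j] bj ijq.
    by rewrite (koszul_deg0 _ bj) raddf0 !linear0 !scale0r mulr0 addr0.
  rewrite (twist_deg pi) (twist_deg (has_deg_koszul _ bj)) -ijq !ext_sign.
  rewrite [c (_ *: _)]linearZ /= !scalerA -scalerDl (_ : _ + _ = 0) ?scale0r //.
  by rewrite addnS exprS exprD; ring.
by rewrite raddf0 !KM0 raddf0 mulr0 addr0.
Qed.

Lemma koszul_KM_cycle G e : (forall b, ddiff f e b = 0) -> d (KM G e) = KM (dd G) e.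
Proof.
move=> ecyc; elim/ext_deg_ind: G => [G H IHG IHH|q G Gq].
  by rewrite KM_D !raddfD /= KM_D IHG IHH.
rewrite (koszul_KM _ Gq) [X in _ * X](_ : _ = 0) ?mulr0 ?addr0 //.
elim/xy_ind: G {Gq} => [G H IHG IHH|p b]; first by rewrite KM_D IHG IHH addr0.
by rewrite KM_xy /= ecyc scale0r.
Qed.

Lemma KM_rscale r G c : KM G (rscale r c) = r *: KM G c.
Proof.
elim/xy_ind: G => [G H IHG IHH|p b]; first by rewrite !KM_D IHG IHH scalerDr.
by rewrite !KM_xy /= /rscale scalerA.
Qed.

Lemma KM_eq0 G e : (forall b, e b = 0) -> KM G e = 0.
Proof.
move=> e0; elim/xy_ind: G => [G H IHG IHH|p b]; first by rewrite KM_D IHG IHH addr0.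
by rewrite KM_xy e0 scale0r.
Qed.

Lemma has_deg_KM q r G e : codeg q e -> has_deg (r + q) G -> has_deg r (KM G e).
Proof.
move=> eq; apply: (@xy_deg_ind (fun G => has_deg r (KM G e)) (r + q)) =>
  [G1 G2 IH1 IH2|i j p b pi bj ijq|]; first by rewrite KM_D; apply: has_degD.
- rewrite KM_xy; have [ejq|nejq] := eqVneq j q.
    apply: has_deg_scale; move: ijq; rewrite ejq => /eqP; rewrite eqn_add2r => /eqP <-.
    exact: pi.
  by rewrite (eq j) ?scale0r //; [apply: has_deg0 | apply: has_deg_twist].
by rewrite KM0; apply: has_deg0.
Qed.

(** For G = p(x) b(y), the degrees force |a| = |p| whenever e does not vanish on a b. Commuting a
    past p and twisting a then give the sign (-1)^(r r + r) with r = |a|, which is 1. *)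
Lemma KM_dact q G e a : has_deg q G -> codeg q e -> KM G (dact e a) = KM (Y a * G) e.
Proof.
move=> Gq eq; elim/ext_deg_ind: a => [a1 a2 IH1 IH2|r a ar].
  rewrite raddfD mulrDl KM_D -IH1 -IH2 /=.
  elim/xy_ind: G {Gq IH1 IH2} => [G1 G2 IH1 IH2|p b].
    by rewrite !KM_D IH1 IH2 addrACA.
  by rewrite !KM_xy /= /dact mulrDl linearD scalerDl.
move: G Gq; apply: xy_deg_ind => [G1 G2 IH1 IH2|i j p b pi bj ijq|].
- by rewrite !KM_D IH1 IH2 mulrDr KM_D.
- rewrite mulrA (graded_comm (has_deg_ext_y ey ar) (has_deg_ext_x ex pi)) -!mulrA.
  rewrite KM_sign -rmorphM !KM_xy /= /dact rmorphM /= (twist_deg ar) -mulrA !ext_sign.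
  rewrite [e (_ *: _)]linearZ /= !scalerA mulrA -exprD.
  have [<-|neri] := eqVneq r i; first by rewrite -mulnSr -signr_odd oddM /= andbN mul1r.
  rewrite (eq (r + j)) ?mulr0 //; first by apply: has_degM => //; apply: has_deg_twist.
  by rewrite -ijq eqn_add2r.
by rewrite mulr0 !KM0.
Qed.



(** Here e is evaluated on the x-part of G and c on the y-part. After the exchange of the two
    copies, e can again be integrated first, which leaves an argument for c. *)
Lemma dact_KM q G e c b : has_deg q G -> codeg q e ->
  dact e (KM G c) b = (-1) ^+ q * c (KM (swap (X b * G)) e).
Proof.
move=> Gq eq; rewrite /dact; elim/ext_deg_ind: b => [b1 b2 IH1 IH2|r b br].
  rewrite mulrDr linearD /= IH1 IH2 -mulrDr -linearD -KM_D -raddfD -mulrDl -raddfD //.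
move: G Gq; apply: xy_deg_ind => [G1 G2 IH1 IH2|i j p a pi aj ijq|].
- by rewrite KM_D mulrDl linearD /= IH1 IH2 -mulrDr -linearD -KM_D -raddfD -mulrDr.
- rewrite KM_xy ext_scaleAl linearZ /= (mulrA (X b)) -rmorphM !ext_swapM.
  rewrite (ext_swap_x sw_x) (ext_swap_y sw_y).
  rewrite (graded_comm (has_deg_ext_y ey (has_degM br pi)) (has_deg_ext_x ex aj)).
  rewrite KM_sign KM_xy ext_sign !linearZ /=.
  rewrite (twist_deg aj) (twist_deg (has_degM br pi)) (graded_comm br pi) !ext_sign.
  have [erj|nerj] := eqVneq r j; last first.
    rewrite (eq _ _ (has_degM pi br)); last by rewrite -ijq eqn_add2l.
    rewrite (eq (i + r)%N); first by rewrite !(mulr0, mul0r).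
      by apply/has_deg_scale/has_deg_scale/has_degM.
    by rewrite -ijq eqn_add2l.
  rewrite !linearZ /= !mulrA mulrC !mulrA -!exprD; congr (_ * _); rewrite mulrC; congr (_ * _).
  rewrite -signr_odd -[in RHS]signr_odd -ijq -erj !(oddD, oddM).
  by case: (odd i); case: (odd r).
by rewrite mulr0 raddf0 !KM0 mul0r !linear0 mulr0.
Qed.

End Kernel.

(** * The homotopy inverse *)

Section Duality.
Variables (R : comNzRingType) (A : comAlgType R) (B : comNzRingType) (s : nat).
Variables (ex ey : {rmorphism A -> B}) (sw : {rmorphism B -> B}) (f : 'I_s -> A).
Local Notation C := (ext A s).
Local Notation cst := (@ext_const _ _).
Local Notation tw := (@ext_twist _ _).
Local Notation d := (koszul f).
Local Notation X := (@ext_x A B ex s).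
Local Notation Y := (@ext_y A B ey s).
Local Notation dd := (koszul_xy ex ey f).
Local Notation swap := (ext_swap sw).
Hypotheses (sw_x : forall p, sw (ex p) = ey p) (sw_y : forall p, sw (ey p) = ex p).
Hypothesis B_ind : forall P : B -> Prop, (forall p q, P p -> P q -> P (p + q)) ->
  (forall p q, P (ex p * ey q)) -> forall q, P q.
Hypothesis exy_alg : forall r : R, ex r%:A = ey r%:A.

Variable KM : ext B (s + s) -> (C -> R) -> C.
Hypothesis KM_D : forall G H c, KM (G + H) c = KM G c + KM H c.
Hypothesis KM_xy : forall (c : {scalar C}) p b, KM (X p * Y b) c = c (tw b) *: p.

Variables (q : nat) (J J' : ext B (s + s)) (H : C -> ext B (s + s)) (e : {scalar C}).
Variables (t t' : C).
Hypotheses (J_deg : has_deg q J) (e_deg : codeg q e) (e_cyc : forall b, ddiff f e b = 0).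
Hypothesis H_D : forall a b, H (a + b) = H a + H b.
Hypothesis H_Z : forall (r : R) a, H (r *: a) = cst (ex r%:A) * H a.
Hypothesis H_htpy : forall c, (X c - Y c) * J = dd (H c) + H (d c).
Hypothesis H_deg : (forall b, e b = 0) \/
  forall r c, has_deg r c -> has_deg (r.+1 + q) (H c).
Hypothesis swapJ : swap J = (-1) ^+ q * J'.
Hypotheses (t_deg : has_deg 1 t) (t'_deg : has_deg 1 t').
Hypotheses (KMJ : KM J e = 1 + d t) (KMJ' : KM J' e = 1 + d t').
Implicit Types (a b : C) (c : {scalar C}).

(** Right multiplication by d u is null-homotopic; this absorbs the error d t in Phi(e) = 1 + d
    t. *)
Lemma koszul_twistM a u : d (tw a * u) + tw (d a) * u = a * d u.
Proof. by rewrite koszulM twistK koszul_twist mulNr addrAC addNr add0r. Qed.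

Definition right_op a : C := KM (H a) e - tw a * t.
Definition left_op b : C := - (tw b * t') - (-1) ^+ q * KM (swap (H b)) e.

Lemma KM_scale (r : R) G c : KM (cst (ex r%:A) * G) c = r *: KM G c.
Proof.
have -> : cst (ex r%:A) = X (cst r%:A) by rewrite /ext_x extmap_cst.
by rewrite (KM_ext_x B_ind KM_D KM_xy) -ext_scaleE_cst.
Qed.

Lemma right_op_linear : linear right_op.
Proof.
move=> r a b; rewrite /right_op H_D H_Z KM_D KM_scale raddfD mulrDl opprD /=.
by rewrite twist_scale ext_scaleAl scalerBr addrACA.
Qed.

Lemma left_op_linear : linear left_op.
Proof.
move=> r a b; rewrite /left_op H_D H_Z [swap (_ + _)]raddfD /= ext_swapM KM_D.
have -> : swap (cst (ex r%:A) : ext B (s + s)) = cst (ex r%:A).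
  by rewrite /ext_swap extmap_cst sw_x exy_alg.
rewrite KM_scale raddfD /= twist_scale mulrDl ext_scaleAl mulrDr ext_scaleAr.
by rewrite !opprD scalerBr scalerN addrACA.
Qed.

Lemma right_op_deg : degree_one right_op.
Proof.
move=> r a ar; apply: has_degB; last first.
  by rewrite -addn1; apply: has_degM => //; apply: has_deg_twist.
case: H_deg => [e0|Hd]; first by rewrite (KM_eq0 B_ind KM_D KM_xy) //; apply: has_deg0.
by apply: (has_deg_KM B_ind KM_D KM_xy e_deg); apply: Hd.
Qed.

Lemma left_op_deg : degree_one left_op.
Proof.
move=> r a ar; apply: has_degB.
  by apply: has_degN; rewrite -addn1; apply: has_degM => //; apply: has_deg_twist.
rewrite -(rmorph_sign cst); apply: has_degZ.
case: H_deg => [e0|Hd]; first by rewrite (KM_eq0 B_ind KM_D KM_xy) //; apply: has_deg0.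
by apply: (has_deg_KM B_ind KM_D KM_xy e_deg); apply/has_deg_swap/Hd.
Qed.

Lemma right_homotopy a : a - KM J (dact e a) = d (right_op a) + right_op (d a).
Proof.
rewrite /right_op raddfB /= (koszul_KM_cycle B_ind KM_D KM_xy _ e_cyc).
rewrite addrACA -KM_D -H_htpy -opprD koszul_twistM mulrBl KM_D (KMN KM_D).
rewrite (KM_ext_x B_ind KM_D KM_xy) KMJ -(KM_dact B_ind KM_D KM_xy _ J_deg e_deg).
by rewrite mulrDr mulr1 addrAC addrK.
Qed.

Lemma left_homotopy c b :
  c b - dact e (KM J c) b = c (d (left_op b) + left_op (d b)).
Proof.
rewrite (dact_KM sw_x sw_y B_ind KM_D KM_xy _ _ J_deg e_deg).
(* With b moved to the y-copy, the exchange puts it back on the x-side, where it factors out of the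
   integral. *)
have -> : X b * J = Y b * J + (dd (H b) + H (d b)) by rewrite -H_htpy mulrBl addrC subrK.
rewrite raddfD /= ext_swapM (ext_swap_y sw_y) swapJ.
rewrite -(rmorph_sign (@ext_const B (s + s))) cst_commA rmorph_sign.
rewrite KM_D (KM_sign KM_D) (KM_ext_x B_ind KM_D KM_xy) KMJ'.
rewrite [swap (_ + _)]raddfD /= -(koszul_swap _ sw_x sw_y) KM_D.
rewrite -(koszul_KM_cycle B_ind KM_D KM_xy _ e_cyc).
rewrite /left_op raddfB raddfN /=.
have -> : koszul f ((-1) ^+ q * KM (swap (H b)) e) = (-1) ^+ q * d (KM (swap (H b)) e).
  by rewrite -(rmorph_sign cst) koszul_cstM.
rewrite addrACA -!opprD -mulrDr koszul_twistM !ext_sign linearD linearZ /= mulrDr mulrA.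
rewrite -exprD -signr_odd oddD addbb mul1r mulrDr mulr1 !linearD !linearN !linearZ /=.
ring.
Qed.

End Duality.

Lemma extDE (A : comNzRingType) m (a b : ext A m) I : (a + b) I = a I + b I.
Proof. by rewrite ffunE. Qed.

(** * The dual cycle e and its image under Phi *)

Section ResidueFunctional.
Variables (R : comNzRingType) (A : comAlgType R) (n s : nat) (f : 'I_s -> A).
Variables (al : 'I_n -> 'I_s -> A) (rho : {scalar A}).
Local Notation C := (ext A s).
Local Notation cst := (@ext_const _ _).
Local Notation tw := (@ext_twist _ _).
Let g l := \sum_i al l i * f i.
Hypothesis rho_g : forall l p, rho (p * g l) = 0.

(* The transformation law for residues: [rho] is the residue for the g_l. *)
Definition residue (b : C) : R := rho ((alpha al * b) setT).

Fact residue_is_linear : linear_for *%R residue.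
Proof.
move=> r a b; rewrite /residue mulrDr ext_scaleAr !ffunE linearP //.
Qed.

HB.instance Definition _ := GRing.isLinear.Build R C R *%R residue residue_is_linear.

Lemma residue_codeg : codeg (s - n) residue.
Proof.
move=> r b br neq; rewrite /residue.
have [le_ns|lt_sn] := leqP n s; last first.
  by rewrite (has_deg_gt lt_sn (has_deg_alpha al)) mul0r ffunE linear0.
rewrite (has_degM (has_deg_alpha al) br) ?linear0 // cardsT card_ord.
by rewrite eq_sym -(subnKC le_ns) eqn_add2l -(subnKC le_ns) addKn in neq *.
Qed.

Lemma residue_gt b : (s < n)%N -> residue b = 0.
Proof.
by move=> lt_sn; rewrite /residue (has_deg_gt lt_sn (has_deg_alpha al)) mul0r ffunE linear0.
Qed.

Lemma koszul_top h (b : C) : koszul h b setT = 0.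
Proof. by rewrite ffunE big1 // => i; rewrite inE. Qed.

(** Up to sign, alpha d(x) is d(alpha x) - d(alpha) x. A boundary has no top coefficient, and
    d(alpha) has its coefficients in the ideal of the g_l, which rho kills. *)
Lemma residue_cycle b : ddiff f residue b = 0.
Proof.
(* The largest ideal contained in the kernel of rho. *)
pose K p := forall q, rho (q * p) = 0.
have K0 : K 0 by move=> q; rewrite mulr0 linear0.
have KD p q : K p -> K q -> K (p + q) by move=> Kp Kq r; rewrite mulrDr linearD /= Kp Kq addr0.
have KM p q : K q -> K (p * q) by move=> Kq r; rewrite mulrA.
have Kal l : in_ideal K (koszul f (alpha1 al l)).
  have -> : koszul f (alpha1 al l) = cst (g l).
    rewrite raddf_sum raddf_sum; apply: eq_bigr => i _ /=.
    by rewrite koszul_cstM koszul_gen rmorphM.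
  by apply: in_ideal_cst => // q; apply: rho_g.
have Kd : in_ideal K (koszul f (alpha al)).
  have -> : alpha al = \prod_l alpha1 al l by apply: eq_bigl => l; rewrite inE.
  exact: in_ideal_koszul_prod.
have Kx x : K ((alpha al * koszul f x) setT).
  have -> : alpha al * koszul f x =
      cst ((-1) ^+ n) * (koszul f (alpha al * x) - koszul f (alpha al) * x).
    rewrite koszulM addrAC subrr add0r (twist_deg (has_deg_alpha al)) rmorph_sign.
    by rewrite !mulrA -exprD -signr_odd oddD addbb mul1r.
  rewrite cstE extDE koszul_top add0r; apply: (KM).
  have KN : in_ideal K (- (koszul f (alpha al) * x)).
    exact: (in_idealN K0 KD KM (in_idealMr K0 KD KM _ Kd)).
  exact: KN.
rewrite /ddiff /= /residue; apply/eqP; rewrite oppr_eq0 -oppr_eq0; apply/eqP.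
have -> : tw (koszul f b) = - koszul f (tw b) by rewrite koszul_twist opprK.
have := Kx (tw b) 1; rewrite mul1r mulrN => E.
have -> : (- (alpha al * koszul f (tw b))) setT = - (alpha al * koszul f (tw b)) setT :> A.
  by rewrite ffunE.
by rewrite linearN E !oppr0.
Qed.

End ResidueFunctional.

Section ResidueKernel.
Variables (R : comNzRingType) (A : comAlgType R) (B : comNzRingType) (n s : nat).
Variables (ex ey : {rmorphism A -> B}) (u : 'I_n -> B) (f : 'I_s -> A).
Local Notation C := (ext A s).
Local Notation cst := (@ext_const _ _).
Local Notation tw := (@ext_twist _ _).
Local Notation X := (@ext_x A B ex s).
Local Notation Y := (@ext_y A B ey s).
Hypothesis B_ind : forall P : B -> Prop, (forall p q, P p -> P q -> P (p + q)) ->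
  (forall p q, P (ex p * ey q)) -> forall q, P q.
Variable KM : ext B (s + s) -> (C -> R) -> C.
Hypothesis KM_D : forall G H c, KM (G + H) c = KM G c + KM H c.
Hypothesis KM_xy : forall (c : {scalar C}) p b, KM (X p * Y b) c = c (tw b) *: p.

Variables (al : 'I_n -> 'I_s -> A) (rho : {scalar A}) (Rho : B -> A).
Hypothesis Rho_D : forall p q, Rho (p + q) = Rho p + Rho q.
Hypothesis Rho_xy : forall p q, Rho (ex p * ey q) = rho q *: p.
Let g l := \sum_i al l i * f i.
Hypothesis rho_g : forall l p, rho (p * g l) = 0.

Lemma piy_x a : piy (X a) = cst (ex (a set0)).
Proof.
rewrite /piy /ext_x extmap_comp; last exact: piy_odd.
rewrite extmapE (bigD1 set0) //= big_set0 mulr1 big1 ?addr0 // => I /set0Pn[i iI].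
have g0 j : extmap idfun (@piy_gen B s) (ext_gen B (lshift s j)) = 0.
  by rewrite extmap_gen /piy_gen ?gsuml.
rewrite -(setD1K iI) prod_oddU1 ?setD11 // => [|j]; rewrite g0.
  by rewrite mul0r !mulr0.
exact: has_deg0.
Qed.

Lemma piy_y b : piy (Y b) = extmap ey (@ext_gen B s) b.
Proof.
rewrite /piy /ext_y extmap_comp; last exact: piy_odd.
by apply: eq_extmap => // i; rewrite extmap_gen /piy_gen ?gsumr.
Qed.

(** The coefficient on the empty set sees only the part of G free of the f_{i,x}, hence [piy]. The
    map [Rho] extends rho linearly over the x-variables. *)
Lemma KM_residue G :
  KM G (residue al rho) set0 =
  Rho ((extmap ey (@ext_gen B s) (alpha al) * tw (piy G)) setT).
Proof.
have g1 (i : 'I_s) : has_deg 1 (ext_gen B i) by exact: has_deg_gen.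
elim/(@xy_ind R A B s ex ey B_ind): G => [G H IHG IHH|p b].
  rewrite KM_D extDE IHG IHH [piy (_ + _)]raddfD /= [tw (_ + _)]raddfD mulrDr.
  by rewrite extDE Rho_D.
rewrite KM_xy ffunE /residue.
rewrite /piy (extmapM _ (@piy_odd B s)) -!/(piy _) piy_x piy_y rmorphM /= twist_cst.
rewrite cst_commA -extmap_twist // -extmapM // cstE extmap_genE Rho_xy.
by [].
Qed.

Variables (D : 'I_n -> 'I_s -> B) (nabla : ext B n -> ext B n) (dg : {rmorphism B -> B}).
Hypothesis dg_x : forall q, dg (ex q) = ey q.
Hypothesis nabla0 : nabla 0 = 0.
Hypothesis nabla_deg : degree_one nabla.
Hypothesis nabla_htpy :
  forall c, koszul u (nabla c) + nabla (koszul u c) = c - cst (dg (c set0)).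
Hypothesis DP : diff_quot ex ey u f D.
Variable T : 'I_n -> ext B n.
Hypothesis T_odd : forall l, has_deg 1 (T l).
Hypothesis koszul_T : forall l, koszul u (T l) = cst (ex (g l) - ey (g l)).
Hypothesis Rho_T : Rho ((\prod_(l in [set: 'I_n]) T l) setT) = 1.

Lemma Rho0 : Rho 0 = 0.
Proof. by apply: (addrI (Rho 0)); rewrite -Rho_D !addr0. Qed.

Lemma Rho_exM p q : Rho (ex p * q) = p * Rho q.
Proof.
elim/B_ind: q => [q1 q2 IH1 IH2|p' q]; first by rewrite mulrDr !Rho_D IH1 IH2 mulrDr.
by rewrite mulrA -rmorphM !Rho_xy scalerAr.
Qed.

Lemma Rho_sign k q : Rho ((-1) ^+ k * q) = (-1) ^+ k * Rho q.
Proof. by rewrite -[(-1) ^+ k in LHS](rmorph_sign ex) Rho_exM. Qed.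

(** By [KM_residue] and [alpha_jac] the value is, up to sign, [Rho] of the top coefficient of the
    product of the [Theta] l. Replacing [Theta] by T changes it only modulo (f), and an element of
    (f) in degree 0 is a boundary. *)
Lemma KM_jac_residue : exists h : 'I_s -> A,
  KM (jac D) (residue al rho) =
  (-1) ^+ (n * s) * (1 + koszul f (\sum_i cst (h i) * ext_gen A i)).
Proof.
(* The largest ideal that [Rho] maps into (f). It contains f_i(x) because [Rho] is linear over x,
   and g_l(y) because rho kills the multiples of g_l. *)
pose K p := forall q, exists h : 'I_s -> A, Rho (q * p) = \sum_i h i * f i.
have K0 : K 0.
  by move=> q; exists (fun=> 0); rewrite mulr0 Rho0 big1 // => i _; rewrite mul0r.
have KD p q : K p -> K q -> K (p + q).
  move=> Kp Kq r; have [h1 E1] := Kp r; have [h2 E2] := Kq r.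
  exists (fun i => h1 i + h2 i); rewrite mulrDr Rho_D E1 E2 -big_split.
  by apply: eq_bigr => i _; rewrite mulrDl.
have KM' p q : K q -> K (p * q) by move=> Kq r; rewrite mulrA.
have K_f i : K (ex (f i)).
  move=> q; exists (fun j => if j == i then Rho q else 0).
  rewrite mulrC Rho_exM mulrC (bigD1 i) //= eqxx big1 ?addr0 // => j /negbTE->.
  by rewrite mul0r.
have K_g l : K (ey (g l)).
  elim/B_ind => [q1 q2 [h1 E1] [h2 E2]|p q].
    exists (fun i => h1 i + h2 i); rewrite mulrDl Rho_D E1 E2 -big_split.
    by apply: eq_bigr => i _; rewrite mulrDl.
  exists (fun=> 0); rewrite -mulrA -rmorphM Rho_xy rho_g scale0r big1 // => i _.
  by rewrite mul0r.
have := prod_Theta_cong dg_x nabla0 nabla_deg nabla_htpy DP K0 KD KM' K_f K_g T_odd koszul_T.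
move=> /(_ 1) [h]; rewrite mul1r.
have RhoN q : Rho (- q) = - Rho q.
  by apply: (addrI (Rho q)); rewrite -Rho_D !subrr Rho0.
rewrite Rho_D RhoN Rho_T => /eqP; rewrite subr_eq => /eqP hE.
exists h; have deg0 : has_deg 0 (KM (jac D) (residue al rho)).
  apply: (has_deg_KM B_ind KM_D KM_xy (@residue_codeg _ _ _ _ al rho)).
  exact: has_deg_jac.
rewrite (has_deg0E deg0) KM_residue.
have -> : tw (piy (jac D)) = (-1) ^+ (n + s) * piy (jac D).
  rewrite -[LHS](extmap_twist idfun (@piy_odd B s)) jac_sign.
  by rewrite -(rmorph_sign (@ext_const B (s + s))) extmap_cstM !rmorph_sign.
rewrite -(rmorph_sign (@ext_const B s)) cst_commA cstE alpha_jac.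
rewrite mulrA -exprD addnA exprD -[_ ^+ (n + s + (n + s))]signr_odd oddD addbb mul1r.
rewrite Rho_sign hE rmorphM rmorph_sign; congr (_ * _).
rewrite rmorphD rmorph1 addrC; congr (_ + _).
rewrite rmorph_sum raddf_sum; apply: eq_bigr => i _ /=.
by rewrite koszul_cstM koszul_gen rmorphM.
Qed.

End ResidueKernel.

(** * Residues of polynomials *)

Section CayleyHamilton.
Variables (R : comNzRingType) (n s : nat) (f : 'I_s -> {mpoly R[n]}).
Local Notation A := {mpoly R[n]}.

Let inI (p : A) : Prop := exists h : 'I_s -> A, p = \sum_i h i * f i.

Let inID p q : inI p -> inI q -> inI (p + q).
Proof.
move=> [h ->] [k ->]; exists (fun i => h i + k i); rewrite -big_split.
by apply: eq_bigr => i _; rewrite mulrDl.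
Qed.

Let inI0 : inI 0.
Proof. by exists (fun=> 0); rewrite big1 // => i _; rewrite mul0r. Qed.

Let inIM p q : inI q -> inI (p * q).
Proof.
move=> [h ->]; exists (fun i => p * h i); rewrite mulr_sumr.
by apply: eq_bigr => i _; rewrite mulrA.
Qed.

(** Cayley-Hamilton for multiplication by x_l on R[x]/(f): its characteristic polynomial annihilates
    the generators z_i, hence also 1, so it takes a value in (f) at x_l. *)
Lemma monic_in_ideal : fin_gen_quotient f ->
  exists (k : nat) (chi : 'I_n -> {poly R}) (h : 'I_n -> 'I_s -> A),
    forall l, [/\ chi l \is monic, size (chi l) = k.+2 &
      \sum_(j < k.+2) (chi l)`_j *: 'X_l ^+ j = \sum_i h l i * f i].
Proof.
move=> [k [z zP]].
have H l : exists2 G : 'M[R]_k, True &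
    forall i, inI ('X_l * z i - \sum_j G i j *: z j).
  have: forall i, exists g : 'I_k -> R, inI ('X_l * z i - \sum_j g j *: z j).
    move=> i; have [g [h E]] := zP ('X_l * z i); exists g, h.
    by rewrite E addrC addKr.
  move=> /fin_all_exists [g gP]; exists (\matrix_(i, j) g i j) => // i.
  by rewrite (eq_bigr (fun j => g i j *: z j)) // => j _; rewrite mxE.
have : forall l, exists p : {poly R}, [/\ p \is monic, size p = k.+2 &
    inI (\sum_(j < k.+2) p`_j *: 'X_l ^+ j)].
  move=> l; have [G _ GP] := H l.
  (* The extra factor 'X makes the degree k + 1 positive even for k = 0, so that a top monomial
     x_l^k exists for the residue. *)
  have mon : char_poly G * 'X \is monic by rewrite monicMr ?monicX ?char_poly_monic.
  have sz : size (char_poly G * 'X) = k.+2.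
    by rewrite size_mulX ?size_char_poly // monic_neq0 ?char_poly_monic.
  exists (char_poly G * 'X); split => //.
  have hornE (p : {poly R}) N : (size p <= N)%N ->
      horner_alg ('X_l : A) p = \sum_(j < N) p`_j *: 'X_l ^+ j.
    move=> leN; rewrite /horner_alg /horner_morph (@horner_coef_wide _ N).
      by apply: eq_bigr => j _; rewrite coef_map /= mulr_algl.
    by rewrite (leq_trans _ leN) // size_poly.
  rewrite -hornE ?sz // rmorphM /=; rewrite mulrC; apply: inIM.
  pose M : 'M[A]_k := map_mx (horner_alg ('X_l : A)) (char_poly_mx G).
  have detM : \det M = horner_alg ('X_l : A) (char_poly G) by rewrite det_map_mx.
  rewrite -detM.
  have Mz i : inI (\sum_j M i j * z j).
    have -> : \sum_j M i j * z j = 'X_l * z i - \sum_j G i j *: z j; last exact: GP.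
    rewrite (eq_bigr (fun j => ('X_l *+ (i == j)) * z j - G i j *: z j)) => [|j _].
      rewrite sumrB; congr (_ - _); rewrite (bigD1 i) //= eqxx big1 ?addr0 // => j.
      by rewrite eq_sym => /negbTE->; rewrite mul0r.
    rewrite !mxE rmorphB rmorphMn /= horner_algX horner_algC mulrBl; congr (_ - _).
    by rewrite mulr_algl.
  have detz i : inI (\det M * z i).
    (* The adjugate identity, applied to the column of the z_j, whose product with M has entries in
       (f). *)
    have -> : \det M * z i = \sum_j \adj M i j * (\sum_j' M j j' * z j').
      have := congr1 (fun N : 'M[A]_k => (N *m \col_j z j) i 0) (mul_adj_mx M).
      rewrite -mulmxA mul_scalar_mx [(_ *: _ : 'M_(_, _)) _ _]mxE [(\matrix_(_, _) _) _ _]mxE.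
      rewrite [X in X = _ -> _]mxE => <-; apply: eq_bigr => j _; congr (_ * _).
      by rewrite [LHS]mxE; apply: eq_bigr => j' _; rewrite [(\col__ _) _ _]mxE.
    by apply: big_ind => // j _; apply: inIM.
  have [g [h E]] := zP 1; rewrite -(mulr1 (\det M)) E mulrDr; apply: inID.
    rewrite mulr_sumr; apply: big_ind => // j _; rewrite -scalerAr -mulr_algl.
    by apply: inIM.
  by apply: inIM; exists h.
move=> /fin_all_exists [chi chiP]; exists k, chi.
have : forall l, exists h : 'I_s -> A,
    \sum_(j < k.+2) (chi l)`_j *: 'X_l ^+ j = \sum_i h i * f i.
  by move=> l; have [_ _ []] := chiP l => h E; exists h.
by move=> /fin_all_exists [h hP]; exists h => l; have [] := chiP l.
Qed.

End CayleyHamilton.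

Section Recurrence.
Variables (R : comNzRingType) (k : nat) (chi : {poly R}).
Hypotheses (chi_monic : chi \is monic) (chi_size : size chi = k.+2).

(** Take for r m the coefficient of X^k in the remainder of X^m modulo chi. The recurrence says that
    the functional X^m |-> r m kills the multiples of chi. *)
Lemma dual_basis_seq : exists r : nat -> R,
  [/\ forall j, (j < k)%N -> r j = 0, r k = 1 &
      forall m, \sum_(j < k.+2) chi`_j * r (m + j)%N = 0].
Proof.
exists (fun m => (Pdiv.Ring.rmodp 'X^m chi)`_k).
have small j : (j <= k)%N -> Pdiv.Ring.rmodp 'X^j chi = 'X^j.
  by move=> lejk; rewrite Pdiv.Ring.rmodp_small // size_polyXn chi_size ltnS ltnS.
split=> [j ltjk||m].
- by rewrite small ?coefXn ?gtn_eqF // ltnW.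
- by rewrite small // coefXn eqxx.
have : (Pdiv.Ring.rmodp ('X^m * chi) chi)`_k = 0 by rewrite Pdiv.RingMonic.rmodp_mull // coef0.
rewrite {1}[chi in 'X^m * chi](_ : chi = \sum_(j < k.+2) chi`_j *: 'X^j); last first.
  by rewrite -chi_size -poly_def coefK.
rewrite mulr_sumr (Pdiv.RingMonic.rmodp_sum chi_monic) coef_sum => E.
rewrite -[RHS]E; apply: eq_bigr => j _.
by rewrite -scalerAr -exprD Pdiv.RingMonic.rmodpZ // coefZ.
Qed.

End Recurrence.

Section PolynomialResidue.
Variables (R : comNzRingType) (n : nat).
Local Notation A := {mpoly R[n]}.
Local Notation B := {mpoly R[n + n]}.

Lemma x_to_y_emb_y (p : A) : x_to_y (emb_y p) = emb_y p.
Proof.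
rewrite /x_to_y /emb_y comp_mpolyA; congr comp_mpoly; apply: eq_from_tnth => i.
by rewrite !tnth_mktuple comp_mpolyXt tnth_mktuple (unsplitK (inr i)).
Qed.

Lemma emb_xy_alg (r : R) : emb_x (r%:A : A) = emb_y (r%:A : A).
Proof. by rewrite emb_xZ emb_yZ !rmorph1. Qed.

Lemma mpoly_xy_ind (P : B -> Prop) : (forall p q, P p -> P q -> P (p + q)) ->
  (forall p q : A, P (emb_x p * emb_y q)) -> forall q, P q.
Proof.
move=> PD PM q; rewrite (mpolyE q); apply: big_ind => //.
  by rewrite -(mul0r (emb_y 0)) -(rmorph0 (@emb_x R n)); apply: PM.
move=> m _; have -> : q@_m *: 'X_[m] =
    emb_x (q@_m *: 'X_[mon_x m]) * emb_y 'X_[mon_y m]; last exact: PM.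
rewrite emb_xZ -scalerAl; congr (_ *: _).
rewrite /emb_x /emb_y !comp_mpolyX [LHS]mpolyXE_id big_split_ord /=.
by congr (_ * _); apply: eq_bigr => i _; rewrite tnth_mktuple mnmE.
Qed.

Section Functional.
Variable r : 'I_n -> nat -> R.

(** The tensor product of the one-variable functionals sending x_l^j to r l j. *)
Definition mres (p : A) : R := \sum_(m <- msupp p) p@_m * \prod_l r l (m l).

Lemma mres_wide k p : (msize p <= k)%N ->
  mres p = \sum_(m : bmultinom n k) p@_m * \prod_l r l ((m : 'X_{1..n}) l).
Proof.
move=> le; pose I : subFinType _ := bmultinom n k.
rewrite /mres (big_mksub I) ?msupp_uniq //=; first last.
  by move=> x /msize_mdeg_lt /leq_trans; apply.
by rewrite big_rmcond //= => i; move/memN_msupp_eq0 ->; rewrite mul0r.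
Qed.

Fact mres_is_linear : linear_for *%R mres.
Proof.
move=> a p q; pose k := maxn (msize (a *: p + q)) (maxn (msize p) (msize q)).
rewrite !(@mres_wide k) ?leq_max ?leqnn ?orbT // mulr_sumr -big_split.
by apply: eq_bigr => m _; rewrite mcoeffD mcoeffZ mulrDl mulrA.
Qed.

HB.instance Definition _ := GRing.isLinear.Build R A R *%R mres mres_is_linear.

Lemma mresZ a p : mres (a *: p) = a * mres p.
Proof. by have := mres_is_linear a p 0; rewrite addr0 (raddf0 mres) addr0. Qed.

Lemma mres_sum (I : Type) (l : seq I) (F : I -> A) :
  mres (\sum_(i <- l) F i) = \sum_(i <- l) mres (F i).
Proof. exact: (raddf_sum mres). Qed.

Lemma mresX m : mres 'X_[m] = \prod_l r l (m l).
Proof. by rewrite /mres msuppX big_seq1 mcoeffX eqxx mul1r. Qed.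

Variables (D : nat) (c : 'I_n -> nat -> R).
Hypothesis r_rec : forall l m, \sum_(j < D.+2) c l j * r l (m + j)%N = 0.

Definition upoly (l : 'I_n) : A := \sum_(j < D.+2) c l j *: 'X_l ^+ j.

Lemma mres_upoly l p : mres (p * upoly l) = 0.
Proof.
rewrite (mpolyE p) mulr_suml mres_sum big1 // => m _.
rewrite -scalerAl mresZ /upoly [X in mres X]mulr_sumr mres_sum.
rewrite (eq_bigr (fun j : 'I_D.+2 => (\prod_(l' | l' != l) r l' (m l')) *
    (c l j * r l (m l + j)%N))) => [|j _].
  by rewrite -mulr_sumr r_rec !mulr0.
rewrite -scalerAr mresZ mpolyXn -mpolyXD mresX (bigD1 l) //=.
rewrite mulrC -mulrA mulrCA; congr (_ * _).
  apply: eq_bigr => l' neq; rewrite mnmDE mulmnE mnm1E eq_sym (negbTE neq).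
  by rewrite mul0n addn0.
by rewrite mnmDE mulmnE mnm1E eqxx mul1n mulrC.
Qed.

Fact mres0_is_linear : linear_for *%R (fun b : koszul_alg R n 0 => mres (b set0)).
Proof. by move=> a p q; rewrite !ffunE linearP. Qed.

Definition mres0 : {scalar koszul_alg R n 0} :=
  HB.pack (fun b : koszul_alg R n 0 => mres (b set0))
    (GRing.isLinear.Build R (koszul_alg R n 0) R *%R _ mres0_is_linear).

(* The A-linear extension of [mres], integrating the y variables. *)
Definition mres_y (q : B) : A := kernel_map (ext_const (0 + 0) q) mres0 set0.

Lemma mres_yD p q : mres_y (p + q) = mres_y p + mres_y q.
Proof.
have := kernel_map_is_linear mres0 1 (ext_const (0 + 0) p) (ext_const (0 + 0) q).
by rewrite !scale1r /mres_y rmorphD /= => ->; rewrite ffunE.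
Qed.

Lemma mres_y_xy p q : mres_y (emb_x p * emb_y q) = mres q *: p.
Proof.
have -> : mres_y (emb_x p * emb_y q) =
    kernel_map (wedge (ext_emb_x (ext_const 0 p)) (ext_emb_y (ext_const 0 q))) mres0 set0.
  rewrite /mres_y; congr (kernel_map _ _ _); apply/ffunP=> S; rewrite wedge_emb !ffunE.
  have e0 (T : {set 'I_0}) : T = set0 by apply/setP=> -[].
  by rewrite (e0 (set_x S)) (e0 (set_y S)) !eqxx (_ : S = set0) ?eqxx //; apply/setP=> -[].
by rewrite kernel_map_wedge ffunE /= twist_cst /ext_const !ext_monE eqxx.
Qed.

Hypothesis r_small : forall l j, (j < D)%N -> r l j = 0.
Hypothesis r_top : forall l, r l D = 1.
Hypothesis c_top : forall l, c l D.+1 = 1.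

(** The coefficient of y_l^j in (g_l(x_l) - g_l(y_l)) / (x_l - y_l); for j = D it is the leading
    coefficient 1. *)
Definition bezout_coef (l : 'I_n) (j : nat) : A :=
  \sum_(k < D.+2 | (j < k)%N) c l k *: 'X_l ^+ (k.-1 - j).

Definition bezout (l : 'I_n) : B :=
  \sum_(j < D.+1) emb_x (bezout_coef l j) * emb_y ('X_l ^+ j).

Lemma diff_bezout l : diff_xy R l * bezout l = emb_x (upoly l) - emb_y (upoly l).
Proof.
have -> : bezout l = \sum_(k < D.+2) c l k *:
    (\sum_(j < k) 'X_(lshift n l) ^+ (k.-1 - j) * 'X_(rshift n l) ^+ j).
  rewrite /bezout (eq_bigr (fun j : 'I_D.+1 => \sum_(k < D.+2 | (j < k)%N)
      c l k *: ('X_(lshift n l) ^+ (k.-1 - j) * 'X_(rshift n l) ^+ j))) => [|j _].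
    rewrite (exchange_big_dep xpredT) //=; apply: eq_bigr => k _.
    rewrite -scaler_sumr; congr (_ *: _).
    apply/esym/(big_ord_widen D.+1
      (fun j => 'X_(lshift n l) ^+ (k.-1 - j) * 'X_(rshift n l) ^+ j : B)).
    by rewrite -ltnS.
  rewrite rmorph_sum mulr_suml; apply: eq_bigr => k _ /=.
  by rewrite emb_xZ !rmorphXn /= emb_xX emb_yX scalerAl.
rewrite mulr_sumr !rmorph_sum -sumrB; apply: eq_bigr => k _ /=.
rewrite emb_xZ emb_yZ !rmorphXn /= emb_xX emb_yX -scalerBr -scalerAr subrXX.
by rewrite /diff_xy; congr (_ *: (_ * _)); apply: eq_bigr => j _; rewrite -subn1 subnAC subn1.
Qed.

(** The integral factors over the variables. In each of them only y_l^D survives, as r l j = 0 for j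
    < D, and its coefficient is 1. *)
Lemma mres_bezout : mres_y (\prod_l bezout l) = 1.
Proof.
rewrite /bezout bigA_distr_bigA /=.
have mres_y_sum (I : finType) (F : I -> B) : mres_y (\sum_i F i) = \sum_i mres_y (F i).
  apply: (big_morph _ mres_yD); apply: (addrI (mres_y 0)).
  by rewrite -mres_yD !addr0.
rewrite mres_y_sum.
rewrite (eq_bigr (fun p : {ffun 'I_n -> 'I_D.+1} =>
    \prod_l (r l (p l) *: bezout_coef l (p l)))) => [|p _].
  rewrite -(bigA_distr_bigA (fun l (j : 'I_D.+1) => r l j *: bezout_coef l j)).
  rewrite big1 // => l _; rewrite big_ord_recr /= big1 ?add0r => [|j _]; last first.
    by rewrite r_small ?scale0r.
  rewrite r_top scale1r /bezout_coef (big_pred1 ord_max) /= => [|k].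
    by rewrite c_top subnn expr0 scale1r.
  apply/idP/eqP => [ltDk|-> //]; apply/val_inj/eqP.
  by rewrite eqn_leq /= ltDk andbT -ltnS ltn_ord.
rewrite big_split -!rmorph_prod mres_y_xy scaler_prod; congr (_ *: _).
have -> : \prod_l 'X_l ^+ p l = 'X_[[multinom (p l : nat) | l < n]] :> A.
  by rewrite [RHS]mpolyXE_id; apply: eq_bigr => l _; rewrite mnmE.
by rewrite mresX; apply: eq_bigr => l _; rewrite mnmE.
Qed.

End Functional.
End PolynomialResidue.

(** * Duality *)

Lemma prod_cst_gen (B : comNzRingType) m (h : 'I_m -> B) (S : {set 'I_m}) :
  \prod_(l in S) (ext_const m (h l) * ext_gen B l) =
  ext_const m (\prod_(l in S) h l) * ext_mon 1 S.
Proof.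
rewrite -prod_gen; apply: (big_rec3 (fun x y z => x = ext_const m y * z)) => [|i x y z _ ->].
  by rewrite rmorph1 mulr1.
by rewrite -mulrA cst_commA rmorphM !mulrA.
Qed.

Section AbstractDuality.
Variables (R : comNzRingType) (A : comAlgType R) (B : comNzRingType) (n s : nat).
Variables (ex ey : {rmorphism A -> B}) (sw dg : {rmorphism B -> B}).
Variables (u : 'I_n -> B) (f : 'I_s -> A).
Local Notation C := (ext A s).
Local Notation cst := (@ext_const _ _).
Local Notation tw := (@ext_twist _ _).
Local Notation d := (koszul f).
Local Notation X := (@ext_x A B ex s).
Local Notation Y := (@ext_y A B ey s).
Hypotheses (sw_x : forall p, sw (ex p) = ey p) (sw_y : forall p, sw (ey p) = ex p).
Hypothesis sw_u : forall k, sw (u k) = - u k.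
Hypotheses (dg_x : forall p, dg (ex p) = ey p) (dg_y : forall p, dg (ey p) = ey p).
Hypothesis B_ind : forall P : B -> Prop, (forall p q, P p -> P q -> P (p + q)) ->
  (forall p q, P (ex p * ey q)) -> forall q, P q.
Hypothesis exy_alg : forall r : R, ex r%:A = ey r%:A.

Variable nabla : ext B n -> ext B n.
Hypothesis nablaD : forall a b, nabla (a + b) = nabla a + nabla b.
Hypothesis nablaZ : forall q a, nabla (cst (ey q) * a) = cst (ey q) * nabla a.
Hypothesis nabla_deg : degree_one nabla.
Hypothesis nabla_htpy :
  forall c, koszul u (nabla c) + nabla (koszul u c) = c - cst (dg (c set0)).

Definition nabla_mx (k : 'I_n) (i : 'I_s) : B := nabla (cst (ex (f i))) [set k].

Lemma nabla_mxP : diff_quot ex ey u f nabla_mx.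
Proof.
move=> i; have n0 := nabla0 nablaD.
have := nabla_htpy (cst (ex (f i))); rewrite koszul_cst n0 addr0 ffunE eqxx dg_x.
move/(congr1 (fun c : ext B n => c set0)); rewrite -rmorphB [RHS]ffunE eqxx => <-.
rewrite ffunE; apply: eq_big => [k|k _]; first by rewrite inE.
by rewrite sgn0r mul1r setU0.
Qed.

Lemma swap_mxP : diff_quot ex ey u f (fun k i => sw (nabla_mx k i)).
Proof.
move=> i; have := congr1 sw (nabla_mxP i); rewrite rmorphB sw_x sw_y rmorph_sum /=.
move/(congr1 -%R); rewrite opprB => ->; rewrite -sumrN; apply: eq_bigr => k _.
by rewrite rmorphM sw_u mulNr opprK.
Qed.

Variable KM : ext B (s + s) -> (C -> R) -> C.
Hypothesis KM_D : forall G H c, KM (G + H) c = KM G c + KM H c.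
Hypothesis KM_xy : forall (c : {scalar C}) p b, KM (X p * Y b) c = c (tw b) *: p.

(** The exponent of the sign in [jacE]. *)
Let m := (n + n * (s - n))%N.
Definition djac : ext B (s + s) := (-1) ^+ m * jac nabla_mx.

Lemma has_deg_djac : has_deg (s - n) djac.
Proof. by rewrite /djac -(rmorph_sign cst); apply/has_degZ/has_deg_jac. Qed.

Lemma koszul_djac : koszul_xy ex ey f djac = 0.
Proof.
rewrite /djac -(rmorph_sign cst) /koszul_xy koszul_cstM -/(koszul_xy ex ey f _).
by rewrite (koszul_jac nabla_mxP) mulr0.
Qed.

Lemma sign_sub : (n <= s)%N -> (-1) ^+ (s - n) = (-1) ^+ (n + s) :> R.
Proof. by move=> le_ns; rewrite -signr_odd oddB // addbC -oddD signr_odd. Qed.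

Lemma koszul_KM_djac (c : {scalar C}) :
  d (KM djac c) = (-1) ^+ (n + s)%N *: KM djac (ddiff f c).
Proof.
have [le_ns|lt_sn] := leqP n s; last first.
  by rewrite /djac jac_gt // mulr0 !(KM0 KM_D) raddf0 scaler0.
rewrite (koszul_KM f B_ind KM_D KM_xy _ has_deg_djac) koszul_djac (KM0 KM_D) add0r.
by rewrite ext_sign sign_sub.
Qed.

Variables (al : 'I_n -> 'I_s -> A) (rho : {scalar A}) (Rho : B -> A).
Hypothesis Rho_D : forall p q, Rho (p + q) = Rho p + Rho q.
Hypothesis Rho_xy : forall p q, Rho (ex p * ey q) = rho q *: p.
Let g l := \sum_i al l i * f i.
Hypothesis rho_g : forall l p, rho (p * g l) = 0.
Variable h : 'I_n -> B.
Hypothesis u_h : forall l, u l * h l = ex (g l) - ey (g l).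
Hypothesis Rho_h : Rho (\prod_l h l) = 1.

(** The sign cancels (-1)^(n s) from [KM_jac_residue] and (-1)^m from [djac]. *)
Definition dual_one : {scalar C} := rscale ((-1) ^+ (n * s + m)) (residue al rho).

Lemma dual_one_codeg : codeg (s - n) dual_one.
Proof.
by move=> r b br neq; rewrite /= /rscale /= (residue_codeg _ _ br) ?mulr0.
Qed.

Lemma dual_one_gt b : (s < n)%N -> dual_one b = 0.
Proof. by move=> lt_sn; rewrite /= /rscale /= residue_gt ?mulr0. Qed.

Lemma dual_one_cycle b : ddiff f dual_one b = 0.
Proof.
have := residue_cycle rho_g b; rewrite /ddiff /= /rscale /= => /eqP; rewrite oppr_eq0.
by move=> /eqP->; rewrite mulr0 oppr0.
Qed.

(** Stated for all difference quotients, since the left homotopy needs it for the exchanged matrix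
    [swap_mxP], whereas nabla enters only as a contraction. *)
Lemma KM_dual_one D : diff_quot ex ey u f D ->
  exists2 t, has_deg 1 t & KM ((-1) ^+ m * jac D) dual_one = 1 + d t.
Proof.
move=> DP; pose T l := ext_const n (h l) * ext_gen B l.
have T_odd l : has_deg 1 (T l) by apply/has_degZ/has_deg_gen.
have koszul_T l : koszul u (T l) = cst (ex (g l) - ey (g l)).
  by rewrite koszul_cstM koszul_gen -rmorphM mulrC u_h.
have Rho_T : Rho ((\prod_(l in [set: 'I_n]) T l) setT) = 1.
  rewrite prod_cst_gen cstE ext_monE eqxx mulr1 -Rho_h; congr Rho.
  by apply: eq_bigl => l; rewrite inE.
have [hh E] := KM_jac_residue B_ind KM_D KM_xy Rho_D Rho_xy rho_g dg_x (nabla0 nablaD)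
  nabla_deg nabla_htpy DP T_odd koszul_T Rho_T.
exists (\sum_i cst (hh i) * ext_gen A i).
  by apply: has_deg_sum => i _; apply/has_degZ/has_deg_gen.
rewrite (KM_sign KM_D) (KM_rscale B_ind KM_D KM_xy) E !ext_sign !scalerA -!exprD.
rewrite -signr_odd !oddD; case: (odd (n * s)); case: (odd n); case: (odd (n * (s - n)));
  by rewrite ?expr0 scale1r.
Qed.

Theorem abstract_duality : exists (t : C) (Rop Lop : {linear C -> C}),
  [/\ KM djac dual_one = 1 + d t, degree_one Rop, degree_one Lop,
      forall a, a - KM djac (dact dual_one a) = d (Rop a) + Rop (d a)
    & forall (c : {scalar C}) b,
        c b - dact dual_one (KM djac c) b = c (d (Lop b) + Lop (d b))].
Proof.
have [t t1 KMt] := KM_dual_one nabla_mxP; have [t' t'1 KMt'] := KM_dual_one swap_mxP.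
pose H a : ext B (s + s) := (-1) ^+ m * jac_homotopy ex nabla nabla_mx a.
have H_D a b : H (a + b) = H a + H b.
  by rewrite /H jac_homotopyD // mulrDr.
have H_Z (r : R) a : H (r *: a) = cst (ex r%:A) * H a.
  rewrite /H ext_scaleE_cst (jac_homotopyM _ nablaZ) //.
  by rewrite -(rmorph_sign (@ext_const B (s + s))) cst_commA.
have H_htpy a : (X a - Y a) * djac = koszul_xy ex ey f (H a) + H (d a).
  rewrite /H /djac -!(rmorph_sign (@ext_const B (s + s))) cst_commA.
  rewrite (jac_homotopyP dg_x dg_y nablaD nablaZ nabla_deg nabla_htpy nabla_mxP) mulrDr.
  by rewrite /koszul_xy koszul_cstM.
have H_deg : (forall b, dual_one b = 0) \/
    forall r a, has_deg r a -> has_deg (r.+1 + (s - n)) (H a).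
  have [le_ns|lt_sn] := leqP n s; last by left=> b; apply: dual_one_gt.
  right=> r a ar; rewrite /H -(rmorph_sign cst); apply: has_degZ.
  exact: has_deg_jac_homotopy.
have swapJ : ext_swap sw djac =
    (-1) ^+ (s - n) * ((-1) ^+ m * jac (fun k i => sw (nabla_mx k i))).
  rewrite /djac -(rmorph_sign (@ext_const B (s + s))) ext_swapM.
  have -> : ext_swap sw (ext_const (s + s) ((-1) ^+ m)) = ext_const (s + s) ((-1) ^+ m).
    by rewrite /ext_swap extmap_cst rmorph_sign.
  rewrite swap_jac -(rmorph_sign (@ext_const B (s + s))) cst_commA !rmorph_sign.
  have [le_ns|lt_sn] := leqP n s; last by rewrite (jac_gt _ lt_sn) !mulr0.
  by congr (_ * _); rewrite -[LHS]signr_odd -[RHS]signr_odd oddB // oddD addbC.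
exists t; pose Ro := right_op KM H dual_one t; pose Lo := left_op sw KM (s - n) H dual_one t'.
have Rl : linear Ro by apply: (right_op_linear B_ind KM_D KM_xy).
have Ll : linear Lo by apply: (left_op_linear sw_x B_ind exy_alg KM_D KM_xy).
pose Rop : {linear C -> C} := HB.pack Ro (GRing.isLinear.Build R C C *:%R Ro Rl).
pose Lop : {linear C -> C} := HB.pack Lo (GRing.isLinear.Build R C C *:%R Lo Ll).
exists Rop, Lop; split=> //.
- exact: (right_op_deg B_ind KM_D KM_xy dual_one_codeg H_deg t1).
- by apply: (left_op_deg sw B_ind KM_D KM_xy dual_one_codeg H_deg t'1).
- exact: (right_homotopy B_ind KM_D KM_xy has_deg_djac dual_one_codeg dual_one_cycle
    H_htpy KMt).
exact: (left_homotopy sw_x sw_y B_ind KM_D KM_xy has_deg_djac dual_one_codeg dual_one_cycle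
  H_htpy swapJ KMt').
Qed.

End AbstractDuality.

(** * Specialisation to R[x] and R[x, y] *)

Section PolynomialKoszul.
Variables (R : comNzRingType) (n s : nat).
Local Notation A := {mpoly R[n]}.
Local Notation B := {mpoly R[n + n]}.
Local Notation C := (koszul_alg R n s).

Lemma ext_emb_x_ext_x (a : C) : ext_emb_x a = ext_x (@emb_x R n) a.
Proof.
apply: eq_bigr => I _.
have := einl_mon s (1 : B) I; rewrite /einl extmap_mon rmorph1 mul1r => ->.
by rewrite cst_mon mulr1.
Qed.

Lemma ext_emb_y_ext_y (a : C) : ext_emb_y a = ext_y (@emb_y R n) a.
Proof.
apply: eq_bigr => I _.
have := einr_mon s (1 : B) I; rewrite /einr extmap_mon rmorph1 mul1r => ->.
by rewrite cst_mon mulr1.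
Qed.

Lemma kernel_mapD (G H : ext B (s + s)) (c : C -> R) :
  kernel_map (G + H) c = kernel_map G c + kernel_map H c.
Proof. by have := kernel_map_is_linear c 1 G H; rewrite !scale1r. Qed.

Lemma kernel_map_xy (c : {scalar C}) (p b : C) :
  kernel_map (ext_x (@emb_x R n) p * ext_y (@emb_y R n) b) c = c (ext_twist b) *: p.
Proof. by rewrite -kernel_map_wedge ext_emb_x_ext_x ext_emb_y_ext_y. Qed.

Lemma difference_jacobianE (f : 'I_s -> A) nabla :
  difference_jacobian nabla f = djac (@emb_x R n) f nabla.
Proof.
rewrite /djac jacE mulrA -exprD -signr_odd oddD addbb mul1r.
apply: eq_bigr => I _; rewrite ext_scaleE; congr (_ * _).
by rewrite -prod_enum_set.
Qed.

End PolynomialKoszul.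

Theorem theorem4 (R : comNzRingType) (n s : nat) (f : 'I_s -> {mpoly R[n]})
    (nabla : ext {mpoly R[n + n]} n -> ext {mpoly R[n + n]} n)
    (nablaP : difference_homotopy nabla)
    (H0_fin_gen : fin_gen_quotient f) :
  let d := koszul f in
  let Phi := kernel_map (difference_jacobian nabla f) in
  (exists (e : {scalar koszul_alg R n s}) (t : koszul_alg R n s),
    [/\ dual_has_deg (n%:Z - s%:Z) e,
        dual_cycle f e &
        Phi e = ext_one {mpoly R[n]} s + d t] /\
    (forall c : {scalar koszul_alg R n s},
       d (Phi c) = (-1) ^+ (n + s)%N *: Phi (dual_diff f c)) /\
    (forall c b : koszul_alg R n s,
       dual_diff f (dual_act e c) b = (-1) ^+ (n + s)%N * dual_act e (d c) b) /\
    exists Rop Lop : {linear koszul_alg R n s -> koszul_alg R n s},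
      [/\ degree_one Rop, degree_one Lop &
        [/\ forall c : koszul_alg R n s,
              c - Phi (dual_act e c) = d (Rop c) + Rop (d c),
            forall (c : {scalar koszul_alg R n s}) (b : koszul_alg R n s),
              c b - dual_act e (Phi c) b = c (d (Lop b) + Lop (d b)),
            forall c : koszul_alg R n s, d c = 0 ->
              c - Phi (dual_act e c) = d (Rop c)
          & forall (c : {scalar koszul_alg R n s}) (r : int) (b : koszul_alg R n s),
              dual_has_deg r c -> dual_cycle f c ->
              c b - dual_act e (Phi c) b =
              dual_diff f (fun a => (-1) ^+ `|r|%N * c (Lop a)) b]]) /\
  fin_gen_homology f 0 /\
  fin_gen_dual_homology f (n%:Z - s%:Z).
Proof.
move=> d Phi; case: (nablaP) => nD nZ' ndeg nH.
have nZ q a : nabla (ext_const n (emb_y q) * a) = ext_const n (emb_y q) * nabla a.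
  by rewrite -!ext_scaleE nZ'.
have [k [chi [al chiP]]] := monic_in_ideal H0_fin_gen.
have rE l : exists r : nat -> R, [/\ forall j, (j < k)%N -> r j = 0, r k = 1 &
    forall m, \sum_(j < k.+2) (chi l)`_j * r (m + j)%N = 0].
  by have [mon sz _] := chiP l; apply: dual_basis_seq.
have [r rP] := fin_all_exists rE.
pose c l j := (chi l)`_j; pose h := bezout k c.
have r_rec l m : \sum_(j < k.+2) c l j * r l (m + j)%N = 0 by have [] := rP l.
have r_small l j : (j < k)%N -> r l j = 0 by have [+ _ _] := rP l; apply.
have r_top l : r l k = 1 by have [] := rP l.
have c_top l : c l k.+1 = 1.
  by have [/monicP + sz _] := chiP l; rewrite lead_coefE sz.
have gE l : \sum_i al l i * f i = upoly k c l by have [_ _ <-] := chiP l.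
have rho_g l p : mres r (p * (\sum_i al l i * f i)) = 0 by rewrite gE mres_upoly.
have u_h l : diff_xy R l * h l =
    emb_x (\sum_i al l i * f i) - emb_y (\sum_i al l i * f i).
  by rewrite gE diff_bezout.
have Rho_h : mres_y r (\prod_l h l) = 1 by apply: mres_bezout.
have B_ind := @mpoly_xy_ind R n.
have := @abstract_duality R {mpoly R[n]} {mpoly R[n + n]} n s (@emb_x R n) (@emb_y R n)
  (@swap_xy R n) (@x_to_y R n) (@diff_xy R n) f (@swap_emb_x R n) (@swap_emb_y R n)
  (@swap_diff R n) (@x_to_y_emb_x R n) (@x_to_y_emb_y R n) B_ind (@emb_xy_alg R n)
  nabla nD nZ ndeg nH (@kernel_map R n s) (@kernel_mapD R n s) (@kernel_map_xy R n s)
  al (mres r) (mres_y r) (mres_yD r) (mres_y_xy r) rho_g h u_h Rho_h.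
rewrite -difference_jacobianE.
move=> [t [Rop [Lop [KMt Rdeg Ldeg Rhtpy Lhtpy]]]].
have e_deg := dual_one_codeg (s := s) al (mres r).
have e_gt b := dual_one_gt (s := s) al (mres r) b.
have e_cyc := dual_one_cycle rho_g.
have dPhi : forall c : {scalar koszul_alg R n s},
    d (Phi c) = (-1) ^+ (n + s)%N *: Phi (dual_diff f c).
  move=> c'; rewrite /Phi difference_jacobianE.
  exact: (@koszul_KM_djac R {mpoly R[n]} {mpoly R[n + n]} n s (@emb_x R n) (@emb_y R n)
    (@x_to_y R n) (@diff_xy R n) f (@x_to_y_emb_x R n) B_ind nabla nD nH
    (@kernel_map R n s) (@kernel_mapD R n s) (@kernel_map_xy R n s)).
set e := dual_one (s := s) al (mres r) in KMt Rhtpy Lhtpy e_deg e_gt e_cyc.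
have e_dual : dual_has_deg (n%:Z - s%:Z) e.
  move=> q b bq neq; have [le_ns|lt_sn] := leqP n s; last exact: e_gt.
  apply: (e_deg q) => //; apply: contraNneq neq => ->.
  by rewrite opprB subzn.
have e_act : forall c b : koszul_alg R n s,
    dual_diff f (dual_act e c) b = (-1) ^+ (n + s)%N * dual_act e (d c) b.
  move=> a b; have [le_ns|lt_sn] := leqP n s.
    by rewrite -sign_sub //; apply: (ddiff_dact _ _ e_deg e_cyc).
  by rewrite /dual_diff /dual_act !e_gt // oppr0 mulr0.
have htpy4 (c' : {scalar koszul_alg R n s}) (q : int) (b : koszul_alg R n s) :
    dual_has_deg q c' -> dual_cycle f c' ->
    c' b - dual_act e (Phi c') b =
    dual_diff f (fun a => (-1) ^+ `|q|%N * c' (Lop a)) b.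
  move=> c'q c'cyc; rewrite [LHS]Lhtpy linearD /= (cycle_koszul c'cyc) add0r.
  rewrite /dual_diff.
  (* An operator of degree 1 anticommutes with the twist; this produces the sign in the fourth
     formula. *)
  have -> : Lop (ext_twist (koszul f b)) = - ext_twist (Lop (koszul f b)).
    elim/ext_deg_ind: (koszul f b) => [x y IHx IHy|j x xj].
      by rewrite raddfD !linearD /= IHx IHy raddfD opprD.
    rewrite (twist_deg xj) (twist_deg (Ldeg _ _ xj)) !ext_sign linearZ /= exprS.
    by rewrite mulN1r scaleNr opprK.
  rewrite linearN /= (dual_twist_homog _ c'q) mulrN opprK mulrA -exprD.
  by rewrite -signr_odd oddD addbb mul1r.
split; [exists e, t; split; [|split; [|split]] => //|].
- exists Rop, Lop; split=> //; split=> // a da.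
  by rewrite [LHS]Rhtpy [koszul f a]da linear0 addr0.
have [k' [z zP]] := H0_fin_gen.
have dgen (h' : 'I_s -> {mpoly R[n]}) :
    d (\sum_j ext_const s (h' j) * ext_gen _ j) = ext_const s (\sum_j h' j * f j).
  rewrite /d [LHS]raddf_sum [RHS]rmorph_sum; apply: eq_bigr => j _ /=.
  by rewrite koszul_cstM koszul_gen rmorphM.
have degen (h' : 'I_s -> {mpoly R[n]}) :
    has_deg 1 (\sum_j ext_const s (h' j) * ext_gen _ j).
  by apply: has_deg_sum => j _; apply/has_degZ/has_deg_gen.
have H0 (a : koszul_alg R n s) : has_deg 0 a -> exists (g : 'I_k' -> R) (w : koszul_alg R n s),
    has_deg 1 w /\ a = \sum_i g i *: (ext_const s (z i) : koszul_alg R n s) + d w.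
  move=> a0; have [g [h' E]] := zP (a set0).
  exists g, (\sum_j ext_const s (h' j) * ext_gen _ j); split => //.
  rewrite dgen (has_deg0E a0) E rmorphD; congr (_ + _).
  rewrite rmorph_sum; apply: eq_bigr => i _ /=.
  by rewrite ext_scaleE_cst -rmorphM mulr_algl.
split.
  exists k', (fun i => ext_const s (z i)); split.
    by move=> i; split; [apply: has_deg_cst | apply: koszul_cst].
  by move=> a a0 _; apply: H0.
(* The generators are the images e . z_i of the generators of R[x]/(f). *)
exists k', (fun i => dact e (ext_const s (z i)) : {scalar koszul_alg R n s}); split.
  move=> i; split.
    move=> q b bq neq; apply: (e_dual q) => //.
    by rewrite -[q]add0n; apply: has_degM => //; apply: has_deg_cst.
  move=> b; rewrite [LHS]e_act /d koszul_cst /dual_act (mul0r b : wedge 0 b = 0).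
  by rewrite linear0 mulr0.
move=> c' c'deg c'cyc.
have Phi0 : has_deg 0 (Phi c').
  rewrite /Phi difference_jacobianE; have [le_ns|lt_sn] := leqP n s; last first.
    rewrite /djac jac_gt // mulr0 (KM0 (@kernel_mapD R n s)); exact: has_deg0.
  have c'_deg : codeg (s - n) c'.
    move=> q b bq neq; apply: (c'deg q) => //; apply: contraNneq neq.
    by rewrite opprB subzn // => -[->].
  apply: (has_deg_KM B_ind (@kernel_mapD R n s) (@kernel_map_xy R n s) c'_deg).
  rewrite add0n; exact: has_deg_djac.
have [g [w [w1 E]]] := H0 _ Phi0.
(* The first term has boundary c' - e . Phi(c'). Since Phi(c') is the sum of the g_i z_i plus d w,
   there remains e . d w, which up to sign is the boundary of e . w, the second term. *)
pose W0 (b : koszul_alg R n s) : R :=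
  (-1) ^+ `|(n%:Z - s%:Z)%R|%N * c' (Lop b) + (-1) ^+ (n + s)%N * e (w * b).
have W_lin : linear_for *%R W0.
  move=> x a b; rewrite /W0 [Lop _]linearP [c' _]linearP [w * _]mulrDr ext_scaleAr.
  rewrite [e _]linearP /=; ring.
pose W : {scalar koszul_alg R n s} :=
  HB.pack W0 (GRing.isLinear.Build R (koszul_alg R n s) R *%R W0 W_lin).
exists g, W; split.
  move=> q b bq neq; rewrite /= /W0 (c'deg _ _ (Ldeg _ _ bq)); last first.
    by apply: contraNneq neq => E1; rewrite opprD -E1 -addn1 PoszD addrK.
  rewrite (e_dual _ _ (has_degM w1 bq)); last first.
    by apply: contraNneq neq => E1; rewrite opprD -E1 PoszD addrC addKr.
  by rewrite !mulr0 addr0.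
move=> b; have := htpy4 _ _ b c'deg c'cyc; move/eqP; rewrite subr_eq => /eqP ->.
rewrite addrC E {1}/dual_act.
have -> : wedge (\sum_i g i *: (ext_const s (z i) : koszul_alg R n s) + d w) b =
    \sum_i g i *: (ext_const s (z i) * b) + d w * b.
  rewrite -[LHS]/(_ * b) mulrDl mulr_suml; congr (_ + _); apply: eq_bigr => i _.
  exact: ext_scaleAl.
rewrite linearD linear_sum /= -addrA; congr (_ + _).
  by apply: eq_bigr => i _; rewrite linearZ.
have -> : e (d w * b) = (-1) ^+ (n + s) * dual_diff f (dual_act e w) b.
  by rewrite e_act mulrA -exprD -signr_odd oddD addbb mul1r.
rewrite /dual_diff /= /W0 /dual_act opprD addrC mulrN; congr (_ + _).
Qed.
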